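(* Let $P$ be a rank-1 Hermitian projector-valued function on $\overline{\mathbb{C}}$, with components differentiable at least $N+2$ times, which is a solution of the Euler-Lagrange equations $[\partial_+\partial_-P,P]=0$ with finite action $S(P)<\infty$, and let $F$ be the associated surface in $su(N)$. Then every element $Q$ of the sequence of projectors $P,\ \Pi_+^kP,\ \Pi_-^kP$ ($k\ge 1$) obtained from $P$ by repeated application of the raising and lowering operators is normal to the surface: $$(Q,\partial_+F)=0\qquad\text{and}\qquad (Q,\partial_-F)=0 .$$
   Context: Coordinates: $(\xi_1,\xi_2)\in\mathbb{R}^2$, $\xi_\pm=\xi_1\pm i\xi_2$, $\partial_\pm=\partial/\partial\xi_\pm=\frac12\left(\frac{\partial}{\partial \xi_1}\mp i\frac{\partial}{\partial\xi_2}\right)$. $\overline{\mathbb{C}}=\mathbb{C}\cup\{\infty\}$, with differentiability at $\infty$ meant in the coordinate $w_\pm=\xi_\pm^{-1}$. A rank-1 Hermitian projector (function) is an $N\times N$ complex matrix function $P$ of $(\xi_1,\xi_2)$ (not assumed holomorphic) with $P^2=P$, $P^\dagger=P$, $\mathrm{tr}(P)=1$ pointwise. The action is $S(P)=\int_{\mathbb{R}^2}\mathrm{tr}(\partial_+P\,\partial_-P)\,d\xi_1d\xi_2$. Raising and lowering operators: for a Hermitian projector function $X$, $$\Pi_\pm(X)=\frac{\partial_\pm X\,X\,\partial_\mp X}{\mathrm{tr}(\partial_\pm X\,X\,\partial_\mp X)}\ \text{ if } \partial_\pm X\,X\,\partial_\mp X\neq 0,\qquad \Pi_\pm(X)=0\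 \text{ if }\partial_\pm X\,X\,\partial_\mp X= 0.$$ Here ''$=0$'' means identically zero as a matrix function, and in the first case the quotient is extended by continuity across the zeros of its denominator. Set $\Pi_\pm^0(X)=X$ and $\Pi_\pm^k(X)=\Pi_\pm(\Pi_\pm^{k-1}(X))$. Associated surface: $F:\mathbb{R}^2\to su(N)$ is obtained (up to an additive constant) by integrating the closed skew-Hermitian one-form $dF=i\left(-[\partial_+P,P]\,d\xi_++[\partial_-P,P]\,d\xi_-\right)$. The bilinear product is $(A,B)=-\frac12\mathrm{tr}(AB)$ on $su(N)$, extended by the same formula to all $N\times N$ complex matrices. *)

(* Defs.v *)
From mathcomp Require Import all_boot all_order all_algebra.
From mathcomp Require Import complex.
From mathcomp Require Import all_classical all_reals all_analysis.

Set Implicit Arguments.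
Unset Strict Implicit.
Unset Printing Implicit Defensive.

Import Order.TTheory GRing.Theory Num.Theory.
Import numFieldNormedType.Exports.

Local Open Scope classical_set_scope.
Local Open Scope ring_scope.
Local Open Scope complex_scope.

(* The plane is R * R, with coordinates xi = (xi_1, xi_2).  R[i] carries no
   topology in the libraries, so every analytic notion for matrix functions
   over R[i] is taken on the real and imaginary parts of the entries. *)

Section MatrixFunctions.
Variables (R : realType) (N : nat).

Definition mxfun := R * R -> 'M[R[i]]_N.

Implicit Types (A X P F Q : mxfun) (x h : R * R).

Definition re_entry A (j k : 'I_N) : R * R -> R := fun y => complex.Re (A y j k).
Definition im_entry A (j k : 'I_N) : R * R -> R := fun y => complex.Im (A y j k).

Definition mx_derive h A : mxfun := fun x =>
  \matrix_(j, k) ('D_h (re_entry A j k) x +i* 'D_h (im_entry A j k) x).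

(* f is n times (Frechet) differentiable on the plane; continuity of the
   derivatives of order n is not required. *)
Fixpoint n_differentiable (n : nat) (f : R * R -> R) : Prop :=
  if n is m.+1 then
    [/\ forall x, differentiable f x,
        n_differentiable m (fun x => 'D_(1, 0) f x) &
        n_differentiable m (fun x => 'D_(0, 1) f x)]
  else True.

Definition mx_n_differentiable (n : nat) A : Prop :=
  forall j k, n_differentiable n (re_entry A j k) /\
              n_differentiable n (im_entry A j k).

Definition dplus A : mxfun := fun x =>
  2^-1 *: (mx_derive (1, 0) A x - 'i%C *: mx_derive (0, 1) A x).
Definition dminus A : mxfun := fun x =>
  2^-1 *: (mx_derive (1, 0) A x + 'i%C *: mx_derive (0, 1) A x).

Definition commutator (A B : 'M[R[i]]_N) : 'M[R[i]]_N := A *m B - B *m A.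

Definition adjoint (A : 'M[R[i]]_N) : 'M[R[i]]_N := (map_mx conjc A)^T.

Definition rank1_projector (A : 'M[R[i]]_N) : Prop :=
  [/\ A *m A = A, adjoint A = A & \tr A = 1].

(* The Riemann sphere: Some xi is the finite point xi, None is infinity. *)
Definition sphere : Type := @one_point_compactification (R * R).

Definition recip (w : R * R) : R * R :=
  let z := (w.1 +i* w.2)^-1 in (complex.Re z, complex.Im z).

Definition finite_chart (P : sphere -> 'M[R[i]]_N) : mxfun := fun x => P (Some x).

(* P in the coordinate w = 1 / xi, with infinity at w = 0. *)
Definition infinite_chart (P : sphere -> 'M[R[i]]_N) : mxfun := fun w =>
  if w == 0 then P None else P (Some (recip w)).

Definition sphere_n_differentiable (n : nat) (P : sphere -> 'M[R[i]]_N) : Prop :=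
  mx_n_differentiable n (finite_chart P) /\
  mx_n_differentiable n (infinite_chart P).

Definition euler_lagrange P : Prop :=
  forall x, commutator (dplus (dminus P) x) (P x) = 0.

(* For Hermitian P one has dminus P = adjoint of dplus P, so the trace is a
   nonnegative real number and its real part is the whole integrand. *)
Definition action P : \bar R :=
  (\int[lebesgue_measure \x lebesgue_measure]_x
     (complex.Re (\tr (dplus P x *m dminus P x)))%:E)%E.

(* The value is meaningful only if D accumulates at x and the limit exists. *)
Definition mx_lim_within (D : set (R * R)) A x : 'M[R[i]]_N :=
  \matrix_(j, k) (lim (re_entry A j k @ within D (nbhs x)) +i*
                  lim (im_entry A j k @ within D (nbhs x))).

(* Common form of Pi_+ and Pi_-.  Unless the numerator vanishes identically,
   the quotient is extended by its limit along the points where its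
   denominator is nonzero. *)
Definition ladder (d d' : mxfun -> mxfun) X : mxfun :=
  let num : mxfun := fun x => d X x *m X x *m d' X x in
  let quot : mxfun := fun x => (\tr (num x))^-1 *: num x in
  if `[< forall x, num x = 0 >] then fun=> 0
  else fun x => if \tr (num x) != 0 then quot x
                else mx_lim_within [set y | \tr (num y) != 0] quot x.

Definition raising : mxfun -> mxfun := ladder dplus dminus.
Definition lowering : mxfun -> mxfun := ladder dminus dplus.

(* k = 0 gives P itself. *)
Definition in_projector_sequence P Q : Prop :=
  exists k : nat, Q = iter k raising P \/ Q = iter k lowering P.

Definition in_su (A : 'M[R[i]]_N) : Prop := adjoint A = - A /\ \tr A = 0.

(* F is an su(N)-valued primitive of
     i (- [dplus P, P] dxi_+ + [dminus P, P] dxi_-);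
   dF at x in the direction h is the directional derivative, and
   dxi_+ (h) = h.1 + i h.2, dxi_- (h) = h.1 - i h.2. *)
Definition associated_surface P F : Prop :=
  [/\ forall x, in_su (F x),
      forall j k x, differentiable (re_entry F j k) x /\
                    differentiable (im_entry F j k) x &
      forall x h, mx_derive h F x =
        'i%C *: (- ((h.1 +i* h.2) *: commutator (dplus P x) (P x))
                 + (h.1 -i* h.2) *: commutator (dminus P x) (P x))].

(* The product of su(N), by the same formula on all complex matrices. *)
Definition su_product (A B : 'M[R[i]]_N) : R[i] := - 2^-1 * \tr (A *m B).

End MatrixFunctions.

(* Main.v *)
Require Import Defs.
From HB Require Import structures.
From mathcomp Require Import all_boot all_order all_algebra.
From mathcomp Require Import complex ring lra zify.
From mathcomp Require Import all_classical all_reals all_analysis.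

(** The case k = 0 is cyclicity of the trace.  For k >= 1 it is enough that the
projector Q is orthogonal to P, that is P Q = Q P = 0, since then both terms of
tr (Q [X, P]) vanish (tr_commutator).  So the theorem says that the harmonic
sequence generated by a harmonic map from the sphere is orthogonal to its
initial term.  Write d_+ and d_- for the operators dplus and dminus.

The sphere enters as follows.  Let D_t X = (1 - P) d_t X P (twisted) be the
derivative of homomorphisms from the line of P to its orthogonal complement, and
let A_0 = d_- P P, A_(n+1) = D_- A_n (oscul).  The Euler-Lagrange equation says
D_+ A_0 = 0, and the commutator of D_+ and D_- (curvature_formula) shows by
induction that D_+ A_n is a combination of the A_i with i < n.  Therefore the
function tr (d_- P A_n) is annihilated by d_+.  In the coordinate w = 1 / xi the
operator d_- acquires the factor conj(w)^2, so this function tends to 0 at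
infinity, and by Liouville it is zero: d_- P A_n = 0 (oscul_system).  The spaces
reached from P by raising and by lowering are therefore orthogonal.

Let K be the orthogonal projector on the span of the A_n.  It is built one
dimension at a time (osculating_projector).  If K is the projector on the span
of the A_i with i < j, then T = (1 - K) A_j satisfies d_+ T = L T + T M with smooth
L and M.  Solutions of such systems have the unique continuation property
(unique_continuation), so the set where T does not vanish is empty or dense and
connected, and in the second case K plus the projector on the range of T is the
next stage.  Traces bound the number of stages.  When T = 0 one finds
d_+ K = - P d_+ P and d_- K = - d_- P P.  These are also the derivatives of
(i F - P) / 2, where F is the associated surface; so K extends from a dense
connected open set to the whole plane as (i F - P) / 2 plus a constant
(osculating_extension_exists).

The pairs (K, P) and (1 - K - P, P) are then such that K and K + P project on
holomorphic (respectively antiholomorphic) subbundles, the line of P being the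
only new direction of the derivative (holo_pair).  One application of Pi_+
(respectively Pi_-) either gives 0 or turns the pair (K, P) into
(K + P, Pi_+ P) (ladder_step).  Every later term is orthogonal to the partial
sums, in particular to P (ladder_orthogonal).  The zeros of d_+ P P are harmless:
in a holomorphic frame this matrix is holomorphic modulo the range of K + P,
hence near each point it is a scalar function times a nonvanishing matrix
function (local_factorP), and the limit in the definition of Pi_+ is the value
of a smooth projector.

Complex-valued functions are handled through real and imaginary parts.  The
maximum principle comes from second-order expansions, and power series come from
iterated divided differences, so that no contour integrals occur. *)

Set Implicit Arguments.
Unset Strict Implicit.
Unset Printing Implicit Defensive.

Import Order.TTheory GRing.Theory Num.Theory.
Import numFieldNormedType.Exports.

Local Open Scope classical_set_scope.
Local Open Scope ring_scope.
Local Open Scope complex_scope.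

(** * Repeated differentiability of real functions on the plane *)

Section RealCalculus.
Context {R : realType}.
Implicit Types (f g : R * R -> R) (x h : R * R) (D : set (R * R)).

(** The derivative at x is given by the two partial derivatives a and b; a workable
    form of differentiability for estimates. *)
Definition frechet f x (a b : R) : Prop :=
  forall e, 0 < e -> exists2 d, 0 < d &
    forall h, `|h| < d -> `|f (x + h) - f x - (a * h.1 + b * h.2)| <= e * `|h|.

Definition lin2 (a b : R) (h : R * R) : R := a * h.1 + b * h.2.

Lemma lin2_linear a b : linear (lin2 a b).
Proof. by move=> k u v; rewrite /lin2 /= /GRing.scale /=; ring. Qed.

HB.instance Definition _ a b :=
  @GRing.isLinear.Build R (R * R)%type R *:%R (lin2 a b) (lin2_linear a b).

Lemma lin2_continuous a b : continuous (lin2 a b).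
Proof.
move=> x; rewrite /lin2; apply: cvgD.
  by apply: cvgM; [exact: cvg_cst|exact: cvg_fst].
by apply: cvgM; [exact: cvg_cst|exact: cvg_snd].
Qed.

Lemma norm_pairE (h : R * R) : `|h| = Num.max `|h.1| `|h.2|.
Proof. by []. Qed.

Lemma frechetP f x a b :
  frechet f x a b <->
  [/\ differentiable f x, 'D_(1, 0) f x = a & 'D_(0, 1) f x = b].
Proof.
split=> [H|[df <- <-] e e0].
  have key : forall e, 0 < e -> \forall h \near (0 : R * R),
      `|(f \o shift x - (cst (f x) + lin2 a b)) h| <= e * `|h|.
    move=> e e0; have [d d0 Hd] := H _ e0.
    apply/nbhs_normP; exists d => //= h.
    rewrite /= sub0r normrN => hd.
    rewrite !fctE /= /shift /cst /lin2 /= opprD addrA [h + x]addrC.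
    exact: Hd.
  have uq : 'd f x = lin2 a b :> (R * R -> R).
    apply: (@diff_unique R (R * R)%type R^o f (lin2 a b) x).
      exact: lin2_continuous.
    by apply/eqaddoP => e e0; apply: key.
  have df : differentiable f x.
    apply/diff_locallyP; split; rewrite ?uq //.
      exact: lin2_continuous.
    by apply/eqaddoP => e e0; apply: key.
  split=> //; rewrite deriveE // uq /lin2 /= ?mulr1 ?mulr0 ?addr0 ?add0r //.
have /diff_locallyP [_ /eqaddoP /(_ _ e0)] := df.
rewrite /= -nbhs_nearE => /nbhs_normP [d d0 Hd]; exists d => // h hd.
have := Hd h; rewrite /= sub0r normrN => /(_ hd).
rewrite !fctE /= /shift /cst /= opprD addrA [h + x]addrC.
rewrite !deriveE //.
have -> // : 'd f x h = 'd f x (1, 0) * h.1 + 'd f x (0, 1) * h.2.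
have {1}-> : h = h.1 *: (1, 0) + h.2 *: (0, 1).
  rewrite /= [RHS]surjective_pairing /= /GRing.scale /= !mulr0 !mulr1.
  by case: h {hd} => u v /=; rewrite addr0 add0r.
by rewrite linearD !linearZ /= /GRing.scale /= mulrC [h.2 * _]mulrC.
Qed.

Lemma frechet_near f g x a b : {near x, f =1 g} -> frechet f x a b ->
  frechet g x a b.
Proof.
move=> fg H e e0; have [d d0 Hd] := H _ e0.
have /nbhs_normP [r /= r0 Hr] := fg.
exists (Num.min d r); first by rewrite lt_min d0.
move=> h; rewrite lt_min => /andP[hd hr].
rewrite -Hr ?Hd //=; last by rewrite opprD addNKr normrN.
by rewrite -(Hr x) ?Hd //= subrr normr0.
Qed.

Lemma near_differentiable f g x :
  {near x, f =1 g} -> differentiable f x -> differentiable g x.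
Proof.
move=> fg df; have : frechet f x ('D_(1,0) f x) ('D_(0,1) f x) by apply/frechetP.
by move=> /(frechet_near fg) /frechetP [].
Qed.

Lemma open_near D x (f g : R * R -> R) :
  open D -> D x -> (forall y, D y -> f y = g y) -> {near x, f =1 g}.
Proof. by move=> oD Dx fg; apply: filterS (open_nbhs_nbhs (conj oD Dx)). Qed.

(** The same recursion as n_differentiable, localized to a set D so that it can be
    used near points where a quotient is defined. *)
Fixpoint ndiff (n : nat) D f : Prop :=
  if n is m.+1 then
    [/\ forall x, D x -> differentiable f x,
        ndiff m D (fun x => 'D_(1, 0) f x) &
        ndiff m D (fun x => 'D_(0, 1) f x)]
  else True.

Lemma n_differentiableE n f : n_differentiable n f <-> ndiff n setT f.
Proof.
elim: n f => [|n IH] f //=; split=> -[df d1 d2]; split=> //;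
  by [move=> x; apply: df | apply/IH].
Qed.

Lemma ndiff_eq n D f g : open D -> (forall x, D x -> f x = g x) ->
  ndiff n D f -> ndiff n D g.
Proof.
move=> oD; elim: n f g => [|n IH] f g //= fg [df d1 d2]; split.
- by move=> x Dx; apply: near_differentiable (open_near oD Dx fg) (df _ Dx).
- by apply: IH d1 => x Dx; apply/near_eq_derive/(open_near oD Dx fg).
- by apply: IH d2 => x Dx; apply/near_eq_derive/(open_near oD Dx fg).
Qed.

Lemma ndiff_subset n D D' f : D' `<=` D -> ndiff n D f -> ndiff n D' f.
Proof.
move=> sD; elim: n f => [|n IH] f //= [df d1 d2].
by split; [move=> x /sD; apply: df | apply: IH | apply: IH].
Qed.

Lemma ndiff_le m n D f : (m <= n)%N -> ndiff n D f -> ndiff m D f.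
Proof.
elim: m n f => [|m IH] [|n] f //=; rewrite ltnS => mn [df d1 d2].
by split=> //; apply: IH mn _.
Qed.

Lemma ndiff_cst n D (c : R) : open D -> ndiff n D (fun=> c).
Proof.
move=> oD; elim: n c => [|n IH] c //=.
by split=> [x _||]; [exact: differentiable_cst| |];
  apply: (ndiff_eq oD _ (IH 0)) => x _; rewrite derive_cst.
Qed.

Lemma ndiffD n D f g : open D -> ndiff n D f -> ndiff n D g ->
  ndiff n D (fun x => f x + g x).
Proof.
move=> oD; elim: n f g => [|n IH] f g //= [df f1 f2] [dg g1 g2]; split.
- by move=> x Dx; apply: differentiableD; [apply: df|apply: dg].
- apply: (ndiff_eq oD _ (IH _ _ f1 g1)) => x Dx.
  by rewrite -deriveD //; apply: diff_derivable; [apply: df|apply: dg].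
- apply: (ndiff_eq oD _ (IH _ _ f2 g2)) => x Dx.
  by rewrite -deriveD //; apply: diff_derivable; [apply: df|apply: dg].
Qed.

Lemma ndiffM n D f g : open D -> ndiff n D f -> ndiff n D g ->
  ndiff n D (fun x => f x * g x).
Proof.
move=> oD; elim: n f g => [|n IH] f g // Hf Hg.
have [df f1 f2] := Hf; have [dg g1 g2] := Hg.
have f0 := ndiff_le (leqnSn n) Hf; have g0 := ndiff_le (leqnSn n) Hg.
split.
- by move=> x Dx; apply: differentiableM; [apply: df|apply: dg].
- apply: (ndiff_eq oD _ (ndiffD oD (IH _ _ f0 g1) (IH _ _ g0 f1))) => x Dx.
  by apply/esym/deriveM; apply: diff_derivable; [apply: df|apply: dg].
- apply: (ndiff_eq oD _ (ndiffD oD (IH _ _ f0 g2) (IH _ _ g0 f2))) => x Dx.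
  by apply/esym/deriveM; apply: diff_derivable; [apply: df|apply: dg].
Qed.

Lemma ndiffN n D f : open D -> ndiff n D f -> ndiff n D (fun x => - f x).
Proof.
move=> oD Hf; apply: (ndiff_eq oD _ (ndiffM oD (ndiff_cst n (-1) oD) Hf)).
by move=> x _; rewrite mulN1r.
Qed.

Lemma ndiffV n D f : open D -> (forall x, D x -> f x != 0) ->
  ndiff n D f -> ndiff n D (fun x => (f x)^-1).
Proof.
move=> oD f0; elim: n => [|n IH] // Hf.
have [df f1 f2] := Hf; have fn := IH (ndiff_le (leqnSn n) Hf).
split.
- by move=> x Dx; apply: differentiableV; [apply: df|apply: f0].
- apply: (ndiff_eq oD _ (ndiffM oD (ndiffN oD (ndiffM oD fn fn)) f1)) => x Dx.
  apply/esym; apply: etrans (deriveV (f0 _ Dx) _) _.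
    by apply: diff_derivable; apply: df.
  by rewrite -exprVn expr2.
- apply: (ndiff_eq oD _ (ndiffM oD (ndiffN oD (ndiffM oD fn fn)) f2)) => x Dx.
  apply/esym; apply: etrans (deriveV (f0 _ Dx) _) _.
    by apply: diff_derivable; apply: df.
  by rewrite -exprVn expr2.
Qed.

Lemma frechet_fst x : frechet fst x 1 0.
Proof.
move=> e e0; exists 1 => // h _.
have -> : (x + h).1 - x.1 - (1 * h.1 + 0 * h.2) = 0 by rewrite /=; ring.
by rewrite normr0 mulr_ge0 // ltW.
Qed.

Lemma frechet_snd x : frechet snd x 0 1.
Proof.
move=> e e0; exists 1 => // h _.
have -> : (x + h).2 - x.2 - (0 * h.1 + 1 * h.2) = 0 by rewrite /=; ring.
by rewrite normr0 mulr_ge0 // ltW.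
Qed.

Lemma ndiff_fst n D : open D -> ndiff n D fst.
Proof.
move=> oD; case: n => [|n] //=; split.
- by move=> x _; have /frechetP[] := frechet_fst x.
- apply: (ndiff_eq oD _ (ndiff_cst n 1 oD)) => x _.
  by have /frechetP[] := frechet_fst x.
- apply: (ndiff_eq oD _ (ndiff_cst n 0 oD)) => x _.
  by have /frechetP[] := frechet_fst x.
Qed.

Lemma ndiff_snd n D : open D -> ndiff n D snd.
Proof.
move=> oD; case: n => [|n] //=; split.
- by move=> x _; have /frechetP[] := frechet_snd x.
- apply: (ndiff_eq oD _ (ndiff_cst n 0 oD)) => x _.
  by have /frechetP[] := frechet_snd x.
- apply: (ndiff_eq oD _ (ndiff_cst n 1 oD)) => x _.
  by have /frechetP[] := frechet_snd x.
Qed.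

End RealCalculus.

(** * Equality of mixed partial derivatives *)

Section Young.
Context {R : realType}.
Implicit Types (f : R * R -> R) (x h : R * R).

Lemma is_derive_line f x h (t a b : R) : frechet f (x + t *: h) a b ->
  is_derive t 1 (fun s => f (x + s *: h)) (a * h.1 + b * h.2).
Proof.
move=> fr; have /frechetP[df Da Db] := fr.
have dl : is_diff t (fun s : R => x + s *: h) (fun s : R => 0 + s *: h).
  by apply: is_diffD.
have [dfl Dl] := @is_diff_comp _ _ _ _ _ _ _ _ t dl (differentiableP df).
split; first by apply: diff_derivable.
rewrite deriveE // Dl /= add0r scale1r.
have hE : h = h.1 *: (1, 0) + h.2 *: (0, 1).
  by case: h {fr df Da Db dl dfl Dl} => u v; congr pair; rewrite /= /GRing.scale /=; ring.
rewrite [X in _ X = _]hE.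
by rewrite linearD !linearZ -!deriveE // Da Db /= /GRing.scale /= mulrC [h.2 * _]mulrC.
Qed.

Lemma norm_coord1 (s t : R) : 0 <= s <= t -> `|(s, t) : R * R| = t.
Proof.
move=> /andP[s0 st]; rewrite norm_pairE /= !ger0_norm ?(le_trans s0) //.
exact/max_idPr.
Qed.

(** The symmetric second difference over a square with side t; divided by t^2 it tends
    to either mixed partial derivative. *)
Definition increment2 f x (t : R) :=
  f (x + (t, t)) - f (x + (t, 0)) - (f (x + (0, t)) - f x).

(** The mean value theorem in the first variable writes the second difference as t
    times a difference of first derivatives, which differentiability at x evaluates.
    *)
Lemma increment2_near1 f x (r : R) (a b e : R) : 0 < r ->
  (forall y, `|y - x| < r -> differentiable f y) ->
  frechet (fun y => 'D_(1, 0) f y) x a b -> 0 < e ->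
  exists2 d, 0 < d & forall t, 0 < t < d ->
    `|increment2 f x t - t ^+ 2 * b| <= 2 * e * t ^+ 2.
Proof.
move=> r0 df fr e0; have [d d0 Hd] := fr _ e0.
exists (Num.min d r); first by rewrite lt_min d0.
move=> t /andP[t0]; rewrite lt_min => /andP[td tr].
pose p y := 'D_(1, 0) f y.
have lineE (s u : R) : x + (s, u) = (x + (0, u)) + s *: (1, 0).
  by case: x {df fr Hd} => x1 x2; congr pair; rewrite /= /GRing.scale /=; ring.
pose phi s := f ((x + (0, t)) + s *: (1, 0)) - f ((x + (0, 0)) + s *: (1, 0)).
have dline (u s : R) : 0 <= s <= t -> 0 <= u <= t ->
    is_derive s 1 (fun s => f ((x + (0, u)) + s *: (1, 0))) (p (x + (s, u))).
  move=> /andP[s0 st] /andP[u0 ut].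
  have := @is_derive_line f (x + (0, u)) (1, 0) s (p (x + (s, u))) ('D_(0, 1) f (x + (s, u))).
  rewrite /= mulr1 mulr0 addr0; apply; rewrite -lineE; apply/frechetP; split => //.
  apply: df; rewrite addrAC subrr add0r norm_pairE /= !ger0_norm //.
  by rewrite gt_max !(le_lt_trans _ tr).
have dphi (s : R) : 0 <= s <= t ->
    is_derive s 1 phi (p (x + (s, t)) - p (x + (s, 0))).
  move=> st; apply: is_deriveB; apply: dline => //; rewrite ?lexx ?(ltW t0) //.
have [||s sI] := @MVT R phi (fun s => p (x + (s, t)) - p (x + (s, 0))) 0 t t0.
- by move=> s; rewrite in_itv /= => /andP[s0 st]; apply: dphi; rewrite !ltW.
- apply: derivable_within_continuous => s; rewrite in_itv /= => st.
  by case: (dphi s st).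
have {}sI : 0 <= s <= t by move: sI; rewrite in_itv /= => /andP[? ?]; rewrite !ltW.
have -> : phi t - phi 0 = increment2 f x t.
  rewrite /phi /increment2 -!lineE; congr (_ - _ - (_ - _)); congr f.
  by case: x {df fr Hd p lineE phi dline dphi} => x1 x2; congr pair; rewrite /=; ring.
rewrite subr0 => ->.
have nt := norm_coord1 sI.
have ns : `|(s, 0) : R * R| <= t.
  rewrite norm_pairE /= normr0; case/andP: sI => s0 st.
  by rewrite ge_max ger0_norm // st ltW.
have h1 := Hd (s, t); rewrite nt td /= in h1; have {}h1 := h1 isT.
have h2 := Hd (s, 0); rewrite /= (le_lt_trans ns td) in h2; have {}h2 := h2 isT.
have {}h2 := le_trans h2 (ler_wpM2l (ltW e0) ns).
have -> : (p (x + (s, t)) - p (x + (s, 0))) * t - t ^+ 2 * b =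
  t * ((p (x + (s, t)) - p x - (a * s + b * t)) - (p (x + (s, 0)) - p x - (a * s + b * 0))).
  by ring.
rewrite normrM gtr0_norm // expr2 mulrA [2 * e * t * t]mulrC ler_wpM2l ?(ltW t0) //.
apply: (le_trans (ler_normB _ _)); rewrite -mulrA mulr2n mulrDl !mul1r.
exact: lerD.
Qed.

(** Exchanging the coordinates reduces each statement about the second partial
    derivative to the first. *)
Lemma frechet_swap f x a b : frechet f x a b ->
  frechet (fun y => f (y.2, y.1)) (x.2, x.1) b a.
Proof.
move=> fr e e0; have [d d0 Hd] := fr e e0; exists d => // h hd.
have n : `|(h.2, h.1) : R * R| = `|h| by rewrite !norm_pairE maxC.
have := Hd (h.2, h.1); rewrite n => /(_ hd).
rewrite (_ : x + (h.2, h.1) = (((x.2, x.1) + h).2, ((x.2, x.1) + h).1)) //=.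
by rewrite -surjective_pairing (addrC (a * _)).
Qed.

Lemma increment2_near2 f x (r : R) (a b e : R) : 0 < r ->
  (forall y, `|y - x| < r -> differentiable f y) ->
  frechet (fun y => 'D_(0, 1) f y) x a b -> 0 < e ->
  exists2 d, 0 < d & forall t, 0 < t < d ->
    `|increment2 f x t - t ^+ 2 * a| <= 2 * e * t ^+ 2.
Proof.
move=> r0 df fr e0; pose g y := f (y.2, y.1).
have dg y : `|y - (x.2, x.1)| < r -> differentiable g y /\ 'D_(1, 0) g y = 'D_(0, 1) f (y.2, y.1).
  move=> yr; have /df dfy : `|(y.2, y.1) - x| < r.
    by move: yr; rewrite !norm_pairE /= maxC.
  have /frechet_swap /= : frechet f (y.2, y.1) ('D_(1, 0) f (y.2, y.1)) ('D_(0, 1) f (y.2, y.1)).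
    exact/frechetP.
  by rewrite -surjective_pairing => /frechetP[].
have [||d d0 Hd] := @increment2_near1 g (x.2, x.1) r b a e r0 _ _ e0.
- by move=> y /dg [].
- by apply: frechet_near (frechet_swap fr); apply/nbhs_normP; exists r => //= y; rewrite distrC => /dg [].
exists d => // t /Hd; rewrite (_ : increment2 g (x.2, x.1) t = increment2 f x t) //.
rewrite /increment2 /g /= -[(x.1, x.2)]surjective_pairing.
rewrite (_ : (x.1 + t, x.2 + t) = x + (t, t)) // (_ : (x.1 + 0, x.2 + t) = x + (0, t)) //.
by rewrite (_ : (x.1 + t, x.2 + 0) = x + (t, 0)) //; ring.
Qed.

(** Young's form of the theorem: the first derivatives are only assumed differentiable
    at x. Both mixed derivatives are limits of the same second difference. *)
Lemma mixed_partials f x (r : R) : 0 < r ->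
  (forall y, `|y - x| < r -> differentiable f y) ->
  differentiable (fun y => 'D_(1, 0) f y) x ->
  differentiable (fun y => 'D_(0, 1) f y) x ->
  'D_(0, 1) (fun y => 'D_(1, 0) f y) x = 'D_(1, 0) (fun y => 'D_(0, 1) f y) x.
Proof.
move=> r0 df d1 d2; set b := LHS; set a := RHS.
have fr1 : frechet (fun y => 'D_(1, 0) f y) x ('D_(1, 0) (fun y => 'D_(1, 0) f y) x) b.
  exact/frechetP.
have fr2 : frechet (fun y => 'D_(0, 1) f y) x a ('D_(0, 1) (fun y => 'D_(0, 1) f y) x).
  exact/frechetP.
apply/eqP; rewrite -subr_eq0 -normr_le0; apply/ler_addgt0Pl => e e0.
have e4 : 0 < e / 4 by rewrite divr_gt0.
have [s1 s10 H1] := increment2_near1 r0 df fr1 e4.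
have [s2 s20 H2] := increment2_near2 r0 df fr2 e4.
pose t := Num.min s1 s2 / 2.
have m0 : 0 < Num.min s1 s2 by rewrite lt_min s10.
have t0 : 0 < t by rewrite divr_gt0.
have tm : t < Num.min s1 s2 by rewrite /t; lra.
have {}H1 := H1 t; rewrite t0 /= (lt_le_trans tm) ?ge_min ?lexx // in H1.
have {}H2 := H2 t; rewrite t0 /= (lt_le_trans tm) ?ge_min ?lexx ?orbT // in H2.
have t2 : 0 < t ^+ 2 by rewrite exprn_gt0.
rewrite addr0 -(ler_pM2l t2).
have -> : t ^+ 2 * `|b - a| = `|(increment2 f x t - t ^+ 2 * a) - (increment2 f x t - t ^+ 2 * b)|.
  by rewrite -[X in X * `|_|]gtr0_norm // -normrM; congr `|_|; ring.
apply: (le_trans (ler_normB _ _)).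
have -> : t ^+ 2 * e = 2 * (e / 4) * t ^+ 2 + 2 * (e / 4) * t ^+ 2 by field.
by apply: lerD; [apply: H2|apply: H1].
Qed.

End Young.

(** * Wirtinger derivatives *)

(** Directional derivative of a complex function, locked so that conversion never
    unfolds the limit. *)
HB.lock Definition cderive (R : realType) (h : R * R) (f : R * R -> R[i])
    (x : R * R) : R[i] :=
  'D_h (fun y => complex.Re (f y)) x +i* 'D_h (fun y => complex.Im (f y)) x.

Definition wsign {R : realType} (s : bool) : R[i] := if s then - 'i else 'i.

(** The operator d_+ for s = true and d_- for s = false; one Boolean parameter lets
    both cases share every proof. *)
HB.lock Definition wirtinger (R : realType) (s : bool) (f : R * R -> R[i])
    (x : R * R) : R[i] :=
  2^-1 * (cderive (1, 0) f x + wsign s * cderive (0, 1) f x).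

Section ComplexCalculus.
Context {R : realType}.
Local Notation C := R[i].
Implicit Types (f g : R * R -> C) (x h : R * R) (D : set (R * R)) (s t : bool).


Definition cdiff f x : Prop :=
  differentiable (fun y => complex.Re (f y)) x /\
  differentiable (fun y => complex.Im (f y)) x.

Definition cndiff n D f : Prop :=
  ndiff n D (fun y => complex.Re (f y)) /\ ndiff n D (fun y => complex.Im (f y)).

Lemma cderiveE h f x : cderive h f x =
  'D_h (fun y => complex.Re (f y)) x +i* 'D_h (fun y => complex.Im (f y)) x.
Proof. by rewrite unlock. Qed.

Local Notation wsign := (@wsign R).

Lemma wirtingerE s f x : wirtinger s f x =
  2^-1 * (cderive (1, 0) f x + wsign s * cderive (0, 1) f x).
Proof. by rewrite unlock. Qed.

Lemma complexP (z w : C) :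
  complex.Re z = complex.Re w -> complex.Im z = complex.Im w -> z = w.
Proof. by case: z w => [a b] [c d] /= -> ->. Qed.

Lemma ReD (z w : C) : complex.Re (z + w) = complex.Re z + complex.Re w.
Proof. by case: z w => [a b] [c d]. Qed.
Lemma ImD (z w : C) : complex.Im (z + w) = complex.Im z + complex.Im w.
Proof. by case: z w => [a b] [c d]. Qed.
Lemma ReN (z : C) : complex.Re (- z) = - complex.Re z.
Proof. by case: z. Qed.
Lemma ImN (z : C) : complex.Im (- z) = - complex.Im z.
Proof. by case: z. Qed.
Lemma ReM (z w : C) :
  complex.Re (z * w) = complex.Re z * complex.Re w - complex.Im z * complex.Im w.
Proof. by case: z w => [a b] [c d]. Qed.
Lemma ImM (z w : C) :
  complex.Im (z * w) = complex.Re z * complex.Im w + complex.Im z * complex.Re w.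
Proof. by case: z w => [a b] [c d]. Qed.
Definition ReImE := (ReD, ImD, ReN, ImN, ReM, ImM).

Lemma cderiveD h f g x : cdiff f x -> cdiff g x ->
  cderive h (fun y => f y + g y) x = cderive h f x + cderive h g x.
Proof.
move=> [f1 f2] [g1 g2]; apply: complexP; rewrite !cderiveE ReImE /=.
  rewrite -deriveD ?/Algebra.add /=; try exact: diff_derivable.
  by congr ('D_h _ x); apply/funext => y; rewrite ReImE.
rewrite -deriveD ?/Algebra.add /=; try exact: diff_derivable.
by congr ('D_h _ x); apply/funext => y; rewrite ReImE.
Qed.

Lemma cdiffD f g x : cdiff f x -> cdiff g x -> cdiff (fun y => f y + g y) x.
Proof.
move=> [f1 f2] [g1 g2]; split.
  rewrite (_ : (fun y => _) = (fun y => complex.Re (f y)) + (fun y => complex.Re (g y))).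
    exact: differentiableD.
  by apply/funext => y; rewrite ReImE.
rewrite (_ : (fun y => _) = (fun y => complex.Im (f y)) + (fun y => complex.Im (g y))).
  exact: differentiableD.
by apply/funext => y; rewrite ReImE.
Qed.

Lemma cdiffM f g x : cdiff f x -> cdiff g x -> cdiff (fun y => f y * g y) x.
Proof.
move=> [f1 f2] [g1 g2]; split.
  rewrite (_ : (fun y => _) = (fun y => complex.Re (f y)) * (fun y => complex.Re (g y))
     - (fun y => complex.Im (f y)) * (fun y => complex.Im (g y))).
    by apply: differentiableB; exact: differentiableM.
  by apply/funext => y; rewrite ReImE.
rewrite (_ : (fun y => _) = (fun y => complex.Re (f y)) * (fun y => complex.Im (g y))
     + (fun y => complex.Im (f y)) * (fun y => complex.Re (g y))).
  by apply: differentiableD; exact: differentiableM.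
by apply/funext => y; rewrite ReImE.
Qed.

Lemma cderiveM h f g x : cdiff f x -> cdiff g x ->
  cderive h (fun y => f y * g y) x = cderive h f x * g x + f x * cderive h g x.
Proof.
move=> [f1 f2] [g1 g2]; apply: complexP; rewrite !cderiveE !ReImE /=.
  rewrite (_ : (fun y => _) = (fun y => complex.Re (f y)) * (fun y => complex.Re (g y))
     - (fun y => complex.Im (f y)) * (fun y => complex.Im (g y))); last first.
    by apply/funext => y; rewrite ReImE.
  rewrite deriveB; try by apply: derivableM; exact: diff_derivable.
  by rewrite !deriveM; try exact: diff_derivable; rewrite /GRing.scale /=; ring.
rewrite (_ : (fun y => _) = (fun y => complex.Re (f y)) * (fun y => complex.Im (g y))
     + (fun y => complex.Im (f y)) * (fun y => complex.Re (g y))); last first.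
  by apply/funext => y; rewrite ReImE.
rewrite deriveD; try by apply: derivableM; exact: diff_derivable.
by rewrite !deriveM; try exact: diff_derivable; rewrite /GRing.scale /=; ring.
Qed.

Lemma cdiff_cst (c : C) x : cdiff (fun=> c) x.
Proof. by split; exact: differentiable_cst. Qed.

Lemma cderive_cst h (c : C) x : cderive h (fun=> c) x = 0.
Proof. by rewrite cderiveE !derive_cst. Qed.

Lemma cdiff_conj f x : cdiff f x -> cdiff (fun y => conjc (f y)) x.
Proof.
move=> [f1 f2]; split.
  by rewrite (_ : (fun y => _) = (fun y => complex.Re (f y))) //; apply/funext => y; case: (f y).
rewrite (_ : (fun y => _) = - (fun y => complex.Im (f y))); first exact: differentiableN.
by apply/funext => y /=; rewrite fctE; case: (f y).
Qed.

Lemma cderive_conj h f x : cdiff f x ->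
  cderive h (fun y => conjc (f y)) x = conjc (cderive h f x).
Proof.
move=> [f1 f2]; apply: complexP; rewrite !cderiveE /=.
  by congr ('D_h _ x); apply/funext => y; case: (f y).
rewrite -deriveN; last exact: diff_derivable.
by congr ('D_h _ x); apply/funext => y /=; rewrite fctE; case: (f y).
Qed.

Lemma cderive_near h f g x : {near x, f =1 g} -> cderive h f x = cderive h g x.
Proof.
move=> fg; rewrite !cderiveE; congr (_ +i* _); apply: near_eq_derive; apply: filterS fg.
  by move=> y; rewrite /= => ->.
by move=> y; rewrite /= => ->.
Qed.

Lemma wirtinger_near s f g x : {near x, f =1 g} -> wirtinger s f x = wirtinger s g x.
Proof. by move=> fg; rewrite !wirtingerE !(cderive_near _ fg). Qed.

Lemma wirtingerD s f g x : cdiff f x -> cdiff g x ->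
  wirtinger s (fun y => f y + g y) x = wirtinger s f x + wirtinger s g x.
Proof. by move=> df dg; rewrite !wirtingerE !cderiveD //; ring. Qed.

Lemma wirtingerM s f g x : cdiff f x -> cdiff g x ->
  wirtinger s (fun y => f y * g y) x = wirtinger s f x * g x + f x * wirtinger s g x.
Proof. by move=> df dg; rewrite !wirtingerE !cderiveM //; ring. Qed.

Lemma wirtinger_cst s (c : C) x : wirtinger s (fun=> c) x = 0.
Proof. by rewrite !wirtingerE !cderive_cst !mulr0 addr0 mulr0. Qed.

Lemma conjcM (z w : C) : conjc (z * w) = conjc z * conjc w.
Proof. exact: rmorphM. Qed.

Lemma conjcD (z w : C) : conjc (z + w) = conjc z + conjc w.
Proof. exact: rmorphD. Qed.

Lemma conj_wsign s : conjc (wsign s) = wsign (~~ s).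
Proof. by case: s; apply: complexP; rewrite /= ?oppr0 ?opprK. Qed.

Lemma conj_half : conjc (2^-1 : C) = 2^-1.
Proof. by rewrite conjc_inv conjc_nat. Qed.

Lemma wirtinger_conj s f x : cdiff f x ->
  wirtinger s (fun y => conjc (f y)) x = conjc (wirtinger (~~ s) f x).
Proof.
move=> df; rewrite !wirtingerE !cderive_conj // conjcM conjcD conjcM.
by rewrite conj_half conj_wsign negbK.
Qed.

Lemma wirtinger_ex f x :
  cderive (1, 0) f x = wirtinger true f x + wirtinger false f x.
Proof.
rewrite !wirtingerE (_ : wsign true = - wsign false) //.
by move: (wsign false) => i; field.
Qed.

Lemma wirtinger_ey f x :
  cderive (0, 1) f x = 'i * (wirtinger true f x - wirtinger false f x).
Proof.
rewrite !wirtingerE (_ : wsign true = - wsign false) //.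
have := @sqr_i R; rewrite expr2 -[in LHS](_ : wsign false = 'i) // => i2.
rewrite -[X in _ = X * _](_ : wsign false = 'i) //.
move: (wsign false) i2 => i i2; transitivity (- (i * i) * cderive (0, 1) f x).
  by rewrite i2 opprK mul1r.
by field.
Qed.

Lemma cndiff_eq n D f g : open D -> (forall x, D x -> f x = g x) ->
  cndiff n D f -> cndiff n D g.
Proof.
move=> oD fg [f1 f2]; split; first by apply: ndiff_eq f1 => // x /fg ->.
by apply: ndiff_eq f2 => // x /fg ->.
Qed.

Lemma cndiff_subset n D D' f : D' `<=` D -> cndiff n D f -> cndiff n D' f.
Proof. by move=> sD [f1 f2]; split; apply: ndiff_subset sD _. Qed.

Lemma cndiff_le m n D f : (m <= n)%N -> cndiff n D f -> cndiff m D f.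
Proof. by move=> mn [f1 f2]; split; apply: ndiff_le mn _. Qed.

Lemma cndiff_cdiff n D f x : cndiff n.+1 D f -> D x -> cdiff f x.
Proof. by move=> [[f1 _ _] [f2 _ _]] Dx; split; [apply: f1|apply: f2]. Qed.

Lemma cndiff_cst n D (c : C) : open D -> cndiff n D (fun=> c).
Proof. by move=> oD; split; exact: ndiff_cst. Qed.

Lemma cndiffD n D f g : open D -> cndiff n D f -> cndiff n D g ->
  cndiff n D (fun x => f x + g x).
Proof.
move=> oD [f1 f2] [g1 g2]; split.
  by apply: ndiff_eq (ndiffD oD f1 g1) => // x _; rewrite ReImE.
by apply: ndiff_eq (ndiffD oD f2 g2) => // x _; rewrite ReImE.
Qed.

Lemma cndiffM n D f g : open D -> cndiff n D f -> cndiff n D g ->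
  cndiff n D (fun x => f x * g x).
Proof.
move=> oD [f1 f2] [g1 g2]; split.
  apply: ndiff_eq (ndiffD oD (ndiffM oD f1 g1) (ndiffN oD (ndiffM oD f2 g2))) => // x _.
  by rewrite ReImE.
by apply: ndiff_eq (ndiffD oD (ndiffM oD f1 g2) (ndiffM oD f2 g1)) => // x _; rewrite ReImE.
Qed.

Lemma cndiffN n D f : open D -> cndiff n D f -> cndiff n D (fun x => - f x).
Proof.
move=> oD Hf; apply: cndiff_eq (cndiffM oD (cndiff_cst n (-1) oD) Hf) => // x _.
by rewrite mulN1r.
Qed.

Lemma cndiff_conj n D f : open D -> cndiff n D f -> cndiff n D (fun x => conjc (f x)).
Proof.
move=> oD [f1 f2]; split; first by apply: ndiff_eq f1 => // x _; case: (f x).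
by apply: ndiff_eq (ndiffN oD f2) => // x _; case: (f x).
Qed.

Lemma sqrRI_neq0 (z : C) : z != 0 -> complex.Re z ^+ 2 + complex.Im z ^+ 2 != 0.
Proof.
case: z => [a b]; apply: contra => /=; rewrite paddr_eq0 ?sqr_ge0 // !sqrf_eq0.
by move=> /andP[/eqP -> /eqP ->].
Qed.

Lemma cndiffV n D f : open D -> (forall x, D x -> f x != 0) -> cndiff n D f ->
  cndiff n D (fun x => (f x)^-1).
Proof.
move=> oD f0 [f1 f2].
have Hn : ndiff n D (fun x => (complex.Re (f x) ^+ 2 + complex.Im (f x) ^+ 2)^-1).
  apply: ndiffV => //; first by move=> x /f0 /sqrRI_neq0.
  by apply: ndiffD => //; apply: ndiffM.
split; first by apply: ndiff_eq (ndiffM oD f1 Hn) => // x _; case: (f x).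
apply: ndiff_eq (ndiffM oD (ndiffN oD f2) Hn) => // x _; case: (f x) => a b /=.
by rewrite mulNr.
Qed.

Lemma cndiff_cderive n D f : open D -> cndiff n.+1 D f ->
  cndiff n D (cderive (1, 0) f) /\ cndiff n D (cderive (0, 1) f).
Proof.
move=> oD [[_ a b] [_ c d]].
have E h : cderive h f = fun x =>
  'D_h (fun y => complex.Re (f y)) x +i* 'D_h (fun y => complex.Im (f y)) x.
  by apply/funext => x; rewrite cderiveE.
by rewrite !E.
Qed.

Lemma cndiff_wirtinger s n D f : open D -> cndiff n.+1 D f -> cndiff n D (wirtinger s f).
Proof.
move=> oD /(cndiff_cderive oD) [f1 f2].
have -> : wirtinger s f = fun x =>
    2^-1 * (cderive (1, 0) f x + wsign s * cderive (0, 1) f x).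
  by apply/funext => x; rewrite wirtingerE.
apply: cndiffM => //; first exact: cndiff_cst.
by apply: cndiffD => //; apply: cndiffM => //; exact: cndiff_cst.
Qed.

Lemma cndiff_sum (I : Type) (r : seq I) (P : pred I) n D (F : I -> R * R -> C) :
  open D -> (forall i, cndiff n D (F i)) ->
  cndiff n D (fun x => \sum_(i <- r | P i) F i x).
Proof.
move=> oD HF; elim: r => [|i r IH].
  by apply: cndiff_eq (cndiff_cst n 0 oD) => // x _; rewrite big_nil.
case Pi : (P i).
  by apply: cndiff_eq (cndiffD oD (HF i) IH) => // x _; rewrite big_cons Pi.
by apply: cndiff_eq IH => // x _; rewrite big_cons Pi.
Qed.

Lemma cndiff_prod (I : Type) (r : seq I) (P : pred I) n D (F : I -> R * R -> C) :
  open D -> (forall i, cndiff n D (F i)) ->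
  cndiff n D (fun x => \prod_(i <- r | P i) F i x).
Proof.
move=> oD HF; elim: r => [|i r IH].
  by apply: cndiff_eq (cndiff_cst n 1 oD) => // x _; rewrite big_nil.
case Pi : (P i).
  by apply: cndiff_eq (cndiffM oD (HF i) IH) => // x _; rewrite big_cons Pi.
by apply: cndiff_eq IH => // x _; rewrite big_cons Pi.
Qed.

Lemma cdiff_sum (I : Type) (r : seq I) (P : pred I) (F : I -> R * R -> C) x :
  (forall i, cdiff (F i) x) -> cdiff (fun y => \sum_(i <- r | P i) F i y) x.
Proof.
move=> HF; elim: r => [|i r IH].
  have -> : (fun y => \sum_(i <- [::] | P i) F i y) = fun=> 0.
    by apply/funext => y; rewrite big_nil.
  exact: cdiff_cst.
case Pi : (P i).
  have -> : (fun y => \sum_(j <- i :: r | P j) F j y) =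
      fun y => F i y + \sum_(j <- r | P j) F j y.
    by apply/funext => y; rewrite big_cons Pi.
  exact: cdiffD.
have -> // : (fun y => \sum_(j <- i :: r | P j) F j y) =
    fun y => \sum_(j <- r | P j) F j y.
by apply/funext => y; rewrite big_cons Pi.
Qed.

Lemma wirtinger_sum s (I : Type) (r : seq I) (P : pred I) (F : I -> R * R -> C) x :
  (forall i, cdiff (F i) x) ->
  wirtinger s (fun y => \sum_(i <- r | P i) F i y) x =
  \sum_(i <- r | P i) wirtinger s (F i) x.
Proof.
move=> HF; elim: r => [|i r IH].
  rewrite big_nil; apply: etrans (wirtinger_cst s 0 x); congr (wirtinger s _ x).
  by apply/funext => y; rewrite big_nil.
rewrite big_cons; case Pi : (P i).
  rewrite -IH -wirtingerD //; last exact: cdiff_sum.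
  by congr (wirtinger s _ x); apply/funext => y; rewrite big_cons Pi.
by rewrite -IH; congr (wirtinger s _ x); apply/funext => y; rewrite big_cons Pi.
Qed.

Lemma cderiveC f x D : open D -> D x -> cndiff 2 D f ->
  cderive (0, 1) (cderive (1, 0) f) x = cderive (1, 0) (cderive (0, 1) f) x.
Proof.
move=> oD Dx Hf; have [[[f2 _ _] [g2 _ _]] [[f3 _ _] [g3 _ _]]] := cndiff_cderive oD Hf.
have [[f1 _ _] [g1 _ _]] := Hf.
have Re1 h : (fun y => complex.Re (cderive h f y)) = (fun y => 'D_h (fun y => complex.Re (f y)) y).
  by apply/funext => y; rewrite cderiveE.
have Im1 h : (fun y => complex.Im (cderive h f y)) = (fun y => 'D_h (fun y => complex.Im (f y)) y).
  by apply/funext => y; rewrite cderiveE.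
rewrite !Re1 in f2 f3; rewrite !Im1 in g2 g3.
rewrite !(cderiveE _ (cderive _ f)) !Re1 !Im1.
have /nbhs_normP [r /= r0 Hr] := open_nbhs_nbhs (conj oD Dx).
have Hr' y : `|y - x| < r -> D y by move=> H; apply: Hr; rewrite /= distrC.
apply: complexP.
  exact: (mixed_partials r0 (fun y Hy => f1 y (Hr' y Hy)) (f2 x Dx) (f3 x Dx)).
exact: (mixed_partials r0 (fun y Hy => g1 y (Hr' y Hy)) (g2 x Dx) (g3 x Dx)).
Qed.

(** Both orders expand into the second partial derivatives, where the mixed ones
    agree. *)
Lemma wirtingerC s t f x D : open D -> D x -> cndiff 2 D f ->
  wirtinger s (wirtinger t f) x = wirtinger t (wirtinger s f) x.
Proof.
move=> oD Dx Hf.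
have [/cndiff_cdiff f1 /cndiff_cdiff f2] := cndiff_cderive oD Hf.
have key u v : wirtinger u (wirtinger v f) x =
    2^-1 * 2^-1 * (cderive (1, 0) (cderive (1, 0) f) x +
     (wsign u + wsign v) * cderive (1, 0) (cderive (0, 1) f) x +
     wsign u * wsign v * cderive (0, 1) (cderive (0, 1) f) x).
  have Hh h : cderive h (wirtinger v f) x = 2^-1 * (cderive h (cderive (1, 0) f) x +
      wsign v * cderive h (cderive (0, 1) f) x).
    have c1 := cdiff_cst (wsign v) x; have c2 := cdiff_cst (2^-1) x.
    have m1 := cdiffM c1 (f2 x Dx).
    rewrite (_ : wirtinger v f = fun x =>
      2^-1 * (cderive (1, 0) f x + wsign v * cderive (0, 1) f x)); last first.
      by apply/funext => y; rewrite wirtingerE.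
    rewrite [LHS](cderiveM h c2 (cdiffD (f1 x Dx) m1)) cderive_cst mul0r add0r.
    by rewrite (cderiveD h (f1 x Dx) m1) (cderiveM h c1 (f2 x Dx)) cderive_cst mul0r add0r.
  rewrite [LHS]wirtingerE !Hh (cderiveC oD Dx Hf).
  by move: (2^-1) (wsign u) (wsign v) (cderive _ _ x) (cderive _ _ x) (cderive _ _ x) => k p q a b c; ring.
rewrite !key.
by move: (2^-1) (wsign s) (wsign t) (cderive _ _ x) (cderive _ _ x) (cderive _ _ x) => k p q a b c; ring.
Qed.

Definition zeta (x : R * R) : C := x.1 +i* x.2.

Lemma cdiff_zeta x : cdiff zeta x.
Proof.
split; first by have /frechetP[] := frechet_fst x.
by have /frechetP[] := frechet_snd x.
Qed.

Lemma cndiff_zeta n D : open D -> cndiff n D zeta.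
Proof. by move=> oD; split; [exact: ndiff_fst|exact: ndiff_snd]. Qed.

Lemma wirtinger_zeta s x : wirtinger s zeta x = if s then 1 else 0.
Proof.
have /frechetP[_ a b] := frechet_fst x; have /frechetP[_ c d] := frechet_snd x.
rewrite wirtingerE !cderiveE /= a b c d.
have := @sqr_i R; rewrite expr2 => i2.
have -> : (1 +i* 0 : C) = 1 by [].
case: s; rewrite /wsign ?mulNr i2 ?subrr ?mulr0 //.
by rewrite opprK -[1 + 1]/(2 : C) mulVf // pnatr_eq0.
Qed.

End ComplexCalculus.

(** * Differential calculus of matrix functions *)

(** The entrywise version of wirtinger: dplus for s = true and dminus for s = false.
    *)
HB.lock Definition dd (R : realType) (N : nat) (s : bool) (A : mxfun R N) : mxfun R N :=
  if s then dplus A else dminus A.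

Lemma dd_true (R : realType) (N : nat) (A : mxfun R N) : dd true A = dplus A.
Proof. by rewrite unlock. Qed.

Lemma dd_false (R : realType) (N : nat) (A : mxfun R N) : dd false A = dminus A.
Proof. by rewrite unlock. Qed.

Section MatrixCalculus.
Context {R : realType} {N : nat}.
Local Notation C := R[i].
Local Notation M := 'M[C]_N.
Implicit Types (A B : mxfun R N) (f : R * R -> C) (x h : R * R) (D : set (R * R)) (s t : bool).

Definition mdiff A x := forall j k, cdiff (fun y => A y j k) x.
Definition mndiff n D A := forall j k, cndiff n D (fun y => A y j k).

Lemma ddE s A x j k : dd s A x j k = wirtinger s (fun y => A y j k) x.
Proof.
rewrite wirtingerE !cderiveE; case: s; rewrite ?dd_true ?dd_false !mxE //.
by rewrite mulNr.
Qed.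

Lemma adjointE (X : M) j k : adjoint X j k = conjc (X k j).
Proof. by rewrite !mxE. Qed.

Lemma adjointM (X Y : M) : adjoint (X *m Y) = adjoint Y *m adjoint X.
Proof. by rewrite /adjoint map_mxM trmx_mul. Qed.
Lemma adjointD (X Y : M) : adjoint (X + Y) = adjoint X + adjoint Y.
Proof. by rewrite /adjoint map_mxD linearD. Qed.
Lemma adjointN (X : M) : adjoint (- X) = - adjoint X.
Proof. by rewrite /adjoint map_mxN linearN. Qed.
Lemma adjointB (X Y : M) : adjoint (X - Y) = adjoint X - adjoint Y.
Proof. by rewrite adjointD adjointN. Qed.
Lemma adjointK (X : M) : adjoint (adjoint X) = X.
Proof. by apply/matrixP => j k; rewrite !adjointE conjcK. Qed.
Lemma adjointZ (c : C) (X : M) : adjoint (c *: X) = conjc c *: adjoint X.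
Proof. by apply/matrixP => j k; rewrite !(adjointE, mxE) conjcM. Qed.
Lemma adjoint0 : adjoint (0 : M) = 0.
Proof. by apply/matrixP => j k; rewrite !(adjointE, mxE) conjc0. Qed.
Lemma adjoint1 : adjoint (1%:M : M) = 1%:M.
Proof. by apply/matrixP => j k; rewrite !(adjointE, mxE) conjc_nat eq_sym. Qed.
Lemma tr_adjoint (X : M) : \tr (adjoint X) = conjc (\tr X).
Proof. by rewrite /adjoint mxtrace_tr /mxtrace rmorph_sum; apply: eq_bigr => j _; rewrite mxE. Qed.

Lemma near_entry A B x j k : {near x, A =1 B} ->
  {near x, (fun y => A y j k) =1 (fun y => B y j k)}.
Proof. by move=> AB; apply: filterS AB => y; rewrite /= => ->. Qed.

Lemma dd_near s A B x : {near x, A =1 B} -> dd s A x = dd s B x.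
Proof.
move=> AB; apply/matrixP => j k; rewrite (ddE s A) (ddE s B).
exact: wirtinger_near (near_entry j k AB).
Qed.

Lemma mdiffD A B x : mdiff A x -> mdiff B x -> mdiff (fun y => A y + B y) x.
Proof.
move=> dA dB j k; rewrite (_ : (fun y => _) = fun y => A y j k + B y j k).
  exact: cdiffD.
by apply/funext => y; rewrite !mxE.
Qed.

Lemma ddD s A B x : mdiff A x -> mdiff B x ->
  dd s (fun y => A y + B y) x = dd s A x + dd s B x.
Proof.
move=> dA dB; apply/matrixP => j k; rewrite mxE (ddE s A) (ddE s B) (ddE s (fun y => A y + B y)) -(wirtingerD s (dA j k) (dB j k)).
by congr (wirtinger s _ x); apply/funext => y; rewrite mxE.
Qed.

Lemma mdiff_cst (X : M) x : mdiff (fun=> X) x.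
Proof. by move=> j k; exact: cdiff_cst. Qed.

Lemma dd_cst s (X : M) x : dd s (fun=> X) x = 0.
Proof. by apply/matrixP => j k; rewrite mxE ddE wirtinger_cst. Qed.

Lemma mdiffM A B x : mdiff A x -> mdiff B x -> mdiff (fun y => A y *m B y) x.
Proof.
move=> dA dB j k; rewrite (_ : (fun y => _) = fun y => \sum_l A y j l * B y l k).
  by apply: cdiff_sum => l; exact: cdiffM.
by apply/funext => y; rewrite !mxE.
Qed.

Lemma ddM s A B x : mdiff A x -> mdiff B x ->
  dd s (fun y => A y *m B y) x = dd s A x *m B x + A x *m dd s B x.
Proof.
move=> dA dB; apply/matrixP => j k; rewrite !mxE (ddE s (fun y => A y *m B y)).
rewrite (_ : (fun y => _) = fun y => \sum_l A y j l * B y l k); last first.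
  by apply/funext => y; rewrite !mxE.
rewrite wirtinger_sum; last by move=> l; exact: (cdiffM (dA j l) (dB l k)).
rewrite -big_split /=.
by apply: eq_bigr => l _; rewrite (wirtingerM s (dA j l) (dB l k)) (ddE s A) (ddE s B).
Qed.

Lemma mdiffZ f A x : cdiff f x -> mdiff A x -> mdiff (fun y => f y *: A y) x.
Proof.
move=> df dA j k; rewrite (_ : (fun y => _) = fun y => f y * A y j k).
  exact: cdiffM.
by apply/funext => y; rewrite !mxE.
Qed.

Lemma ddZ s f A x : cdiff f x -> mdiff A x ->
  dd s (fun y => f y *: A y) x = wirtinger s f x *: A x + f x *: dd s A x.
Proof.
move=> df dA; apply/matrixP => j k; rewrite !mxE (ddE s A) (ddE s (fun y => f y *: A y)) -(wirtingerM s df (dA j k)).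
by congr (wirtinger s _ x); apply/funext => y; rewrite mxE.
Qed.

Lemma mdiffN A x : mdiff A x -> mdiff (fun y => - A y) x.
Proof.
move=> dA; rewrite (_ : (fun y => _) = fun y => (-1) *: A y).
  by apply: mdiffZ => //; exact: cdiff_cst.
by apply/funext => y; rewrite scaleN1r.
Qed.

Lemma ddN s A x : mdiff A x -> dd s (fun y => - A y) x = - dd s A x.
Proof.
move=> dA; rewrite (_ : (fun y => _) = fun y => (-1) *: A y).
  by rewrite ddZ ?wirtinger_cst ?scale0r ?add0r ?scaleN1r //; exact: cdiff_cst.
by apply/funext => y; rewrite scaleN1r.
Qed.

Lemma mdiffB A B x : mdiff A x -> mdiff B x -> mdiff (fun y => A y - B y) x.
Proof. by move=> dA dB; apply: mdiffD => //; exact: mdiffN. Qed.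

Lemma ddB s A B x : mdiff A x -> mdiff B x ->
  dd s (fun y => A y - B y) x = dd s A x - dd s B x.
Proof. by move=> dA dB; rewrite ddD ?ddN //; exact: mdiffN. Qed.

Lemma mdiff_adjoint A x : mdiff A x -> mdiff (fun y => adjoint (A y)) x.
Proof.
move=> dA j k; rewrite (_ : (fun y => _) = fun y => conjc (A y k j)).
  exact: cdiff_conj.
by apply/funext => y; rewrite adjointE.
Qed.

Lemma dd_adjoint s A x : mdiff A x ->
  dd s (fun y => adjoint (A y)) x = adjoint (dd (~~ s) A x).
Proof.
move=> dA; apply/matrixP => j k; rewrite adjointE !ddE -(wirtinger_conj s (dA k j)).
by congr (wirtinger s _ x); apply/funext => y; rewrite adjointE.
Qed.

Lemma cdiff_tr A x : mdiff A x -> cdiff (fun y => \tr (A y)) x.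
Proof. by move=> dA; apply: cdiff_sum => j. Qed.

Lemma wirtinger_tr s A x : mdiff A x ->
  wirtinger s (fun y => \tr (A y)) x = \tr (dd s A x).
Proof.
by move=> dA; rewrite wirtinger_sum //; apply: eq_bigr => j _; rewrite ddE.
Qed.

Lemma mndiff_eq n D A B : open D -> (forall x, D x -> A x = B x) ->
  mndiff n D A -> mndiff n D B.
Proof. by move=> oD AB dA j k; apply: cndiff_eq (dA j k) => // x /AB ->. Qed.

Lemma mndiff_subset n D D' A : D' `<=` D -> mndiff n D A -> mndiff n D' A.
Proof. by move=> sD dA j k; apply: cndiff_subset sD _. Qed.

Lemma mndiff_le m n D A : (m <= n)%N -> mndiff n D A -> mndiff m D A.
Proof. by move=> mn dA j k; apply: cndiff_le mn _. Qed.

Lemma mndiff_mdiff n D A x : mndiff n.+1 D A -> D x -> mdiff A x.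
Proof. by move=> dA Dx j k; apply: cndiff_cdiff Dx; apply: dA. Qed.

Lemma mndiff_cst n D (X : M) : open D -> mndiff n D (fun=> X).
Proof. by move=> oD j k; exact: cndiff_cst. Qed.

Lemma mndiffD n D A B : open D -> mndiff n D A -> mndiff n D B ->
  mndiff n D (fun x => A x + B x).
Proof.
move=> oD dA dB j k; apply: cndiff_eq (cndiffD oD (dA j k) (dB j k)) => // x _.
by rewrite mxE.
Qed.

Lemma mndiffM n D A B : open D -> mndiff n D A -> mndiff n D B ->
  mndiff n D (fun x => A x *m B x).
Proof.
move=> oD dA dB j k.
apply: (@cndiff_eq _ _ _ (fun x => \sum_l A x j l * B x l k)) => //.
  by move=> x _; rewrite mxE.
by apply: cndiff_sum => // l; exact: cndiffM.
Qed.

Lemma mndiffZ n D f A : open D -> cndiff n D f -> mndiff n D A ->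
  mndiff n D (fun x => f x *: A x).
Proof.
move=> oD df dA j k; apply: cndiff_eq (cndiffM oD df (dA j k)) => // x _.
by rewrite mxE.
Qed.

Lemma mndiffN n D A : open D -> mndiff n D A -> mndiff n D (fun x => - A x).
Proof.
move=> oD dA j k; apply: cndiff_eq (cndiffN oD (dA j k)) => // x _.
by rewrite mxE.
Qed.

Lemma mndiffB n D A B : open D -> mndiff n D A -> mndiff n D B ->
  mndiff n D (fun x => A x - B x).
Proof. by move=> oD dA dB; apply: mndiffD => //; exact: mndiffN. Qed.

Lemma mndiff_adjoint n D A : open D -> mndiff n D A ->
  mndiff n D (fun x => adjoint (A x)).
Proof.
move=> oD dA j k; apply: cndiff_eq (cndiff_conj oD (dA k j)) => // x _.
by rewrite adjointE.
Qed.

Lemma mndiff_dd s n D A : open D -> mndiff n.+1 D A -> mndiff n D (dd s A).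
Proof.
move=> oD dA j k; apply: cndiff_eq (cndiff_wirtinger s oD (dA j k)) => // x _.
by rewrite ddE.
Qed.

Lemma cndiff_tr n D A : open D -> mndiff n D A -> cndiff n D (fun x => \tr (A x)).
Proof. by move=> oD dA; apply: cndiff_sum. Qed.

Lemma ddC s t A x D : open D -> D x -> mndiff 2 D A ->
  dd s (dd t A) x = dd t (dd s A) x.
Proof.
move=> oD Dx dA; apply/matrixP => j k; rewrite !ddE.
transitivity (wirtinger s (wirtinger t (fun y => A y j k)) x).
  by congr (wirtinger s _ x); apply/funext => y; rewrite ddE.
rewrite (wirtingerC _ _ oD Dx (dA j k)).
by congr (wirtinger t _ x); apply/funext => y; rewrite ddE.
Qed.

End MatrixCalculus.

Section Inverse.
Context {R : realType}.
Local Notation C := R[i].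

Lemma cndiff_det n m D (A : R * R -> 'M[C]_m) : open D ->
  (forall j k, cndiff n D (fun y => A y j k)) -> cndiff n D (fun y => \det (A y)).
Proof.
move=> oD dA; apply: cndiff_sum => // p.
apply: cndiffM => //; first exact: cndiff_cst.
exact: cndiff_prod.
Qed.

(** Cramer's formula expresses the inverse by the determinant and cofactors, which are
    polynomials in the entries. *)
Lemma mndiff_inv n N D (A : mxfun R N) : open D -> mndiff n D A ->
  (forall x, D x -> A x \in unitmx) -> mndiff n D (fun x => invmx (A x)).
Proof.
move=> oD dA uA j k.
apply: (@cndiff_eq _ _ _ (fun x => (\det (A x))^-1 * cofactor (A x) k j)) => //.
  by move=> x Dx; rewrite /invmx uA // !mxE.
apply: (cndiffM oD).
  apply: (cndiffV oD); last exact: cndiff_det.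
  by move=> x /uA; rewrite unitmxE unitfE.
rewrite /cofactor; apply: (cndiffM oD); first exact: cndiff_cst.
apply: (cndiff_det oD) => a b.
by apply: (cndiff_eq oD _ (dA (lift k a) (lift j b))) => x _; rewrite !mxE.
Qed.

End Inverse.

(** * The modulus and complex derivatives of first and second order *)

(** The modulus as an element of R; the norm of R[i] has values in R[i] itself. *)
HB.lock Definition cabs (R : realType) (z : R[i]) : R := Normc.normc z.

Section Modulus.
Context {R : realType}.
Local Notation C := R[i].
Implicit Types (z w : C) (x h : R * R).

Lemma cabsE z : cabs z = Num.sqrt (complex.Re z ^+ 2 + complex.Im z ^+ 2).
Proof. by rewrite unlock; case: z. Qed.
Lemma cabs_ge0 z : 0 <= cabs z. Proof. by rewrite cabsE sqrtr_ge0. Qed.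
Lemma cabsM z w : cabs (z * w) = cabs z * cabs w.
Proof. by rewrite unlock Normc.normcM. Qed.
Lemma ler_cabsD z w : cabs (z + w) <= cabs z + cabs w.
Proof. by rewrite unlock; exact: le_normcD. Qed.
Lemma cabsN z : cabs (- z) = cabs z.
Proof. by rewrite unlock; exact: normcN. Qed.
Lemma ler_cabsB z w : cabs (z - w) <= cabs z + cabs w.
Proof. by rewrite -(cabsN w); exact: ler_cabsD. Qed.
Lemma cabsB_sym z w : cabs (z - w) = cabs (w - z).
Proof. by rewrite -cabsN opprB. Qed.
Lemma cabs0 : cabs (0 : C) = 0. Proof. by rewrite unlock Normc.normc0. Qed.
Lemma cabs1 : cabs (1 : C) = 1. Proof. by rewrite unlock Normc.normc1. Qed.
Lemma cabsV z : cabs z^-1 = (cabs z)^-1.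
Proof. by rewrite unlock Normc.normcV. Qed.
Lemma cabsX z n : cabs (z ^+ n) = cabs z ^+ n.
Proof. by elim: n => [|n IH]; rewrite ?expr0 ?cabs1 // !exprS cabsM IH. Qed.
Lemma cabs_eq0 z : (cabs z == 0) = (z == 0).
Proof.
apply/idP/idP => [|/eqP ->]; last by rewrite cabs0.
by rewrite unlock => /eqP /Normc.eq0_normc ->.
Qed.
Lemma cabs_gt0 z : (0 < cabs z) = (z != 0).
Proof. by rewrite lt_neqAle cabs_ge0 andbT eq_sym cabs_eq0. Qed.
Lemma sqr_cabs z : cabs z ^+ 2 = complex.Re z ^+ 2 + complex.Im z ^+ 2.
Proof. by rewrite cabsE sqr_sqrtr // addr_ge0 // sqr_ge0. Qed.

Lemma le_Re_cabs z : `|complex.Re z| <= cabs z.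
Proof. by rewrite cabsE -sqrtr_sqr ler_wsqrtr // lerDl sqr_ge0. Qed.
Lemma le_Im_cabs z : `|complex.Im z| <= cabs z.
Proof. by rewrite cabsE -sqrtr_sqr ler_wsqrtr // lerDr sqr_ge0. Qed.
Lemma cabs_le z : cabs z <= `|complex.Re z| + `|complex.Im z|.
Proof.
rewrite -(@ler_pXn2r _ 2) ?nnegrE ?cabs_ge0 ?addr_ge0 //.
rewrite sqr_cabs sqrrD !real_normK ?num_real //.
have : 0 <= `|complex.Re z| * `|complex.Im z| by exact: mulr_ge0.
by move=> H; lra.
Qed.

Lemma zetaD x h : zeta (x + h) = zeta x + zeta h.
Proof. by []. Qed.
Lemma zetaB x h : zeta (x - h) = zeta x - zeta h.
Proof. by []. Qed.
Lemma zeta0 : zeta (0 : R * R) = 0. Proof. by []. Qed.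
Lemma zeta_inj : injective (@zeta R).
Proof. by move=> [a b] [c d] [-> ->]. Qed.
Lemma zeta_eq0 x : (zeta x == 0) = (x == 0).
Proof. by rewrite -zeta0 (inj_eq zeta_inj). Qed.
Lemma zeta_neq x h : (zeta x - zeta h == 0) = (x == h).
Proof. by rewrite -zetaB zeta_eq0 subr_eq0. Qed.

Lemma norm_le_zeta x : `|x| <= cabs (zeta x).
Proof.
by rewrite norm_pairE ge_max (le_Re_cabs (zeta x)) (le_Im_cabs (zeta x)).
Qed.
Lemma zeta_le_norm x : cabs (zeta x) <= 2 * `|x|.
Proof.
apply: (le_trans (cabs_le _)); rewrite mulr2n mulrDl mul1r norm_pairE.
by apply: lerD; rewrite le_max lexx ?orbT.
Qed.

Lemma scale_zeta (t : R) h : zeta (t *: h) = t%:C * zeta h.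
Proof. by case: h => u v; apply: complexP; rewrite ReImE /= /GRing.scale /=; ring. Qed.

Lemma cabs_real (t : R) : cabs t%:C = `|t|.
Proof. by rewrite cabsE /= expr0n addr0 sqrtr_sqr. Qed.

(** By the Bernoulli inequality. *)
Lemma expr_unbounded (q c : R) : 1 < q -> exists n, c < q ^+ n.
Proof.
move=> q1; pose d := q - 1; have d0 : 0 < d by rewrite subr_gt0.
have ber n : 1 + n%:R * d <= q ^+ n.
  elim: n => [|n IH]; first by rewrite mul0r addr0 expr0.
  rewrite exprS; apply: le_trans (ler_wpM2l _ IH); last by rewrite ltW // (lt_trans ltr01).
  have -> : q = 1 + d by rewrite /d; ring.
  rewrite -natr1.
  have : 0 <= d * (n%:R * d) by rewrite !mulr_ge0 // ltW.
  by move=> H; lra.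
exists (Num.bound (c / d)); apply: lt_le_trans (ber _).
have : c / d < (Num.bound (c / d))%:R.
  have [cd|cd] := leP 0 (c / d); first exact: archi_boundP.
  exact: lt_le_trans cd (ler0n _ _).
by rewrite ltr_pdivrMr // => H; lra.
Qed.

Lemma expr_small (q e : R) : 0 <= q < 1 -> 0 < e -> exists n, q ^+ n < e.
Proof.
move=> /andP[q0 q1] e0; have [->|qn0] := eqVneq q 0; first by exists 1%N; rewrite expr1.
have qp : 0 < q by rewrite lt_neqAle eq_sym qn0.
have [|n Hn] := @expr_unbounded q^-1 e^-1; first by rewrite invf_gt1.
by exists n; move: Hn; rewrite exprVn ltf_pV2 ?posrE ?exprn_gt0.
Qed.

End Modulus.

Section ComplexDerivative.
Context {R : realType}.
Local Notation C := R[i].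
Implicit Types (F G : R * R -> C) (x y h : R * R).

Definition cder F x (c : C) : Prop :=
  forall e, 0 < e -> exists2 d, 0 < d &
    forall h, `|h| < d -> cabs (F (x + h) - F x - c * zeta h) <= e * cabs (zeta h).

(** A complex expansion of second order at a single point. It is stable under sums and
    products and suffices for the maximum principle, so it replaces holomorphy until
    power series are available. *)
Definition cder2 F x : Prop :=
  exists c1 c2 : C, forall e, 0 < e -> exists2 d, 0 < d &
    forall h, `|h| < d ->
    cabs (F (x + h) - (F x + c1 * zeta h + c2 * zeta h ^+ 2)) <= e * cabs (zeta h) ^+ 2.

Definition ccont F x : Prop :=
  forall e, 0 < e -> exists2 d, 0 < d & forall h, `|h| < d -> cabs (F (x + h) - F x) < e.

Lemma cder_ccont F x c : cder F x c -> ccont F x.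
Proof.
move=> H e e0; have [d d0 Hd] := H _ ltr01.
have k0 : 0 < 1 + cabs c by rewrite ltr_pwDl // cabs_ge0.
exists (Num.min d (e / (2 * (1 + cabs c)) / 2)).
  by rewrite lt_min d0 !divr_gt0 // mulr_gt0.
move=> h; rewrite lt_min => /andP[hd he].
have -> : F (x + h) - F x = (F (x + h) - F x - c * zeta h) + c * zeta h by ring.
apply: (le_lt_trans (ler_cabsD _ _)); rewrite cabsM.
apply: (@le_lt_trans _ _ ((1 + cabs c) * cabs (zeta h))).
  by rewrite mulrDl lerD2r; apply: Hd.
apply: (@le_lt_trans _ _ ((1 + cabs c) * (2 * `|h|))).
  by rewrite ler_wpM2l ?(ltW k0) // zeta_le_norm.
apply: (@le_lt_trans _ _ ((1 + cabs c) * (2 * (e / (2 * (1 + cabs c)) / 2)))).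
  by rewrite ler_wpM2l ?(ltW k0) // ler_wpM2l // ltW.
have -> : (1 + cabs c) * (2 * (e / (2 * (1 + cabs c)) / 2)) = e / 2.
  by field; rewrite gt_eqF.
by move: e0 => ?; lra.
Qed.

Lemma cder2_cder F x : cder2 F x -> exists c, cder F x c.
Proof.
move=> [c1 [c2 H]]; exists c1 => e e0; have [d d0 Hd] := H _ ltr01.
have k0 : 0 < 1 + cabs c2 by rewrite ltr_pwDl // cabs_ge0.
exists (Num.min d (e / (1 + cabs c2) / 2)); first by rewrite lt_min d0 !divr_gt0.
move=> h; rewrite lt_min => /andP[hd he].
have -> : F (x + h) - F x - c1 * zeta h =
  (F (x + h) - (F x + c1 * zeta h + c2 * zeta h ^+ 2)) + c2 * zeta h ^+ 2 by ring.
apply: (le_trans (ler_cabsD _ _)); rewrite cabsM cabsX.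
apply: (@le_trans _ _ ((1 + cabs c2) * cabs (zeta h) ^+ 2)).
  by rewrite mulrDl lerD2r; apply: Hd.
rewrite expr2 mulrA ler_wpM2r ?cabs_ge0 //.
apply: (@le_trans _ _ ((1 + cabs c2) * (2 * `|h|))).
  by rewrite ler_wpM2l ?(ltW k0) // zeta_le_norm.
have eE : e = (1 + cabs c2) * (2 * (e / (1 + cabs c2) / 2)).
  by field; rewrite gt_eqF.
by rewrite [leRHS]eE ler_wpM2l ?(ltW k0) // ler_wpM2l // ltW.
Qed.

Lemma cder2_ccont F x : cder2 F x -> ccont F x.
Proof. by move=> /cder2_cder [c /cder_ccont]. Qed.

Lemma cder_unique F x c c' : cder F x c -> cder F x c' -> c = c'.
Proof.
move=> H H'; apply/eqP; rewrite -subr_eq0 -cabs_eq0 eq_le cabs_ge0 andbT.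
apply/ler_addgt0Pl => e e0; rewrite addr0.
have e2 : 0 < e / 2 by rewrite divr_gt0.
have [d d0 Hd] := H _ e2; have [d' d0' Hd'] := H' _ e2.
pose m := Num.min d d' / 2; pose h : R * R := (m, 0).
have m0 : 0 < m by rewrite divr_gt0 // lt_min d0.
have nh : `|h| = m by rewrite norm_pairE /= normr0 gtr0_norm //; apply/max_idPl/ltW.
have mlt : m < Num.min d d' by rewrite /m; have : 0 < Num.min d d' by [rewrite lt_min d0]; move=> ?; lra.
have zh : 0 < cabs (zeta h) by rewrite cabs_gt0 zeta_eq0 -normr_gt0 nh.
have [md md'] : m < d /\ m < d' by apply/andP; rewrite -lt_min.
rewrite -(ler_pM2r zh) -cabsM.
have -> : (c - c') * zeta h = (F (x + h) - F x - c' * zeta h) - (F (x + h) - F x - c * zeta h) by ring.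
apply: (le_trans (ler_cabsB _ _)).
have -> : e * cabs (zeta h) = e / 2 * cabs (zeta h) + e / 2 * cabs (zeta h) by field.
by apply: lerD; [apply: Hd'|apply: Hd]; rewrite nh.
Qed.

Lemma cder_near F G x c : {near x, F =1 G} -> cder F x c -> cder G x c.
Proof.
move=> FG H e e0; have [d d0 Hd] := H _ e0.
have /nbhs_normP [r /= r0 Hr] := FG.
exists (Num.min d r); first by rewrite lt_min d0.
move=> h; rewrite lt_min => /andP[hd hr].
rewrite -Hr /=; last by rewrite opprD addNKr normrN.
by rewrite -(Hr x) ?Hd //= subrr normr0.
Qed.

Lemma cder2_near F G x : {near x, F =1 G} -> cder2 F x -> cder2 G x.
Proof.
move=> FG [c1 [c2 H]]; exists c1, c2 => e e0; have [d d0 Hd] := H _ e0.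
have /nbhs_normP [r /= r0 Hr] := FG.
exists (Num.min d r); first by rewrite lt_min d0.
move=> h; rewrite lt_min => /andP[hd hr].
rewrite -Hr /=; last by rewrite opprD addNKr normrN.
by rewrite -(Hr x) ?Hd //= subrr normr0.
Qed.

Lemma cder2_cst c x : cder2 (fun=> c) x.
Proof.
exists 0, 0 => e e0; exists 1 => // h _.
by rewrite !mul0r !addr0 subrr cabs0 mulr_ge0 ?(ltW e0) // exprn_ge0 // cabs_ge0.
Qed.

Lemma cder2_zeta x : cder2 (@zeta R) x.
Proof.
exists 1, 0 => e e0; exists 1 => // h _.
by rewrite zetaD mul1r mul0r addr0 subrr cabs0 mulr_ge0 ?(ltW e0) // exprn_ge0 // cabs_ge0.
Qed.

Lemma cder2D F G x : cder2 F x -> cder2 G x -> cder2 (fun y => F y + G y) x.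
Proof.
move=> [a1 [a2 Ha]] [b1 [b2 Hb]]; exists (a1 + b1), (a2 + b2) => e e0.
have e2 : 0 < e / 2 by rewrite divr_gt0.
have [d d0 Hd] := Ha _ e2; have [d' d0' Hd'] := Hb _ e2.
exists (Num.min d d'); first by rewrite lt_min d0.
move=> h; rewrite lt_min => /andP[hd hd'].
have -> : F (x + h) + G (x + h) - (F x + G x + (a1 + b1) * zeta h + (a2 + b2) * zeta h ^+ 2) =
  (F (x + h) - (F x + a1 * zeta h + a2 * zeta h ^+ 2)) +
  (G (x + h) - (G x + b1 * zeta h + b2 * zeta h ^+ 2)) by ring.
apply: (le_trans (ler_cabsD _ _)).
have -> : e * cabs (zeta h) ^+ 2 = e / 2 * cabs (zeta h) ^+ 2 + e / 2 * cabs (zeta h) ^+ 2 by field.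
by apply: lerD; [apply: Hd|apply: Hd'].
Qed.

Definition taylor2 (a0 a1 a2 z : C) : C := a0 + a1 * z + a2 * z ^+ 2.

Lemma cabs_taylor2 a0 a1 a2 z : cabs z <= 1 ->
  cabs (taylor2 a0 a1 a2 z) <= cabs a0 + cabs a1 + cabs a2.
Proof.
move=> z1; apply: (le_trans (ler_cabsD _ _)); apply: lerD; last first.
  by rewrite cabsM cabsX ler_piMr ?cabs_ge0 // exprn_ile1 // cabs_ge0.
apply: (le_trans (ler_cabsD _ _)); rewrite lerD2l cabsM.
by rewrite ler_piMr ?cabs_ge0.
Qed.

Lemma cder2M F G x : cder2 F x -> cder2 G x -> cder2 (fun y => F y * G y) x.
Proof.
move=> [a1 [a2 Ha]] [b1 [b2 Hb]].
set A := fun z => taylor2 (F x) a1 a2 z; set B := fun z => taylor2 (G x) b1 b2 z.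
pose KA := cabs (F x) + cabs a1 + cabs a2; pose KB := cabs (G x) + cabs b1 + cabs b2.
have KA0 : 0 <= KA by rewrite !addr_ge0 ?cabs_ge0.
have KB0 : 0 <= KB by rewrite !addr_ge0 ?cabs_ge0.
pose L := cabs (a1 * b2 + a2 * b1) + cabs (a2 * b2).
have L0 : 0 <= L by rewrite !addr_ge0 ?cabs_ge0.
exists (a1 * G x + F x * b1), (F x * b2 + a1 * b1 + a2 * G x) => e e0.
pose K := KA + KB + L + 2.
have K0 : 0 < K by rewrite /K; lra.
pose e' := Num.min 1 (e / K).
have e'0 : 0 < e' by rewrite lt_min ltr01 divr_gt0.
have e'1 : e' <= 1 by rewrite ge_min lexx.
have e'e : e' * K <= e by rewrite -ler_pdivlMr // ge_min lexx orbT.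
have [d d0 Hd] := Ha _ e'0; have [d' d0' Hd'] := Hb _ e'0.
exists (Num.min (Num.min d d') (e' / 2)); first by rewrite !lt_min d0 d0' divr_gt0.
move=> h; rewrite !lt_min => /andP[/andP[/Hd ha /Hd' hb] hm].
set z := zeta h in ha hb *.
have ze' : cabs z <= e'.
  apply: (le_trans (zeta_le_norm h)); move: (ltW hm).
  by rewrite ler_pdivlMr // mulrC.
have z1 := le_trans ze' e'1.
have z20 : 0 <= cabs z ^+ 2 by rewrite exprn_ge0 // cabs_ge0.
have -> : F (x + h) * G (x + h) - (F x * G x + (a1 * G x + F x * b1) * z +
     (F x * b2 + a1 * b1 + a2 * G x) * z ^+ 2) =
  ((F (x + h) - A z) * (G (x + h) - B z) + (F (x + h) - A z) * B z)
  + (A z * (G (x + h) - B z) + z ^+ 2 * (z * ((a1 * b2 + a2 * b1) + z * (a2 * b2)))).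
  by rewrite /A /B /taylor2; ring.
rewrite -[G x + _ + _]/(B z) in hb; rewrite -[F x + _ + _]/(A z) in ha.
have hA : cabs (A z) <= KA by exact: cabs_taylor2.
have hB : cabs (B z) <= KB by exact: cabs_taylor2.
apply: (@le_trans _ _ (e' * K * cabs z ^+ 2)); last by rewrite ler_wpM2r.
apply: (@le_trans _ _ ((e' * cabs z ^+ 2 * 1 + e' * cabs z ^+ 2 * KB) +
    (KA * (e' * cabs z ^+ 2) + cabs z ^+ 2 * (e' * L)))); last first.
  rewrite /K; have : 0 <= e' * cabs z ^+ 2 by rewrite mulr_ge0 // ltW.
  by move=> H; lra.
apply: (le_trans (ler_cabsD _ _)); apply: lerD.
  apply: (le_trans (ler_cabsD _ _)); rewrite !cabsM; apply: lerD.
    apply: ler_pM; rewrite ?cabs_ge0 //.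
    apply: (le_trans hb); rewrite mulr_ile1 ?(ltW e'0) //.
    by rewrite exprn_ile1 // cabs_ge0.
  by apply: ler_pM; rewrite ?cabs_ge0.
apply: (le_trans (ler_cabsD _ _)).
rewrite [cabs (A z * _)]cabsM [cabs (z ^+ 2 * _)]cabsM cabsX [cabs (z * _)]cabsM.
apply: lerD.
  by apply: ler_pM; rewrite ?cabs_ge0.
rewrite ler_wpM2l //; apply: ler_pM; rewrite ?cabs_ge0 //.
apply: (le_trans (ler_cabsD _ _)); rewrite lerD2l cabsM.
by rewrite ler_piMl ?cabs_ge0.
Qed.

Lemma cder2X F x n : cder2 F x -> cder2 (fun y => F y ^+ n) x.
Proof.
move=> H; elim: n => [|n IH]; first exact: cder2_cst.
rewrite (_ : (fun y => _) = fun y => F y * F y ^+ n); first exact: cder2M.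
by apply/funext => y; rewrite exprS.
Qed.

Lemma cder2_prod (I : Type) (r : seq I) (F : I -> R * R -> C) x :
  (forall i, cder2 (F i) x) -> cder2 (fun y => \prod_(i <- r) F i y) x.
Proof.
move=> HF; elim: r => [|i r IH].
  rewrite (_ : (fun y => _) = fun=> 1); first exact: cder2_cst.
  by apply/funext => y; rewrite big_nil.
rewrite (_ : (fun y => _) = fun y => F i y * \prod_(j <- r) F j y); first exact: cder2M.
by apply/funext => y; rewrite big_cons.
Qed.

Lemma cder2V_zeta (b x : R * R) : x != b -> cder2 (fun y => (zeta y - zeta b)^-1) x.
Proof.
move=> xb; set u := (zeta x - zeta b)^-1.
have v0 : zeta x - zeta b != 0 by rewrite zeta_neq.
have vp : 0 < cabs (zeta x - zeta b) by rewrite cabs_gt0.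
exists (- u ^+ 2), (u ^+ 3) => e e0.
pose c := cabs (zeta x - zeta b).
exists (Num.min (c / 4) (e * (c ^+ 4 / 2) / 2)).
  by rewrite lt_min !divr_gt0 //= mulr_gt0 // divr_gt0 // exprn_gt0.
move=> h; rewrite lt_min => /andP[h1 h2].
have z1 : cabs (zeta h) < c / 2.
  by apply: (le_lt_trans (zeta_le_norm h)); lra.
have z2 : cabs (zeta h) <= e * (c ^+ 4 / 2).
  by apply: (le_trans (zeta_le_norm h)); lra.
have low : c / 2 <= cabs (zeta (x + h) - zeta b).
  have : c <= cabs (zeta (x + h) - zeta b) + cabs (zeta h).
    rewrite /c (_ : zeta x - zeta b = (zeta (x + h) - zeta b) - zeta h).
      exact: ler_cabsB.
    by rewrite zetaD; ring.
  by move=> H; lra.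
have w0 : zeta (x + h) - zeta b != 0.
  by rewrite -cabs_gt0; apply: lt_le_trans low; rewrite divr_gt0.
have -> : (zeta (x + h) - zeta b)^-1 - (u + - u ^+ 2 * zeta h + u ^+ 3 * zeta h ^+ 2) =
   - (zeta h ^+ 3 / ((zeta x - zeta b) ^+ 3 * (zeta (x + h) - zeta b))).
  by rewrite /u; move: w0; rewrite zetaD => w0; field; rewrite v0 w0.
have -> : cabs (- (zeta h ^+ 3 / ((zeta x - zeta b) ^+ 3 * (zeta (x + h) - zeta b)))) =
    cabs (zeta h) / (c ^+ 3 * cabs (zeta (x + h) - zeta b)) * cabs (zeta h) ^+ 2.
  rewrite cabsN [LHS]cabsM cabsV [cabs (_ ^+ 3 * _)]cabsM !cabsX -/c.
  by rewrite exprS mulrAC.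
rewrite ler_wpM2r //; first by rewrite exprn_ge0 // cabs_ge0.
rewrite ler_pdivrMr; last by rewrite mulr_gt0 ?exprn_gt0 // cabs_gt0.
apply: (le_trans z2); rewrite ler_wpM2l ?(ltW e0) //.
rewrite (_ : c ^+ 4 / 2 = c ^+ 3 * (c / 2)); last by field.
by rewrite ler_wpM2l // exprn_ge0 // cabs_ge0.
Qed.

Lemma cder_cst c x : cder (fun=> c) x 0.
Proof.
move=> e e0; exists 1 => // h _.
by rewrite mul0r subr0 subrr cabs0 mulr_ge0 ?(ltW e0) // cabs_ge0.
Qed.

Lemma cderD F G x a b : cder F x a -> cder G x b -> cder (fun y => F y + G y) x (a + b).
Proof.
move=> Ha Hb e e0.
have e2 : 0 < e / 2 by rewrite divr_gt0.
have [d d0 Hd] := Ha _ e2; have [d' d0' Hd'] := Hb _ e2.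
exists (Num.min d d'); first by rewrite lt_min d0.
move=> h; rewrite lt_min => /andP[hd hd'].
have -> : F (x + h) + G (x + h) - (F x + G x) - (a + b) * zeta h =
  (F (x + h) - F x - a * zeta h) + (G (x + h) - G x - b * zeta h) by ring.
apply: (le_trans (ler_cabsD _ _)).
have -> : e * cabs (zeta h) = e / 2 * cabs (zeta h) + e / 2 * cabs (zeta h) by field.
by apply: lerD; [apply: Hd|apply: Hd'].
Qed.

Lemma cderZ F x a k : cder F x a -> cder (fun y => k * F y) x (k * a).
Proof.
move=> Ha e e0.
have k0 : 0 < 1 + cabs k by rewrite ltr_pwDl // cabs_ge0.
have [|d d0 Hd] := Ha (e / (1 + cabs k)); first by rewrite divr_gt0.
exists d => // h /Hd hd.
have -> : k * F (x + h) - k * F x - k * a * zeta h = k * (F (x + h) - F x - a * zeta h) by ring.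
rewrite cabsM; apply: (le_trans (ler_wpM2l (cabs_ge0 _) hd)).
rewrite mulrA ler_wpM2r ?cabs_ge0 // mulrA ler_pdivrMr // mulrC ler_wpM2l ?(ltW e0) //.
by rewrite lerDr.
Qed.

Lemma ccontD F G x : ccont F x -> ccont G x -> ccont (fun y => F y + G y) x.
Proof.
move=> Ha Hb e e0.
have e2 : 0 < e / 2 by rewrite divr_gt0.
have [d d0 Hd] := Ha _ e2; have [d' d0' Hd'] := Hb _ e2.
exists (Num.min d d'); first by rewrite lt_min d0.
move=> h; rewrite lt_min => /andP[hd hd'].
have -> : F (x + h) + G (x + h) - (F x + G x) = (F (x + h) - F x) + (G (x + h) - G x) by ring.
apply: (le_lt_trans (ler_cabsD _ _)); rewrite [e](splitr e).
by apply: ltrD; [apply: Hd|apply: Hd'].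
Qed.

Lemma ccontM F G x : ccont F x -> ccont G x -> ccont (fun y => F y * G y) x.
Proof.
move=> Ha Hb e e0.
pose K := 1 + cabs (F x) + cabs (G x).
have K0 : 0 < K by rewrite /K -addrA ltr_pwDl // addr_ge0 // cabs_ge0.
pose e' := Num.min 1 (e / K / 2).
have e'0 : 0 < e' by rewrite lt_min ltr01 !divr_gt0.
have e'1 : e' <= 1 by rewrite ge_min lexx.
have e'e : e' * K <= e / 2.
  by rewrite -ler_pdivlMr // mulrAC ge_min lexx orbT.
have [d d0 Hd] := Ha _ e'0; have [d' d0' Hd'] := Hb _ e'0.
exists (Num.min d d'); first by rewrite lt_min d0.
move=> h; rewrite lt_min => /andP[/Hd ha /Hd' hb].
have -> : F (x + h) * G (x + h) - F x * G x =
  (F (x + h) - F x) * (G (x + h) - G x) + (F x * (G (x + h) - G x) + (F (x + h) - F x) * G x) by ring.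
apply: (@le_lt_trans _ _ (e' * K)); last by apply: (le_lt_trans e'e); lra.
have -> : e' * K = e' * 1 + e' * (cabs (F x) + cabs (G x)) by rewrite /K; ring.
apply: (le_trans (ler_cabsD _ _)); apply: lerD.
  rewrite cabsM; apply: ler_pM; rewrite ?cabs_ge0 ?(ltW ha) //.
  exact: le_trans (ltW hb) _.
apply: (le_trans (ler_cabsD _ _)); rewrite !cabsM mulrDr; apply: lerD.
  by rewrite mulrC ler_wpM2r ?cabs_ge0 // ltW.
by rewrite ler_wpM2r ?cabs_ge0 // ltW.
Qed.

End ComplexDerivative.

(** * The maximum modulus principle *)

Section MaximumPrinciple.
Context {R : realType}.
Local Notation C := R[i].
Implicit Types (F G : R * R -> C) (x y h a : R * R).

Definition cdisc a (r : R) : set (R * R) := [set y | cabs (zeta (y - a)) <= r].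

Lemma sqr_cabs_zeta x : cabs (zeta x) ^+ 2 = x.1 ^+ 2 + x.2 ^+ 2.
Proof. by rewrite sqr_cabs. Qed.

Lemma continuous_sqr_zeta a :
  continuous (fun y : R * R => cabs (zeta (y - a)) ^+ 2).
Proof.
move=> y; have -> : (fun y : R * R => cabs (zeta (y - a)) ^+ 2) =
    (fun y => (y.1 - a.1) * (y.1 - a.1) + (y.2 - a.2) * (y.2 - a.2)).
  by apply/funext => z; rewrite sqr_cabs_zeta !expr2.
by apply: cvgD; apply: cvgM; apply: cvgB; try exact: cvg_cst;
  try exact: cvg_fst; exact: cvg_snd.
Qed.

Lemma compact_cdisc a r : 0 <= r -> compact (cdisc a r).
Proof.
move=> r0.
have cB : compact (`[a.1 - r, a.1 + r] `*` `[a.2 - r, a.2 + r] : set (R * R)).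
  by apply: compact_setX; exact: segment_compact.
apply: subclosed_compact cB _.
  have -> : cdisc a r = (fun y => cabs (zeta (y - a)) ^+ 2) @^-1` [set t | t <= r ^+ 2].
    apply/seteqP; split => y /=; rewrite /cdisc /=.
      by move=> H; rewrite ler_pXn2r // nnegrE cabs_ge0.
    by rewrite ler_pXn2r // nnegrE cabs_ge0.
  apply: closed_comp; last exact: closed_le.
  by move=> y _; exact: continuous_sqr_zeta.
move=> y; rewrite /cdisc /= => H.
have := le_trans (norm_le_zeta (y - a)) H; rewrite norm_pairE ge_max /= => /andP[].
by rewrite !ler_norml !in_itv /= => /andP[A B] /andP[A' B']; split; apply/andP; split; lra.
Qed.

Lemma ler_cabs_dist (z w : C) : `|cabs z - cabs w| <= cabs (z - w).
Proof.
rewrite ler_norml; apply/andP; split.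
  have := ler_cabsB z (z - w); rewrite opprB addrC subrK => H; lra.
by have := ler_cabsD (z - w) w; rewrite subrK => H; lra.
Qed.

Lemma ccont_cabs F x : ccont F x -> {for x, continuous (fun y => cabs (F y))}.
Proof.
move=> H; apply/(@cvgrPdist_lt _ R^o) => e e0; have [d d0 Hd] := H e e0.
suff : \forall y \near x, `|cabs (F x) - cabs (F y)| < e by [].
apply/nbhs_normP; exists d => //= y; rewrite /= distrC => yd.
rewrite distrC; apply: (le_lt_trans (ler_cabs_dist _ _)).
by have := Hd (y - x) yd; rewrite [x + _]addrC subrK.
Qed.

(** The mean over four points of a small cross replaces the mean over a circle: for a
    quadratic polynomial in zeta the cross terms cancel, and the modulus of the centre
    is bounded by the mean. *)
Lemma four_point_average (f c1 c2 : C) (t : R) :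
  cabs (taylor2 f c1 c2 (zeta (t, 0))) ^+ 2 + cabs (taylor2 f c1 c2 (zeta (0, t))) ^+ 2 +
  cabs (taylor2 f c1 c2 (zeta (- t, 0))) ^+ 2 + cabs (taylor2 f c1 c2 (zeta (0, - t))) ^+ 2 =
  4 * cabs f ^+ 2 + 4 * (cabs c1 ^+ 2 * t ^+ 2 + cabs c2 ^+ 2 * t ^+ 4).
Proof.
rewrite !sqr_cabs /taylor2 !expr2 !ReImE /zeta /=.
by case: f c1 c2 => [f f'] [c c'] [d d'] /=; ring.
Qed.

Lemma sqr_perturb (z e : C) (K b : R) : cabs z <= K -> cabs e <= b ->
  cabs z ^+ 2 - 2 * K * b <= cabs (z + e) ^+ 2.
Proof.
move=> zK eb.
have H := ler_cabsB (z + e) e; rewrite addrK in H.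
have z0 := cabs_ge0 z; have e0 := cabs_ge0 e; have w0 := cabs_ge0 (z + e).
have ze : cabs z * cabs e <= K * b by exact: ler_pM.
have zw : cabs z * cabs z <= cabs z * (cabs (z + e) + cabs e) by rewrite ler_wpM2l.
have [ez|ez] := leP (cabs z) (cabs e).
  have : cabs z * cabs z <= cabs z * cabs e by rewrite ler_wpM2l.
  have : 0 <= cabs (z + e) ^+ 2 by rewrite exprn_ge0.
  have : 0 <= cabs z * cabs e by rewrite mulr_ge0.
  by rewrite !expr2; lra.
have : (cabs z - cabs e) ^+ 2 <= cabs (z + e) ^+ 2.
  by rewrite ler_pXn2r ?nnegrE // ?subr_ge0 ?(ltW ez) //; lra.
have : 0 <= cabs e ^+ 2 by rewrite exprn_ge0.
by rewrite !expr2; lra.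
Qed.

(** The average over a small cross of the squared modulus plus eps times the squared
    distance exceeds the central value by about eps t^2, which beats the error of the
    expansion. *)
Lemma not_local_max F y a (eps d : R) : cder2 F y -> 0 < eps -> 0 < d ->
  ~ (forall h, `|h| < d ->
      cabs (F (y + h)) ^+ 2 + eps * cabs (zeta (y + h - a)) ^+ 2 <=
      cabs (F y) ^+ 2 + eps * cabs (zeta (y - a)) ^+ 2).
Proof.
move=> [c1 [c2 Hc]] e0 d0 Hmax.
pose K := cabs (F y) + cabs c1 + cabs c2.
have K0 : 0 <= K by rewrite !addr_ge0 // cabs_ge0.
(* The error of the expansion changes the squared modulus by at most 2 K eta t^2 < eps
   t^2. *)
pose eta := eps / (4 * (K + 1)).
have eta0 : 0 < eta by rewrite divr_gt0 // mulr_gt0 // ltr_wpDl.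
have [d' d0' Hd'] := Hc _ eta0.
pose t := Num.min 1 (Num.min d d') / 2.
have m0 : 0 < Num.min 1 (Num.min d d') by rewrite !lt_min ltr01 d0.
have t0 : 0 < t by rewrite divr_gt0.
have /andP[t1 /andP[td td']] : [&& t < 1, t < d & t < d'].
  by rewrite -!lt_min /t; lra.
have point h : `|h| = t -> cabs (zeta h) = t ->
    cabs (taylor2 (F y) c1 c2 (zeta h)) ^+ 2 - 2 * K * (eta * t ^+ 2)
    <= cabs (F (y + h)) ^+ 2.
  move=> nh zh; have := Hd' h; rewrite nh zh => /(_ td') He.
  have zK : cabs (taylor2 (F y) c1 c2 (zeta h)) <= K.
    by apply: cabs_taylor2; rewrite zh ltW.
  have := sqr_perturb zK He; rewrite (_ : taylor2 _ _ _ _ + _ = F (y + h)) //.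
  by rewrite /taylor2 addrC subrK.
have nt1 (s : R) : `|s| = t -> `|(s, 0) : R * R| = t.
  by move=> st; rewrite norm_pairE /= normr0 st; apply/max_idPl/ltW.
have nt2 (s : R) : `|s| = t -> `|(0, s) : R * R| = t.
  by move=> st; rewrite norm_pairE /= normr0 st; apply/max_idPr/ltW.
have zt1 (s : R) : `|s| = t -> cabs (zeta (s, 0)) = t.
  by move=> st; rewrite cabsE /= expr0n addr0 sqrtr_sqr.
have zt2 (s : R) : `|s| = t -> cabs (zeta (0, s)) = t.
  by move=> st; rewrite cabsE /= expr0n add0r sqrtr_sqr.
have tt : `|t| = t by rewrite gtr0_norm.
have tN : `|- t| = t by rewrite normrN gtr0_norm.
have p1 := point _ (nt1 _ tt) (zt1 _ tt).
have p2 := point _ (nt2 _ tt) (zt2 _ tt).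
have p3 := point _ (nt1 _ tN) (zt1 _ tN).
have p4 := point _ (nt2 _ tN) (zt2 _ tN).
have q1 := Hmax (t, 0); rewrite (nt1 _ tt) in q1; have {}q1 := q1 td.
have q2 := Hmax (0, t); rewrite (nt2 _ tt) in q2; have {}q2 := q2 td.
have q3 := Hmax (- t, 0); rewrite (nt1 _ tN) in q3; have {}q3 := q3 td.
have q4 := Hmax (0, - t); rewrite (nt2 _ tN) in q4; have {}q4 := q4 td.
have avg := four_point_average (F y) c1 c2 t.
have quad : cabs (zeta (y + (t, 0) - a)) ^+ 2 + cabs (zeta (y + (0, t) - a)) ^+ 2 +
   cabs (zeta (y + (- t, 0) - a)) ^+ 2 + cabs (zeta (y + (0, - t) - a)) ^+ 2 =
   4 * cabs (zeta (y - a)) ^+ 2 + 4 * t ^+ 2.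
  by rewrite !sqr_cabs_zeta /=; ring.
have {}quad := congr1 ( *%R eps) quad; rewrite !mulrDr in quad.
have s2 : 0 < t ^+ 2 by rewrite exprn_gt0.
have s4 : 0 <= cabs c1 ^+ 2 * t ^+ 2 + cabs c2 ^+ 2 * t ^+ 4.
  by rewrite addr_ge0 // mulr_ge0 // exprn_ge0 ?cabs_ge0 // ltW.
have key : 2 * K * eta < eps.
  rewrite /eta mulrA ltr_pdivrMr; last by rewrite mulr_gt0 // ltr_wpDl.
  by nra.
have {}key : 2 * K * eta * t ^+ 2 < eps * t ^+ 2 by rewrite ltr_pM2r.
lra.
Qed.

(** A maximum of the perturbed function lies on the circle, or at a zero of F; the
    perturbation is then sent to 0. *)
Lemma max_modulus0 F a r M : 0 < r -> 0 <= M ->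
  (forall y, cdisc a r y -> ccont F y) ->
  (forall y, cabs (zeta (y - a)) < r -> cder2 F y \/ F y = 0) ->
  (forall y, cabs (zeta (y - a)) = r -> cabs (F y) <= M) ->
  forall y, cdisc a r y -> cabs (F y) <= M.
Proof.
move=> r0 M0 cF dF bF y ydisc.
rewrite -(@ler_pXn2r _ 2) ?nnegrE ?cabs_ge0 //.
apply/ler_addgt0Pl => e e0.
pose eps := e / r ^+ 2.
have eps0 : 0 < eps by rewrite divr_gt0 // exprn_gt0.
have epsr : eps * r ^+ 2 = e by rewrite /eps mulfVK // gt_eqF // exprn_gt0.
pose psi y := cabs (F y) ^+ 2 + eps * cabs (zeta (y - a)) ^+ 2.
have [||c] := @compact_EVT_max _ _ psi (cdisc a r) _ (@compact_cdisc a r (ltW r0)).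
- by exists y.
- apply: continuous_in_subspaceT => z; rewrite inE => zd.
  apply: cvgD.
    rewrite (_ : (fun y => cabs (F y) ^+ 2) = (fun y => cabs (F y) * cabs (F y))).
      by apply: cvgM; apply: ccont_cabs; apply: cF.
    by apply/funext => u; rewrite expr2.
  by apply: cvgM; [exact: cvg_cst|exact: continuous_sqr_zeta].
rewrite inE => cd cmax.
have psic : cabs (F y) ^+ 2 <= psi c.
  apply: le_trans (cmax y _); last by rewrite inE.
  by rewrite /psi lerDl mulr_ge0 ?(ltW eps0) // exprn_ge0 // cabs_ge0.
apply: (le_trans psic).
have cq : eps * cabs (zeta (c - a)) ^+ 2 <= e.
  by rewrite -epsr ler_wpM2l ?(ltW eps0) // ler_pXn2r ?nnegrE ?cabs_ge0 // ltW.
rewrite /psi addrC; apply: lerD => //.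
have : cabs (zeta (c - a)) <= r by exact: cd.
rewrite le_eqVlt => /orP[/eqP cr|cr].
  by rewrite ler_pXn2r ?nnegrE ?cabs_ge0 //; exact: bF.
have [dc|->] := dF c cr; last by rewrite cabs0 expr0n /= exprn_ge0.
exfalso; pose d := (r - cabs (zeta (c - a))) / 2.
have d0 : 0 < d by rewrite divr_gt0 // subr_gt0.
apply: (@not_local_max F c a eps d dc eps0 d0) => h hd.
apply: (cmax (c + h)); rewrite inE /cdisc /= addrAC zetaD.
apply: (le_trans (ler_cabsD _ _)); have := zeta_le_norm h.
by rewrite /d in hd; lra.
Qed.

(** Finitely many points where F is only continuous are allowed. Multiplying F^n by
    the polynomial that vanishes at these points gives a bound with a constant whose
    n-th root tends to 1. *)
Lemma max_modulus F a r M (E : seq (R * R)) : 0 < r -> 0 <= M ->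
  (forall y, cdisc a r y -> ccont F y) ->
  (forall y, cabs (zeta (y - a)) < r -> y \notin E -> cder2 F y) ->
  (forall y, cabs (zeta (y - a)) = r -> cabs (F y) <= M) ->
  forall y, cdisc a r y -> cabs (F y) <= M.
Proof.
move=> r0 M0 cF dF bF.
(* The factor W vanishes on E, where F need not be differentiable. *)
pose W y := \prod_(e <- E) (zeta y - zeta e).
have W2 y : cder2 W y.
  apply: cder2_prod => e; apply: cder2D; [exact: cder2_zeta|exact: cder2_cst].
pose L := \prod_(e <- E) (r + cabs (zeta (a - e))).
have L0 : 0 <= L by apply: prodr_ge0 => e _; rewrite addr_ge0 ?(ltW r0) // cabs_ge0.
have WL y : cabs (zeta (y - a)) <= r -> cabs (W y) <= L.
  move=> yr; rewrite /W /L.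
  elim: E {dF W W2 L L0} => [|e E IH]; first by rewrite !big_nil cabs1.
  rewrite !big_cons cabsM; apply: ler_pM; rewrite ?cabs_ge0 //.
  rewrite -zetaB (_ : y - e = (y - a) + (a - e)); last by rewrite addrA subrK.
  by rewrite zetaD; apply: (le_trans (ler_cabsD _ _)); rewrite lerD2r.
have powK n y : cdisc a r y -> cabs (F y) ^+ n * cabs (W y) <= M ^+ n * L.
  move=> yd; rewrite -cabsX -cabsM.
  have cX z m : ccont F z -> ccont (fun y => F y ^+ m) z.
    move=> cz; elim: m => [|m IH].
      by apply: cder2_ccont; exact: cder2_cst.
    rewrite (_ : (fun y => _) = (fun y => F y * F y ^+ m)); first exact: ccontM.
    by apply/funext => u; rewrite exprS.
  apply: (@max_modulus0 (fun y => F y ^+ n * W y) a r) => //.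
  - by rewrite mulr_ge0 // exprn_ge0.
  - by move=> z zd; apply: ccontM; [apply/cX/cF|apply/cder2_ccont/W2].
  - move=> z zr; have [zE|zE] := boolP (z \in E); last first.
      by left; apply: cder2M => //; apply: cder2X; exact: dF.
    right; rewrite /W (_ : \prod_(e <- E) (zeta z - zeta e) = 0) ?mulr0 //.
    apply/eqP; rewrite prodf_seq_eq0; apply/hasP; exists z => //=.
    by rewrite subrr.
  move=> z zr; rewrite cabsM cabsX; apply: ler_pM; rewrite ?exprn_ge0 ?cabs_ge0 //.
    by rewrite lerXn2r ?nnegrE ?cabs_ge0 //; exact: bF.
  by apply: WL; rewrite zr.
have good y : cdisc a r y -> y \notin E -> cabs (F y) <= M.
  move=> yd yE; rewrite leNgt; apply/negP => MF.
  have W0 : 0 < cabs (W y).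
    rewrite cabs_gt0 /W prodf_seq_neq0; apply/allP => e eE /=.
    by rewrite zeta_neq; apply: contra yE => /eqP ->.
  have F0 : 0 < cabs (F y) by exact: le_lt_trans MF.
  have [M00|Mn0] := eqVneq M 0.
    have := powK 1%N y yd; rewrite M00 !expr1 mul0r leNgt => /negP; apply.
    by rewrite mulr_gt0.
  have Mp : 0 < M by rewrite lt_neqAle eq_sym Mn0.
  have [|n Hn] := @expr_unbounded _ (cabs (F y) / M) (L / cabs (W y)).
    by rewrite ltr_pdivlMr // mul1r.
  have := powK n y yd; rewrite leNgt => /negP; apply.
  move: Hn; rewrite ltr_pdivrMr // expr_div_n mulrAC ltr_pdivlMr ?exprn_gt0 //.
  by rewrite mulrC.
move=> y yd; have [yr|yr] := eqVneq (cabs (zeta (y - a))) r; first exact: bF.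
have {}yr : cabs (zeta (y - a)) < r by rewrite lt_neqAle yr.
apply/ler_addgt0Pl => e e0; have [d d0 Hd] := cF y yd _ e0.
pose m := Num.min d ((r - cabs (zeta (y - a))) / 2).
have m0 : 0 < m by rewrite lt_min d0 divr_gt0 // subr_gt0.
have [s /andP[s0 sm] sE] : exists2 s : R, 0 < s < m & y + (s, 0) \notin E.
  elim: E {dF W W2 L L0 WL powK good} => [|b E [s /andP[s0 sm] sE]].
    by exists (m / 2) => //; rewrite divr_gt0 //=; lra.
  have [j Hj] : exists j : nat, forall k : nat, (j <= k)%N -> y + (s / k.+1%:R, 0) \notin b :: E.
    have inj (k l : nat) : s / k.+1%:R = s / l.+1%:R -> k = l.
      move=> /(mulfI (lt0r_neq0 s0)) /invr_inj /eqP; rewrite eqr_nat => /eqP [] //.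
    elim: (b :: E) => [|c l [j Hj]]; first by exists 0%N.
    have [[k Hk]|nk] := pselect (exists k : nat, y + (s / k.+1%:R, 0) = c).
      exists (maxn j k.+1) => i; rewrite geq_max => /andP[ji ki].
      rewrite inE negb_or Hj // andbT -Hk; apply/negP => /eqP /addrI [] /inj E'.
      by move: ki; rewrite E' ltnn.
    exists j => i ji; rewrite inE negb_or Hj // andbT; apply/negP => /eqP E'.
    by apply: nk; exists i.
  exists (s / j.+1%:R); last exact: Hj.
  rewrite divr_gt0 //= (le_lt_trans _ sm) // ler_pdivrMr // ler_peMr ?(ltW s0) //.
  by rewrite ler1n.
have nh : `|(s, 0) : R * R| = s.
  by rewrite norm_pairE /= normr0 gtr0_norm //; apply/max_idPl/ltW.
move: sm; rewrite lt_min => /andP[sd sr].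
have := Hd (s, 0); rewrite nh => /(_ sd) close.
have : cabs (F (y + (s, 0))) <= M.
  apply: good => //; rewrite /cdisc /= addrAC zetaD.
  apply: (le_trans (ler_cabsD _ _)); rewrite (_ : cabs (zeta (s, 0)) = s); last first.
    by rewrite cabsE /= expr0n addr0 sqrtr_sqr gtr0_norm.
  by lra.
have := ler_cabsB (F (y + (s, 0))) (F (y + (s, 0)) - F y); rewrite opprB addrC subrK.
by move=> H1 H2; lra.
Qed.

End MaximumPrinciple.

(** * Divided differences *)

Section DividedDifference.
Context {R : realType}.
Local Notation C := R[i].
Implicit Types (F G : R * R -> C) (x y h a b : R * R).

Lemma real_cauchy_limit (g : R -> R) :
  (forall e, 0 < e -> exists2 d, 0 < d &
     forall s t, 0 < s < d -> 0 < t < d -> `|g s - g t| <= e) ->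
  exists c, forall e, 0 < e -> exists2 d, 0 < d & forall t, 0 < t < d -> `|g t - c| <= e.
Proof.
move=> H.
pose u : R^o^nat := fun n => g (n.+1%:R^-1).
have small (d : R) : 0 < d -> exists N0 : nat, forall n, (N0 <= n)%N -> 0 < (n.+1%:R^-1 : R) < d.
  move=> d0; exists (Num.bound d^-1) => n Nn; rewrite invr_gt0 ltr0n /=.
  rewrite invf_plt ?posrE ?ltr0n //.
  apply: (@lt_le_trans _ _ (Num.bound d^-1)%:R).
    by apply: archi_boundP; rewrite invr_ge0 ltW.
  by rewrite ler_nat leqW.
have cu : cvg (u @ \oo).
  apply: cauchy_cvg; apply: cauchy_exP => e e0.
  have e2 : 0 < e / 2 by rewrite divr_gt0.
  have [d d0 Hd] := H _ e2; have [N0 HN] := small d d0.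
  exists (u N0); exists N0 => // n /= Nn; rewrite /ball /=.
  apply: le_lt_trans (Hd _ _ (HN _ (leqnn _)) (HN _ Nn)) _; lra.
exists (lim (u @ \oo)) => e e0.
have e2 : 0 < e / 2 by rewrite divr_gt0.
have [d d0 Hd] := H _ e2; exists d => // t td.
have [N0 HN] := small d d0.
have /cvgrPdist_lt /(_ _ e2) [N1 _ HN1] := cu.
pose n := maxn N0 N1.
have h1 : `|lim (u @ \oo) - u n| < e / 2 by apply: HN1; rewrite /= leq_maxr.
have h2 := Hd _ _ td (HN n (leq_maxl _ _)).
rewrite -[g t](subrK (u n)) -addrA [e]splitr; apply: (le_trans (ler_normD _ _)).
by apply: lerD => //; rewrite distrC ltW.
Qed.

Lemma cauchy_limit (D : R * R -> C) a :
  (forall e, 0 < e -> exists2 d, 0 < d &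
     forall h k, 0 < `|h| < d -> 0 < `|k| < d -> cabs (D (a + h) - D (a + k)) <= e) ->
  exists c, forall e, 0 < e -> exists2 d, 0 < d &
     forall h, 0 < `|h| < d -> cabs (D (a + h) - c) <= e.
Proof.
move=> H.
have nt (s : R) : 0 < s -> `|(s, 0) : R * R| = s.
  by move=> s0; rewrite norm_pairE /= normr0 gtr0_norm //; apply/max_idPl/ltW.
have [|c1 H1] := @real_cauchy_limit (fun t => complex.Re (D (a + (t, 0)))).
  move=> e e0; have [d d0 Hd] := H e e0; exists d => // s t sd td.
  rewrite -ReN -ReD; apply: (le_trans (le_Re_cabs _)); apply: Hd; rewrite nt //.
  - by case/andP: sd.
  - by case/andP: td.
have [|c2 H2] := @real_cauchy_limit (fun t => complex.Im (D (a + (t, 0)))).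
  move=> e e0; have [d d0 Hd] := H e e0; exists d => // s t sd td.
  rewrite -ImN -ImD; apply: (le_trans (le_Im_cabs _)); apply: Hd; rewrite nt //.
  - by case/andP: sd.
  - by case/andP: td.
exists (c1 +i* c2) => e e0.
have e3 : 0 < e / 3 by rewrite divr_gt0.
have [d1 d10 Hd1] := H1 _ e3; have [d2 d20 Hd2] := H2 _ e3.
have [d d0 Hd] := H _ e3; exists d => // h hd.
pose t := Num.min d (Num.min d1 d2) / 2.
have m0 : 0 < Num.min d (Num.min d1 d2) by rewrite !lt_min d0 d10.
have t0 : 0 < t by rewrite divr_gt0.
have /andP[td /andP[t1 t2]] : [&& t < d, t < d1 & t < d2].
  by rewrite -!lt_min /t; lra.
rewrite -[D (a + h)](subrK (D (a + (t, 0)))) -addrA.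
apply: (le_trans (ler_cabsD _ _)).
have := Hd h (t, 0) hd; rewrite nt // t0 td => /(_ isT) k1.
have := cabs_le (D (a + (t, 0)) - (c1 +i* c2)); rewrite !ReImE /= => k2.
have := Hd1 t; rewrite t0 t1 => /(_ isT) k3.
have := Hd2 t; rewrite t0 t2 => /(_ isT) k4.
lra.
Qed.

Definition quot F b (c : C) y : C :=
  if y == b then c else (F y - F b) * (zeta y - zeta b)^-1.

Lemma quotE F b c y : F y = F b + (zeta y - zeta b) * quot F b c y.
Proof.
rewrite /quot; case: eqVneq => [->|yb]; first by rewrite subrr mul0r addr0.
by rewrite mulrC mulfVK ?zeta_neq // addrC subrK.
Qed.

Lemma quot_near F b c y : y != b ->
  {near y, (fun z => (F z - F b) * (zeta z - zeta b)^-1) =1 quot F b c}.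
Proof.
move=> yb; suff : {near y, forall z, z != b}.
  by apply: filterS => z; rewrite /quot => /negbTE ->.
apply/nbhs_normP; exists `|y - b|; first by rewrite /= normr_gt0 subr_eq0.
by move=> z /=; apply: contraTneq => ->; rewrite ltxx.
Qed.

Lemma ccont_near F G x : {near x, F =1 G} -> ccont F x -> ccont G x.
Proof.
move=> FG H e e0; have [d d0 Hd] := H _ e0.
have /nbhs_normP [r /= r0 Hr] := FG.
exists (Num.min d r); first by rewrite lt_min d0.
move=> h; rewrite lt_min => /andP[hd hr].
rewrite -Hr /=; last by rewrite opprD addNKr normrN.
by rewrite -(Hr x) ?Hd //= subrr normr0.
Qed.

Lemma quot_cder2 F b c y : y != b -> cder2 F y -> cder2 (quot F b c) y.
Proof.
move=> yb dF; apply: cder2_near (quot_near _ _ yb) _.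
apply: cder2M; last exact: cder2V_zeta.
by apply: cder2D => //; exact: cder2_cst.
Qed.

Lemma quot_ccont F b c y : y != b -> ccont F y -> ccont (quot F b c) y.
Proof.
move=> yb cF; apply: ccont_near (quot_near _ _ yb) _.
apply: ccontM; last by apply: cder2_ccont; exact: cder2V_zeta.
by apply: ccontD => //; apply: cder2_ccont; exact: cder2_cst.
Qed.

Lemma quot_ccont_at F b c :
  (forall e, 0 < e -> exists2 d, 0 < d & forall h, 0 < `|h| < d ->
     cabs ((F (b + h) - F b) * (zeta h)^-1 - c) <= e) ->
  ccont (quot F b c) b.
Proof.
move=> H e e0; have e2 : 0 < e / 2 by rewrite divr_gt0.
have [d d0 Hd] := H _ e2; exists d => // h hd.
rewrite /quot eqxx; case: eqVneq => [_|hn]; first by rewrite subrr cabs0.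
rewrite zetaD [zeta b + _ - _]addrAC subrr add0r.
apply: (@le_lt_trans _ _ (e / 2)); last by lra.
apply: Hd; rewrite hd normr_gt0 andbT; apply: contraNneq hn => ->.
by rewrite addr0.
Qed.

Lemma cder_quot_limit F b c : cder F b c ->
  forall e, 0 < e -> exists2 d, 0 < d & forall h, 0 < `|h| < d ->
     cabs ((F (b + h) - F b) * (zeta h)^-1 - c) <= e.
Proof.
move=> H e e0; have [d d0 Hd] := H e e0; exists d => // h /andP[h0 hd].
have z0 : zeta h != 0 by rewrite zeta_eq0 -normr_gt0.
have -> : (F (b + h) - F b) * (zeta h)^-1 - c = (F (b + h) - F b - c * zeta h) * (zeta h)^-1.
  by rewrite [RHS]mulrBl mulfK.
by rewrite cabsM cabsV ler_pdivrMr ?cabs_gt0 //; exact: Hd.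
Qed.

(** Regularity on a closed disc with a possible exception at the centre; this is the
    class that is stable under forming divided differences at the centre. *)
Definition hreg F a r := [/\ 0 < r, forall y, cdisc a r y -> ccont F y &
  forall y, cdisc a r y -> y != a -> cder2 F y].

Lemma cdisc_ccont_bounded F a r : 0 < r -> (forall y, cdisc a r y -> ccont F y) ->
  exists2 M, 0 <= M & forall y, cdisc a r y -> cabs (F y) <= M.
Proof.
move=> r0 cF.
have [||c] := @compact_EVT_max _ _ (fun y => cabs (F y)) (cdisc a r) _ (@compact_cdisc _ a r (ltW r0)).
- by exists a; rewrite /cdisc /= subrr zeta0 cabs0 ltW.
- by apply: continuous_in_subspaceT => z; rewrite inE => zd; apply/ccont_cabs/cF.
rewrite inE => cd cm; exists (cabs (F c)); first exact: cabs_ge0.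
by move=> y yd; apply: cm; rewrite inE.
Qed.

(** The difference of two divided differences is, on the circle, a fraction whose
    numerator is small when b and b' are close; the maximum principle carries the
    bound to the centre. *)
Lemma quot_diff_bound F a r b b' c c' (M : R) : hreg F a r ->
  (forall y, cdisc a r y -> cabs (F y) <= M) ->
  cabs (zeta (b - a)) <= r / 2 -> cabs (zeta (b' - a)) <= r / 2 -> b != a -> b' != a ->
  cder F b c -> cder F b' c' ->
  cabs (quot F b c a - quot F b' c' a) <=
   (2 * M * cabs (zeta b - zeta b') + 2 * r * cabs (F b - F b')) * (4 / r ^+ 2).
Proof.
move=> [r0 cF dF] bM br br' ba ba' dc dc'.
have M0 : 0 <= M.
  apply: le_trans (cabs_ge0 (F a)) (bM a _).
  by rewrite /cdisc /= subrr zeta0 cabs0 ltW.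
have r2 : r / 2 <= r by lra.
have bd : cdisc a r b by exact: le_trans br r2.
have bd' : cdisc a r b' by exact: le_trans br' r2.
have qc b0 c0 y : cder F b0 c0 -> cdisc a r y -> ccont (quot F b0 c0) y.
  move=> d0 yd; have [->|yb] := eqVneq y b0.
    by apply: quot_ccont_at; exact: cder_quot_limit.
  by apply: quot_ccont => //; exact: cF.
pose G y := quot F b c y + (-1) * quot F b' c' y.
have GE y : quot F b c y - quot F b' c' y = G y by rewrite /G mulN1r.
rewrite GE.
have B0 : 0 <= (2 * M * cabs (zeta b - zeta b') + 2 * r * cabs (F b - F b')) * (4 / r ^+ 2).
  rewrite mulr_ge0 // ?divr_ge0 ?exprn_ge0 ?(ltW r0) //.
  by rewrite addr_ge0 ?mulr_ge0 ?cabs_ge0 ?(ltW r0).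
apply: (@max_modulus _ G a r _ [:: a; b; b'] r0 B0) => [y yd|y yr|y yr|].
- apply: ccontD; first exact: qc.
  by apply: ccontM; [apply: cder2_ccont; exact: cder2_cst|exact: qc].
- rewrite !inE !negb_or => /and3P[ya yb yb'].
  have dFy := dF y (ltW yr) ya.
  apply: cder2D; first exact: quot_cder2.
  by apply: cder2M; [exact: cder2_cst|exact: quot_cder2].
- have yd : cdisc a r y by rewrite /cdisc /= yr.
  have low b0 : cabs (zeta (b0 - a)) <= r / 2 -> r / 2 <= cabs (zeta y - zeta b0).
    move=> b0r; have : cabs (zeta (y - a)) <= cabs (zeta y - zeta b0) + cabs (zeta (b0 - a)).
      by rewrite -zetaB (_ : y - a = (y - b0) + (b0 - a)) ?zetaD ?ler_cabsD // addrA subrK.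
    by rewrite yr => H; lra.
  have l1 := low b br; have l2 := low b' br'.
  have r20 : 0 < r / 2 by lra.
  have y1 : zeta y - zeta b != 0 by rewrite -cabs_gt0; lra.
  have y2 : zeta y - zeta b' != 0 by rewrite -cabs_gt0; lra.
  have yb : y != b by rewrite -zeta_neq.
  have yb' : y != b' by rewrite -zeta_neq.
  rewrite /G /quot (negbTE yb) (negbTE yb').
  have -> : (F y - F b) * (zeta y - zeta b)^-1 + -1 * ((F y - F b') * (zeta y - zeta b')^-1) =
    ((F y - F b) * (zeta b - zeta b') + (F b' - F b) * (zeta y - zeta b)) *
     ((zeta y - zeta b) * (zeta y - zeta b'))^-1 by field; rewrite y1 y2.
  rewrite cabsM cabsV; apply: ler_pM; rewrite ?invr_ge0 ?cabs_ge0 //.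
    apply: (le_trans (ler_cabsD _ _)); rewrite !cabsM; apply: lerD.
      rewrite ler_wpM2r ?cabs_ge0 //; apply: (le_trans (ler_cabsB _ _)).
      by have := bM y yd; have := bM b bd; lra.
    rewrite [cabs (F b' - F b)]cabsB_sym [leLHS]mulrC ler_wpM2r ?cabs_ge0 // -zetaB.
    rewrite (_ : y - b = (y - a) - (b - a)); last by rewrite opprB addrA subrK.
    by rewrite zetaB; apply: (le_trans (ler_cabsB _ _)); rewrite yr; move: bd; rewrite /cdisc /=; lra.
  rewrite (_ : 4 / r ^+ 2 = (r / 2 * (r / 2))^-1); last by field; rewrite gt_eqF.
  rewrite lef_pV2 ?posrE ?mulr_gt0 ?cabs_gt0 ?mulf_neq0 //.
  by rewrite cabsM; apply: ler_pM; rewrite ?(ltW r20).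
by rewrite /cdisc /= subrr zeta0 cabs0 ltW.
Qed.

(** The quotients at points near the centre satisfy a Cauchy condition by the previous
    estimate, so that the derivative at the centre exists; the bound on G is the
    maximum principle on the circle. *)
Lemma divided_difference F a r : hreg F a r ->
  exists G, [/\ hreg G a r, forall y, F y = F a + (zeta y - zeta a) * G y &
    forall M, (forall y, cdisc a r y -> cabs (F y) <= M) ->
      forall y, cdisc a r y -> cabs (G y) <= 2 * M / r].
Proof.
move=> hF; have [r0 cF dF] := hF.
have ad : cdisc a r a by rewrite /cdisc /= subrr zeta0 cabs0 ltW.
have [M M0 bM] := cdisc_ccont_bounded r0 cF.
pose D y := (F y - F a) * (zeta y - zeta a)^-1.
have D_quot b c : b != a -> D b = quot F b c a.
  move=> ba; rewrite /D /quot eq_sym (negbTE ba).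
  by rewrite -[F a - F b]opprB -[zeta a - _]opprB invrN mulrNN.
have [c Hc] : exists c, forall e, 0 < e -> exists2 d, 0 < d &
     forall h, 0 < `|h| < d -> cabs (D (a + h) - c) <= e.
  apply: cauchy_limit => e e0.
  pose k := e * (r ^+ 2 / 4).
  have k0 : 0 < k by rewrite mulr_gt0 // divr_gt0 // exprn_gt0.
  have [|d1 d10 Hd1] := cF a ad (k / 2 / (2 * r) / 2).
    by rewrite !divr_gt0 // mulr_gt0.
  pose d := Num.min d1 (Num.min (r / 2 / 2) (k / 2 / (2 * (M + 1)) / 4)).
  have M1 : 0 < 2 * (M + 1) by lra.
  exists d; first by rewrite !lt_min d10 !divr_gt0.
  move=> h h'; rewrite !lt_min => /andP[h0 /and3P[h1 h2 h3]] /andP[h0' /and3P[h1' h2' h3']].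
  have ne l : 0 < `|l| -> a + l != a.
    by rewrite normr_gt0; apply: contraNneq => /(congr1 (fun z => z - a)); rewrite subrr addrAC subrr add0r => ->.
  have sm l : `|l| < r / 2 / 2 -> cabs (zeta (a + l - a)) <= r / 2.
    move=> lr; rewrite addrAC subrr add0r; have := zeta_le_norm l; lra.
  have dsc l : `|l| < r / 2 / 2 -> cdisc a r (a + l).
    by move=> /sm H; apply: (le_trans H); lra.
  have [c1 Hc1] := cder2_cder (dF _ (dsc _ h2) (ne _ h0)).
  have [c2 Hc2] := cder2_cder (dF _ (dsc _ h2') (ne _ h0')).
  rewrite (D_quot _ c1 (ne _ h0)) (D_quot _ c2 (ne _ h0')).
  apply: (le_trans (quot_diff_bound hF bM (sm _ h2) (sm _ h2') (ne _ h0) (ne _ h0') Hc1 Hc2)).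
  have -> : e = k * (4 / r ^+ 2) by rewrite /k; field; rewrite gt_eqF.
  rewrite ler_wpM2r ?divr_ge0 ?exprn_ge0 ?(ltW r0) //.
  have e1 : 2 * r * cabs (F (a + h) - F (a + h')) <= k / 2.
    have E1 : cabs (F (a + h) - F (a + h')) <= k / 2 / (2 * r).
      have -> : F (a + h) - F (a + h') = (F (a + h) - F a) - (F (a + h') - F a) by ring.
      apply: (le_trans (ler_cabsB _ _)); have := Hd1 _ h1; have := Hd1 _ h1'; lra.
    move: E1; rewrite ler_pdivlMr ?mulr_gt0 // mulrC //.
  have e2 : 2 * M * cabs (zeta (a + h) - zeta (a + h')) <= k / 2.
    have E2 : cabs (zeta (a + h) - zeta (a + h')) <= k / 2 / (2 * (M + 1)).
      have -> : zeta (a + h) - zeta (a + h') = zeta h - zeta h' by rewrite !zetaD; ring.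
      apply: (le_trans (ler_cabsB _ _)); have := zeta_le_norm h; have := zeta_le_norm h'; lra.
    move: E2; rewrite ler_pdivlMr // => E2; apply: le_trans E2.
    by rewrite mulrC ler_wpM2l ?cabs_ge0 //; lra.
  by lra.
exists (quot F a c).
have cont_a : ccont (quot F a c) a.
  apply: quot_ccont_at => e /Hc [d d0 Hd]; exists d => // h /Hd.
  by rewrite /D zetaD [zeta a + _ - _]addrAC subrr add0r.
have hG : hreg (quot F a c) a r.
  split=> // y yd; first by have [->|ya] := eqVneq y a; [|apply: quot_ccont => //; exact: cF].
  by move=> ya; apply: quot_cder2 => //; exact: dF.
split=> //; first by move=> y; exact: quotE.
move=> M' bM'; have M'0 : 0 <= M' by apply: le_trans (cabs_ge0 (F a)) (bM' a _).
have [_ cG dG] := hG.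
apply: (@max_modulus _ _ _ _ _ [:: a]) => //.
- by rewrite divr_ge0 ?mulr_ge0 ?(ltW r0).
- by move=> y yr; rewrite inE => ya; apply: dG => //; exact: ltW.
move=> y yr; have yd : cdisc a r y by rewrite /cdisc /= yr.
have ya : y != a by apply: contra_eq_neq yr => ->; rewrite subrr zeta0 cabs0 lt_eqF.
rewrite /quot (negbTE ya) cabsM cabsV -zetaB yr ler_wpM2r ?invr_ge0 ?(ltW r0) //.
by apply: (le_trans (ler_cabsB _ _)); have := bM' y yd; have := bM' a ad; lra.
Qed.

End DividedDifference.

(** * Power series and division by the zeros of a holomorphic function *)

Section PowerSeries.
Context {R : realType}.
Local Notation C := R[i].
Implicit Types (F G : R * R -> C) (x y h a b : R * R) (D : set (R * R)).

Lemma cder_frechet F x (c : C) : cder F x c <->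
  frechet (fun y => complex.Re (F y)) x (complex.Re c) (- complex.Im c) /\
  frechet (fun y => complex.Im (F y)) x (complex.Im c) (complex.Re c).
Proof.
have reE h : complex.Re (F (x + h) - F x - c * zeta h) =
    complex.Re (F (x + h)) - complex.Re (F x) -
      (complex.Re c * h.1 + - complex.Im c * h.2).
  by rewrite !ReImE /zeta /= mulNr.
have imE h : complex.Im (F (x + h) - F x - c * zeta h) =
    complex.Im (F (x + h)) - complex.Im (F x) -
      (complex.Im c * h.1 + complex.Re c * h.2).
  by rewrite !ReImE /zeta /= [X in _ - X]addrC.
split=> [H|[H1 H2] e e0].
  split=> e e0.
    have [|d d0 Hd] := H (e / 2); first by rewrite divr_gt0.
    exists d => // h hd; rewrite -reE; apply: (le_trans (le_Re_cabs _)).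
    apply: (le_trans (Hd h hd)); have := zeta_le_norm h; have := ltW e0; nra.
  have [|d d0 Hd] := H (e / 2); first by rewrite divr_gt0.
  exists d => // h hd; rewrite -imE; apply: (le_trans (le_Im_cabs _)).
  apply: (le_trans (Hd h hd)); have := zeta_le_norm h; have := ltW e0; nra.
have [|d d0 Hd] := H1 (e / 2); first by rewrite divr_gt0.
have [|d' d0' Hd'] := H2 (e / 2); first by rewrite divr_gt0.
exists (Num.min d d'); first by rewrite lt_min d0.
move=> h; rewrite lt_min => /andP[hd hd'].
apply: (le_trans (cabs_le _)); rewrite reE imE.
have := Hd h hd; have := Hd' h hd'; have := norm_le_zeta h; have := ltW e0; nra.
Qed.

(** Complex differentiability is real differentiability together with the
    Cauchy-Riemann equation. *)
Lemma cderP F x (c : C) : cder F x c <->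
  [/\ cdiff F x, wirtinger true F x = c & wirtinger false F x = 0].
Proof.
have i2 := @sqr_i R; rewrite expr2 in i2.
split.
  move=> /cder_frechet [/frechetP[d1 a1 b1] /frechetP[d2 a2 b2]].
  have e1 : cderive (1, 0) F x = c.
    by rewrite cderiveE a1 a2; case: (c).
  have e2 : cderive (0, 1) F x = 'i * c.
    by rewrite cderiveE b1 b2; apply: complexP; rewrite !ReImE /=; ring.
  split=> //; rewrite wirtingerE e1 e2 mulrA /wsign ?mulNr i2.
    by rewrite mulN1r opprK; field.
  by rewrite mulN1r subrr mulr0.
move=> [[d1 d2] wt wf]; apply/cder_frechet.
have e1 := wirtinger_ex F x; have e2 := wirtinger_ey F x.
rewrite wt wf addr0 cderiveE in e1; rewrite wt wf subr0 cderiveE in e2.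
split; apply/frechetP; split=> //.
- by have := congr1 (@complex.Re _) e1.
- by have := congr1 (@complex.Re _) e2; rewrite /= ReImE /= => ->; ring.
- by have := congr1 (@complex.Im _) e1.
- by have := congr1 (@complex.Im _) e2; rewrite /= ReImE /= => ->; ring.
Qed.

Lemma cder_ex F x (c : C) : cder F x c ->
  cderive (1, 0) F x = c /\ cderive (0, 1) F x = 'i * c.
Proof.
move=> /cderP [_ wt wf].
by rewrite wirtinger_ex wirtinger_ey wt wf addr0 subr0.
Qed.

Lemma cderM F G x (a b : C) : cder F x a -> cder G x b ->
  cder (fun y => F y * G y) x (a * G x + F x * b).
Proof.
move=> /cderP [dF <- F0] /cderP [dG <- G0]; apply/cderP; split.
- exact: cdiffM.
- by rewrite wirtingerM.
- by rewrite wirtingerM // F0 G0 mul0r mulr0 addr0.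
Qed.

Lemma cder_zeta_sub a x : cder (fun y => zeta (y - a)) x 1.
Proof.
move=> e e0; exists 1 => // h _.
rewrite mul1r !zetaB zetaD.
have -> : zeta x + zeta h - zeta a - (zeta x - zeta a) - zeta h = 0 by ring.
by rewrite cabs0 mulr_ge0 ?(ltW e0) // cabs_ge0.
Qed.

Lemma cder_zetaX a x n :
  cder (fun y => zeta (y - a) ^+ n.+1) x (n.+1%:R * zeta (x - a) ^+ n).
Proof.
elim: n => [|n IH]; first by rewrite expr0 mulr1; exact: cder_zeta_sub.
have := cderM (cder_zeta_sub a x) IH.
rewrite (_ : 1 * _ + _ = n.+2%:R * zeta (x - a) ^+ n.+1); last first.
  by rewrite mul1r mulrCA -exprS -natr1; ring.
by congr cder.
Qed.

(** Convergence is expressed by a geometric bound for all remainders at once, which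
    avoids infinite sums. *)
Definition power_series F a (c : nat -> C) (M rho : R) : Prop :=
  [/\ 0 <= M, 0 < rho & forall n h, cabs (zeta h) < rho ->
    cabs (F (a + h) - \sum_(k < n) c k * zeta h ^+ k) <= M * (cabs (zeta h) / rho) ^+ n].

Definition analytic_at F a : Prop := exists c M rho, power_series F a c M rho.

Lemma power_series0 F a c M rho : power_series F a c M rho -> F a = c 0%N.
Proof.
move=> [_ r0 H]; have := H 1%N 0; rewrite cabs0 => /(_ r0).
rewrite mul0r expr1 mulr0 addr0 big_ord_recl big_ord0 expr0 mulr1 addr0 => H0.
by apply/eqP; rewrite -subr_eq0 -cabs_eq0 eq_le H0 cabs_ge0.
Qed.

Lemma power_series_coef F a c M rho n : power_series F a c M rho ->
  cabs (c n) <= 2 * M / rho ^+ n.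
Proof.
move=> [M0 r0 H]; rewrite ler_pdivlMr ?exprn_gt0 //.
apply/ler_addgt0Pl => e e0.
have {H} key (t : R) : 0 < t < 1 -> cabs (c n) * rho ^+ n <= 2 * M.
  move=> /andP[t0 t1]; pose h : R * R := (t * rho, 0).
  have tr0 : 0 < t * rho by rewrite mulr_gt0.
  have zh : cabs (zeta h) = t * rho.
    by rewrite cabsE /= expr0n addr0 sqrtr_sqr gtr0_norm.
  have hr : cabs (zeta h) < rho by rewrite zh -[ltRHS]mul1r ltr_pM2r.
  have H1 := H n h hr; have H2 := H n.+1 h hr.
  have tq : cabs (zeta h) / rho = t by rewrite zh mulfK // gt_eqF.
  rewrite !tq in H1 H2.
  have tn : 0 < t ^+ n by rewrite exprn_gt0.
  rewrite -(ler_pM2r tn) -mulrA -exprMn [rho * t]mulrC -zh -cabsX -cabsM.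
  set S := \sum_(k < n) _ in H1.
  have -> : c n * zeta h ^+ n = (F (a + h) - S) - (F (a + h) - \sum_(k < n.+1) c k * zeta h ^+ k).
    by rewrite big_ord_recr /= -/S; ring.
  apply: (le_trans (ler_cabsB _ _)).
  have : M * t ^+ n.+1 <= M * t ^+ n.
    by rewrite ler_wpM2l // exprS ler_piMl ?(ltW tn) // ltW.
  lra.
have := key (1 / 2); rewrite divr_gt0 // => H2.
by apply: (le_trans (H2 _)); [lra|lra].
Qed.

Lemma analytic_cder2 F a : analytic_at F a -> cder2 F a.
Proof.
move=> [c [M [rho ps]]]; have F0 := power_series0 ps; have [M0 r0 H] := ps.
exists (c 1%N), (c 2%N) => e e0.
pose k := (M + 1) / rho ^+ 3.
have k0 : 0 < k by rewrite divr_gt0 ?exprn_gt0 //; lra.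
exists (Num.min (rho / 2) (e / k / 2)); first by rewrite lt_min; apply/andP; split; rewrite divr_gt0 // divr_gt0.
move=> h; rewrite lt_min => /andP[h1 h2].
have zn := zeta_le_norm h.
have zr : cabs (zeta h) < rho by lra.
have ze : cabs (zeta h) <= e / k by lra.
have := H 3%N h zr; rewrite !big_ord_recr big_ord0 /= add0r expr0 mulr1 expr1 -F0.
move=> /le_trans; apply.
rewrite expr_div_n; apply: (@le_trans _ _ (k * cabs (zeta h) ^+ 3)).
  rewrite (_ : M * (_ / _) = M / rho ^+ 3 * cabs (zeta h) ^+ 3); last by ring.
  rewrite /k ler_wpM2r ?exprn_ge0 ?cabs_ge0 // ler_wpM2r ?invr_ge0 ?exprn_ge0 ?(ltW r0) //.
  by lra.
rewrite exprS mulrA ler_wpM2r ?exprn_ge0 ?cabs_ge0 //.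
by rewrite mulrC -ler_pdivlMr.
Qed.

(** Iterating divided differences at the centre produces the coefficients, and the
    bound of each step produces the geometric estimate of the remainders. *)
Lemma hreg_analytic F a r : hreg F a r -> analytic_at F a.
Proof.
move=> hF; have [r0 cF dF] := hF.
have [M M0 bM] := cdisc_ccont_bounded r0 cF.
pose P (F G : R * R -> C) := [/\ hreg G a r, forall y, F y = F a + (zeta y - zeta a) * G y &
    forall M, (forall y, cdisc a r y -> cabs (F y) <= M) ->
      forall y, cdisc a r y -> cabs (G y) <= 2 * M / r].
pose next F := xget F [set G | P F G].
have nextP G : hreg G a r -> P G (next G).
  by move=> hG; have [H HP] := divided_difference hG; exact: (@xgetPex _ G [set H | P G H] (ex_intro _ H HP)).
pose G n := iter n next F.
have hG n : hreg (G n) a r by elim: n => [|n IH] //=; have [] := nextP _ IH.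
have bG n y : cdisc a r y -> cabs (G n y) <= M * (2 / r) ^+ n.
  elim: n y => [|n IH] y yd; first by rewrite expr0 mulr1; exact: bM.
  have [_ _ /(_ _ IH y yd)] := nextP _ (hG n).
  by rewrite exprSr (_ : 2 * _ / r = M * ((2 / r) ^+ n * (2 / r))) //; ring.
exists (fun k => G k a), M, (r / 2); split=> //; first by rewrite divr_gt0.
move=> n h hr.
have hd : cdisc a r (a + h) by rewrite /cdisc /= addrAC subrr add0r; lra.
have -> : F (a + h) - \sum_(k < n) G k a * zeta h ^+ k = zeta h ^+ n * G n (a + h).
  elim: n => [|n IH]; first by rewrite big_ord0 subr0 expr0 mul1r.
  rewrite big_ord_recr /= opprD addrA IH.
  have [_ E _] := nextP _ (hG n).
  rewrite (E (a + h)) zetaD [zeta a + _ - _]addrAC subrr add0r exprS -/(G n) -[next (G n)]/(G n.+1).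
  by ring.
rewrite cabsM cabsX mulrC.
apply: (le_trans (ler_wpM2r _ (bG n _ hd))); first by rewrite exprn_ge0 ?cabs_ge0.
rewrite -mulrA -exprMn (_ : 2 / r * cabs (zeta h) = cabs (zeta h) / (r / 2)) //.
by field; rewrite gt_eqF.
Qed.

(** The derivative is the value at the centre of the divided difference. *)
Lemma cauchy_estimate F a r M c : 0 < r -> (forall y, cdisc a r y -> cder2 F y) ->
  (forall y, cdisc a r y -> cabs (F y) <= M) -> cder F a c -> cabs c <= 2 * M / r.
Proof.
move=> r0 dF bM dc.
have hF : hreg F a r.
  by split=> // y yd; [exact: cder2_ccont (dF _ yd)|move=> _; exact: dF].
have ad : cdisc a r a by rewrite /cdisc /= subrr zeta0 cabs0 ltW.
have [G [[_ cG _] E /(_ _ bM a ad)]] := divided_difference hF.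
suff -> : c = G a by [].
apply: cder_unique dc _ => e e0; have [d d0 Hd] := cG a ad e e0.
exists d => // h hd; rewrite E zetaD.
have -> : F a + (zeta a + zeta h - zeta a) * G (a + h) - F a - G a * zeta h =
  (G (a + h) - G a) * zeta h by ring.
by rewrite cabsM ler_wpM2r ?cabs_ge0 // ltW // Hd.
Qed.

Lemma open_cdisc D a : open D -> D a -> exists2 r, 0 < r &
  forall y, cabs (zeta (y - a)) < r -> D y.
Proof.
move=> oD Da; have /nbhs_normP [d /= d0 Hd] := open_nbhs_nbhs (conj oD Da).
exists d => // y yd; apply: Hd; rewrite /= distrC.
exact: le_lt_trans (norm_le_zeta _) yd.
Qed.

Lemma cder_poly a (c : nat -> C) n x :
  cder (fun y => \sum_(k < n.+1) c k * zeta (y - a) ^+ k) x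
    (\sum_(k < n) (k.+1%:R * c k.+1) * zeta (x - a) ^+ k).
Proof.
elim: n => [|n IH].
  rewrite big_ord0 (_ : (fun y => _) = fun=> c 0%N); first exact: cder_cst.
  by apply/funext => y; rewrite big_ord_recl big_ord0 expr0 mulr1 addr0.
rewrite big_ord_recr /=; have := cderD IH (cderZ (c n.+1) (cder_zetaX a x n)).
rewrite (_ : c n.+1 * _ = n.+1%:R * c n.+1 * zeta (x - a) ^+ n); last by ring.
congr cder; apply/funext => y; by rewrite [RHS]big_ord_recr.
Qed.

Lemma cder2_poly a (c : nat -> C) n x :
  cder2 (fun y => \sum_(k < n) c k * zeta (y - a) ^+ k) x.
Proof.
elim: n => [|n IH].
  rewrite (_ : (fun y => _) = fun=> 0); first exact: cder2_cst.
  by apply/funext => y; rewrite big_ord0.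
rewrite (_ : (fun y => _) = fun y => \sum_(k < n) c k * zeta (y - a) ^+ k +
   c n * (zeta y - zeta a) ^+ n); last first.
  by apply/funext => y; rewrite big_ord_recr /= zetaB.
apply: cder2D => //; apply: cder2M; first exact: cder2_cst.
by apply: cder2X; apply: cder2D; [exact: cder2_zeta|exact: cder2_cst].
Qed.

(** The remainders of the derivative are derivatives of the remainders, bounded by the
    Cauchy estimate on a disc whose radius is the distance to the centre. *)
Lemma analytic_derive D F : open D -> (forall y, D y -> analytic_at F y) ->
  forall a, D a -> analytic_at (cderive (1, 0) F) a.
Proof.
move=> oD aF a Da.
have [c [M [rho0 [M0 r00 H0]]]] := aF a Da.
have [rD rD0 HD] := open_cdisc oD Da.
pose rho := Num.min rho0 rD.
have r0 : 0 < rho by rewrite lt_min r00.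
have ps : power_series F a c M rho.
  split=> // n h; rewrite lt_min => /andP[hr hd].
  apply: (le_trans (H0 n h hr)); rewrite ler_wpM2l // lerXn2r ?nnegrE ?divr_ge0 ?cabs_ge0 ?(ltW r0) ?(ltW r00) //.
  by rewrite ler_wpM2l ?cabs_ge0 // lef_pV2 ?posrE // ge_min lexx.
have [_ _ H] := ps.
have inD y : cabs (zeta (y - a)) < rho -> D y.
  by rewrite lt_min => /andP[_ /HD].
have dF y : D y -> cder F y (cderive (1, 0) F y).
  by move=> /aF /analytic_cder2 /cder2_cder [c' dc']; have [-> _] := cder_ex dc'.
have F1 : cderive (1, 0) F a = c 1%N.
  have : cder F a (c 1%N).
    have F0 := power_series0 ps.
    move=> e e0; pose k := (M + 1) / rho ^+ 2.
    have k0 : 0 < k by rewrite divr_gt0 ?exprn_gt0 //; lra.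
    exists (Num.min (rho / 2) (e / k / 2)); first by rewrite lt_min; apply/andP; split; rewrite divr_gt0 // divr_gt0.
    move=> h; rewrite lt_min => /andP[h1 h2].
    have zn := zeta_le_norm h.
    have zr : cabs (zeta h) < rho by lra.
    have ze : cabs (zeta h) <= e / k by lra.
    have := H 2%N h zr; rewrite !big_ord_recr big_ord0 /= add0r expr0 mulr1 expr1 -F0 opprD addrA.
    move=> /le_trans; apply.
    rewrite expr_div_n; apply: (@le_trans _ _ (k * cabs (zeta h) ^+ 2)).
      rewrite (_ : M * (_ / _) = M / rho ^+ 2 * cabs (zeta h) ^+ 2); last by ring.
      rewrite /k ler_wpM2r ?exprn_ge0 ?cabs_ge0 // ler_wpM2r ?invr_ge0 ?exprn_ge0 ?(ltW r0) //.
      by lra.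
    rewrite expr2 mulrA ler_wpM2r ?cabs_ge0 //.
    by rewrite mulrC -ler_pdivlMr.
  by move=> /cder_ex [].
exists (fun k => k.+1%:R * c k.+1), (4 * M / rho), (rho / 2).
split; [by rewrite divr_ge0 ?mulr_ge0 ?(ltW r0)|by rewrite divr_gt0|].
move=> n h hr.
have [h0|hn0] := eqVneq h 0.
  rewrite h0 addr0 zeta0 cabs0 mul0r; case: n => [|n].
    rewrite big_ord0 subr0 expr0 mulr1 F1; apply: (le_trans (power_series_coef 1 ps)).
    rewrite expr1 ler_wpM2r ?invr_ge0 ?(ltW r0) //; lra.
  rewrite big_ord_recl big1 => [|k _]; last by rewrite /= expr0n mulr0.
  by rewrite expr0 mulr1 addr0 mul1r F1 subrr cabs0 expr0n mulr0.
pose s := cabs (zeta h); have s0 : 0 < s by rewrite cabs_gt0 zeta_eq0.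
pose G y := F y + (-1) * \sum_(k < n.+1) c k * zeta (y - a) ^+ k.
have sub y : cdisc (a + h) s y -> cabs (zeta (y - a)) <= 2 * s.
  rewrite /cdisc /= => yd; rewrite (_ : y - a = (y - (a + h)) + h).
    by rewrite zetaD; apply: (le_trans (ler_cabsD _ _)); rewrite -/s; lra.
  by rewrite opprD addrA subrK.
have sr : 2 * s < rho by rewrite /s; lra.
have -> : 4 * M / rho * (cabs (zeta h) / (rho / 2)) ^+ n = 2 * (M * (2 * s / rho) ^+ n.+1) / s.
  rewrite -/s (_ : s / (rho / 2) = 2 * s / rho); last by field; rewrite gt_eqF.
  by rewrite exprS; field; rewrite !gt_eqF.
apply: (@cauchy_estimate G (a + h)) => //.
- move=> y /sub yr; apply: cder2D.
    by apply/analytic_cder2/aF/inD; lra.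
  by apply: cder2M; [exact: cder2_cst|exact: cder2_poly].
- move=> y /sub yr; have yrho : cabs (zeta (y - a)) < rho by lra.
  have := H n.+1 (y - a) yrho; rewrite [a + _]addrC subrK /G mulN1r => /le_trans; apply.
  rewrite ler_wpM2l // lerXn2r ?nnegrE ?divr_ge0 ?cabs_ge0 ?mulr_ge0 ?(ltW r0) ?(ltW s0) //.
  by rewrite ler_wpM2r ?invr_ge0 ?(ltW r0).
have hh : (a + h) - a = h by rewrite addrAC subrr add0r.
have := cder_poly a c n (a + h); rewrite hh => dp.
rewrite -mulN1r; apply: cderD; last exact: cderZ.
by apply/dF/inD; rewrite hh; lra.
Qed.

Lemma analytic_cr D F : (forall y, D y -> analytic_at F y) ->
  forall a, D a -> cdiff F a /\ wirtinger false F a = 0.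
Proof.
by move=> aF a /aF /analytic_cder2 /cder2_cder [c /cderP []].
Qed.

Lemma analytic_smooth D F : open D -> (forall y, D y -> analytic_at F y) ->
  forall n, cndiff n D F.
Proof.
move=> oD aF n; elim: n F aF => [|n IH] F aF //.
have a1 := analytic_derive oD aF.
have d1 := IH _ a1.
have e1 y : D y -> cderive (0, 1) F y = 'i * cderive (1, 0) F y.
  by move=> /aF /analytic_cder2 /cder2_cder [c /cder_ex [-> ->]].
have d2 : cndiff n D (cderive (0, 1) F).
  by apply: cndiff_eq (cndiffM oD (cndiff_cst n 'i oD) d1) => // y /e1.
have Re1 h : (fun y => complex.Re (cderive h F y)) = (fun y => 'D_h (fun y => complex.Re (F y)) y).
  by apply/funext => y; rewrite cderiveE.
have Im1 h : (fun y => complex.Im (cderive h F y)) = (fun y => 'D_h (fun y => complex.Im (F y)) y).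
  by apply/funext => y; rewrite cderiveE.
have [d1r d1i] := d1; have [d2r d2i] := d2; rewrite !Re1 in d1r d2r; rewrite !Im1 in d1i d2i.
by split; split=> // y Dy; have [[]] := analytic_cr aF Dy.
Qed.

Lemma is_derive_quadratic (u : R -> R) (t du k a b : R) : is_derive t 1 u du ->
  is_derive t 1 (fun s => u s - k - s * a - s ^+ 2 / 2 * b) (du - a - t * b).
Proof.
move=> du'.
have -> : (fun s => u s - k - s * a - s ^+ 2 / 2 * b) =
    u - (cst k + (id * cst a + id * id * cst (b / 2))).
  by apply/funext => s; rewrite !fctE /cst /=; field.
have D1 : is_derive t 1 (id * cst a) (t *: 0 + a *: 1) by apply: is_deriveM.
have D2 : is_derive t 1 (id * id) (t *: 1 + t *: 1) by apply: is_deriveM.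
have D3 : is_derive t 1 (id * id * cst (b / 2)) ((t * t) *: 0 + (b / 2) *: (t *: 1 + t *: 1)).
  by apply: is_deriveM.
have D4 := is_deriveB du' (is_deriveD (is_derive_cst k t 1) (is_deriveD D1 D3)).
apply: (is_derive_eq D4); rewrite /GRing.scale /=.
by field.
Qed.

(** The mean value theorem along a segment, for a real-linear part of the values (the
    real or the imaginary part). *)
Lemma taylor_line (F : R * R -> C) (x h : R * R) (c1 c2 : C) (part : C -> R) (b : R) :
  (forall t : R, 0 <= t <= 1 ->
     is_derive t 1 (fun t => part (F (x + t *: h) - F x - t%:C * (c1 * zeta h)
        - (t ^+ 2 / 2)%:C * (c2 * zeta h ^+ 2)))
       (part ((cderive (1, 0) F (x + t *: h) - c1 - t%:C * (c2 * zeta h)) * zeta h))) ->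
  (forall z : C, `|part z| <= cabs z) -> part 0 = 0 ->
  (forall t : R, 0 <= t <= 1 ->
     cabs (cderive (1, 0) F (x + t *: h) - c1 - t%:C * (c2 * zeta h)) <= b) ->
  `|part (F (x + h) - F x - c1 * zeta h - 2^-1%:C * (c2 * zeta h ^+ 2))| <= b * cabs (zeta h).
Proof.
move=> dv np p0 bb.
pose phi (t : R) := part (F (x + t *: h) - F x - t%:C * (c1 * zeta h)
        - (t ^+ 2 / 2)%:C * (c2 * zeta h ^+ 2)).
have [||t tI] := @MVT R phi (fun t => part ((cderive (1, 0) F (x + t *: h) - c1 - t%:C * (c2 * zeta h)) * zeta h)) 0 1 ltr01.
- by move=> s; rewrite in_itv /= => /andP[s0 s1]; apply: dv; rewrite !ltW.
- apply: derivable_within_continuous => s; rewrite in_itv /= => st.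
  by case: (dv s st).
have -> : phi 0 = 0.
  rewrite /phi scale0r addr0 subrr.
  have -> : ((0 : R) ^+ 2 / 2)%:C = 0 :> C by rewrite expr2 !mul0r.
  by rewrite !mul0r !subr0 p0.
have -> : phi 1 = part (F (x + h) - F x - c1 * zeta h - 2^-1%:C * (c2 * zeta h ^+ 2)).
  by rewrite /phi scale1r expr1n div1r mul1r.
rewrite !subr0 mulr1 => ->; apply: (le_trans (np _)); rewrite cabsM ler_wpM2r ?cabs_ge0 //.
by apply: bb; move: tI; rewrite in_itv /= => /andP[? ?]; rewrite !ltW.
Qed.

(** By equality of mixed derivatives the complex derivative satisfies the
    Cauchy-Riemann equation at x too, and integration along segments gives the
    second-order expansion. *)
Lemma cr_cder2 D F : open D -> cndiff 2 D F ->
  (forall y, D y -> wirtinger false F y = 0) -> forall x, D x -> cder2 F x.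
Proof.
move=> oD dF cr x Dx.
have dFy y : D y -> cder F y (cderive (1, 0) F y).
  move=> Dy; have dy := cndiff_cdiff dF Dy.
  by apply/cderP; split=> //; [rewrite wirtinger_ex cr ?addr0|exact: cr].
have dd := cndiff_cderive oD dF; have [d1 d2] := dd.
have c1 := cndiff_cdiff d1 Dx.
pose p := cderive (1, 0) F.
have dp : cder p x (cderive (1, 0) p x).
  have near01 : {near x, cderive (0, 1) F =1 (fun y => 'i * p y)}.
    have : nbhs x D by apply: open_nbhs_nbhs.
    by apply: filterS => y /dFy /cder_ex [].
  have e1 : cderive (0, 1) p x = 'i * cderive (1, 0) p x.
    rewrite /p (cderiveC oD Dx dF) (cderive_near _ near01).
    by rewrite cderiveM ?cderive_cst ?mul0r ?add0r //; exact: cdiff_cst.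
  have i2 := @sqr_i R; rewrite expr2 in i2.
  apply/cderP; split=> //; rewrite wirtingerE e1 mulrA /wsign ?mulNr i2.
    by rewrite mulN1r opprK; field.
  by rewrite mulN1r subrr mulr0.
exists (p x), (2^-1%:C * cderive (1, 0) p x) => e e0.
have e2 : 0 < e / 2 by rewrite divr_gt0.
have [d d0 Hd] := dp _ e2.
have /nbhs_normP [r /= r0 Hr] := open_nbhs_nbhs (conj oD Dx).
exists (Num.min d r); first by rewrite lt_min d0.
move=> h; rewrite lt_min => /andP[hd hr].
have th (t : R) : 0 <= t <= 1 -> `|t *: h| <= `|h|.
  by move=> /andP[t0 t1]; rewrite normrZ ger0_norm // ler_piMl.
have inD (t : R) : 0 <= t <= 1 -> D (x + t *: h).
  by move=> /th H; apply: Hr; rewrite /= opprD addNKr normrN (le_lt_trans H).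
have bnd (t : R) : 0 <= t <= 1 ->
     cabs (p (x + t *: h) - p x - t%:C * (cderive (1, 0) p x * zeta h)) <= e / 2 * cabs (zeta h).
  move=> t01; have := Hd (t *: h) (le_lt_trans (th t t01) hd).
  rewrite scale_zeta [cderive (1, 0) p x * (_ * _)]mulrCA => /le_trans; apply.
  rewrite ler_wpM2l ?(ltW e2) // cabsM cabs_real ler_piMl ?cabs_ge0 //.
  by case/andP: t01 => ? ?; rewrite ger0_norm.
set c2 := cderive (1, 0) p x in bnd *.
have reP : `|complex.Re (F (x + h) - F x - p x * zeta h - 2^-1%:C * (c2 * zeta h ^+ 2))| <=
    e / 2 * cabs (zeta h) * cabs (zeta h).
  apply: (@taylor_line F x h (p x) c2 (@complex.Re R)) => // [t t01|z]; last exact: le_Re_cabs.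
  have /cder_frechet [fr _] := dFy _ (inD t t01).
  have dl := is_derive_line fr.
  have E : (fun t0 : R => complex.Re (F (x + t0 *: h) - F x - t0%:C * (p x * zeta h) -
     (t0 ^+ 2 / 2)%:C * (c2 * zeta h ^+ 2))) =
    (fun t0 => complex.Re (F (x + t0 *: h)) - complex.Re (F x) -
       t0 * complex.Re (p x * zeta h) - t0 ^+ 2 / 2 * complex.Re (c2 * zeta h ^+ 2)).
    apply/funext => s; move: (p x * zeta h) (c2 * zeta h ^+ 2) (F _) (F _) => z w u v.
    by rewrite !ReImE /=; ring.
  rewrite E; apply: (is_derive_eq (is_derive_quadratic _ _ _ dl)).
  rewrite -/p expr2; move: (p (x + t *: h)) (p x) (c2) => u v w.
  rewrite !ReImE /=.
  rewrite (_ : h.1 = complex.Re (zeta h)) // (_ : h.2 = complex.Im (zeta h)) //; ring.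
have imP : `|complex.Im (F (x + h) - F x - p x * zeta h - 2^-1%:C * (c2 * zeta h ^+ 2))| <=
    e / 2 * cabs (zeta h) * cabs (zeta h).
  apply: (@taylor_line F x h (p x) c2 (@complex.Im R)) => // [t t01|z]; last exact: le_Im_cabs.
  have /cder_frechet [_ fr] := dFy _ (inD t t01).
  have dl := is_derive_line fr.
  have E : (fun t0 : R => complex.Im (F (x + t0 *: h) - F x - t0%:C * (p x * zeta h) -
     (t0 ^+ 2 / 2)%:C * (c2 * zeta h ^+ 2))) =
    (fun t0 => complex.Im (F (x + t0 *: h)) - complex.Im (F x) -
       t0 * complex.Im (p x * zeta h) - t0 ^+ 2 / 2 * complex.Im (c2 * zeta h ^+ 2)).
    apply/funext => s; move: (p x * zeta h) (c2 * zeta h ^+ 2) (F _) (F _) => z w u v.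
    by rewrite !ReImE /=; ring.
  rewrite E; apply: (is_derive_eq (is_derive_quadratic _ _ _ dl)).
  rewrite -/p expr2; move: (p (x + t *: h)) (p x) (c2) => u v w.
  rewrite !ReImE /=.
  rewrite (_ : h.1 = complex.Re (zeta h)) // (_ : h.2 = complex.Im (zeta h)) //; ring.
have -> : F (x + h) - (F x + p x * zeta h + 2^-1%:C * c2 * zeta h ^+ 2) =
  F (x + h) - F x - p x * zeta h - 2^-1%:C * (c2 * zeta h ^+ 2) by ring.
apply: (le_trans (cabs_le _)); have := lerD reP imP.
by move=> /le_trans; apply; rewrite expr2; lra.
Qed.

Lemma cr_analytic D F : open D -> cndiff 2 D F ->
  (forall y, D y -> wirtinger false F y = 0) -> forall x, D x -> analytic_at F x.
Proof.
move=> oD dF cr x Dx; have d2 := cr_cder2 oD dF cr.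
have [r r0 Hr] := open_cdisc oD Dx.
have inD y : cdisc x (r / 2) y -> D y by rewrite /cdisc /= => yd; apply: Hr; lra.
apply: (@hreg_analytic _ _ (r / 2)); split; first by rewrite divr_gt0.
  by move=> y /inD /d2 /cder2_ccont.
by move=> y /inD /d2.
Qed.

Lemma open_punctured a : open [set y : R * R | y != a].
Proof.
rewrite openE => y /= ya; suff : \forall z \near y, z != a by [].
apply/nbhs_normP; exists `|y - a|.
  by rewrite /= normr_gt0 subr_eq0.
by move=> z /=; apply: contraTneq => ->; rewrite ltxx.
Qed.

(** The sequence c is the Taylor sequence at a. If its first n terms vanish, the
    quotient by the n-th power extends across a, with the shifted series; if all
    vanish, so does F near a. *)
Lemma hol_divide D F a : open D -> D a -> cndiff 2 D F ->
  (forall y, D y -> wirtinger false F y = 0) ->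
  exists c : nat -> C, ((forall k, c k = 0) -> {near a, F =1 fun=> 0}) /\
   forall n, (forall k, (k < n)%N -> c k = 0) ->
     exists G, [/\ forall m, cndiff m D G, forall y, D y -> wirtinger false G y = 0,
        forall y, D y -> F y = zeta (y - a) ^+ n * G y & G a = c n].
Proof.
move=> oD Da dF cr; have aF := cr_analytic oD dF cr.
have [c [M [rho ps]]] := aF a Da; have [M0 r0 H] := ps.
exists c; split=> [c0|n c0].
  have : {near a, forall y, cabs (zeta (y - a)) < rho}.
    apply/nbhs_normP; exists (rho / 2); first by rewrite /= divr_gt0.
    move=> y /=; rewrite distrC; have := zeta_le_norm (y - a); lra.
  apply: filterS => y yr.
  apply/eqP; rewrite -cabs_eq0 eq_le cabs_ge0 andbT; apply/ler_addgt0Pl => e e0; rewrite addr0.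
  have q01 : 0 <= cabs (zeta (y - a)) / rho < 1.
    by rewrite divr_ge0 ?cabs_ge0 ?(ltW r0) //= ltr_pdivrMr // mul1r.
  have [|n Hn] := expr_small q01 (_ : 0 < e / (M + 1)); first by rewrite divr_gt0 //; lra.
  have := H n (y - a) yr; rewrite [a + _]addrC subrK big1 ?subr0; last by move=> k _; rewrite c0 mul0r.
  move=> /le_trans; apply.
  have qn : 0 <= (cabs (zeta (y - a)) / rho) ^+ n by rewrite exprn_ge0; [|case/andP: q01].
  move: Hn; rewrite ltr_pdivlMr; last by lra.
  by move=> Hn; nra.
pose G y := if y == a then c n else F y * (zeta (y - a) ^+ n)^-1.
pose D' := D `&` [set y | y != a].
have oD' : open D'.
  by apply: openI => //; exact: open_punctured.
have z0 y : y != a -> zeta (y - a) ^+ n != 0.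
  by move=> ya; rewrite expf_neq0 // zeta_eq0 subr_eq0.
have smooth_z (E : set (R * R)) m : open E -> cndiff m E (fun y => zeta (y - a) ^+ n).
  move=> oE; elim: (n) => [|k IH]; first exact: cndiff_cst.
  apply: (@cndiff_eq _ _ _ (fun y => zeta (y - a) * zeta (y - a) ^+ k)) => //.
    by move=> y _; rewrite exprS.
  apply: cndiffM => //; apply: (@cndiff_eq _ _ _ (fun y => zeta y + (- zeta a))) => //.
  by apply: cndiffD => //; [exact: cndiff_zeta|exact: cndiff_cst].
have crz y : wirtinger false (fun y => zeta (y - a) ^+ n) y = 0.
  case: (n) => [|k]; first exact: wirtinger_cst.
  by have /cderP [] := cder_zetaX a y k.
have dG : cndiff 2 D' G.
  apply: (@cndiff_eq _ _ _ (fun y => F y * (zeta (y - a) ^+ n)^-1)) => //.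
    by move=> y [_ /= /negbTE ya]; rewrite /G ya.
  apply: cndiffM => //; first by apply: cndiff_subset dF => y [].
  apply: cndiffV => //; last exact: smooth_z.
  by move=> y [_ /= ya]; exact: z0.
have FG y : y != a -> F y = zeta (y - a) ^+ n * G y.
  by move=> ya; rewrite /G (negbTE ya) mulrC mulfVK // z0.
have crG y : D' y -> wirtinger false G y = 0.
  move=> D'y; have [Dy ya] := D'y.
  have dGy := cndiff_cdiff dG D'y.
  have dzy : cdiff (fun y => zeta (y - a) ^+ n) y by exact: cndiff_cdiff (smooth_z _ 1 oD) Dy.
  have : wirtinger false F y = wirtinger false (fun y => zeta (y - a) ^+ n * G y) y.
    apply: wirtinger_near; have : nbhs y D' by exact: open_nbhs_nbhs.
    by apply: filterS => z [_ /= za]; exact: FG.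
  rewrite cr // wirtingerM // crz mul0r add0r => /esym/eqP.
  by rewrite mulf_eq0 (negbTE (z0 _ ya)) /= => /eqP.
have aG y : D y -> analytic_at G y.
  move=> Dy; have [->|ya] := eqVneq y a; last first.
    by apply: (cr_analytic oD' dG crG).
  exists (fun k => c (n + k)%N), (2 * M / rho ^+ n), rho; split=> //.
    by rewrite divr_ge0 ?mulr_ge0 ?exprn_ge0 // ltW.
  move=> m h hr; have [h0|hn0] := eqVneq h 0.
    rewrite h0 addr0 zeta0 cabs0 mul0r {1}/G eqxx; case: m => [|m].
      by rewrite big_ord0 subr0 expr0 mulr1; exact: power_series_coef ps.
    rewrite big_ord_recl big1 => [|k _]; last by rewrite /= expr0n mulr0.
    by rewrite expr0 mulr1 addr0 addn0 subrr cabs0 expr0n mulr0.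
  have ah : a + h != a.
    by apply: contra hn0; rewrite -subr_eq0 addrAC subrr add0r.
  have hh : (a + h) - a = h by rewrite addrAC subrr add0r.
  have zp : 0 < cabs (zeta h) ^+ n by rewrite exprn_gt0 // cabs_gt0 zeta_eq0.
  rewrite -(ler_pM2l zp) -cabsX -cabsM mulrBr -[h in X in zeta X ^+ n * G _]hh -FG //.
  have := H (n + m)%N h hr; rewrite big_split_ord /= big1 => [|k _]; last by rewrite c0 ?mul0r.
  rewrite add0r big_distrr /= => H1.
  rewrite (eq_bigr (fun k : 'I_m => c (n + k)%N * zeta h ^+ (n + k))); last first.
    by move=> k _; rewrite exprD; ring.
  apply: (le_trans H1).
  rewrite exprD !expr_div_n cabsX.
  have rn : 0 < rho ^+ n by rewrite exprn_gt0.
  have rm : 0 < rho ^+ m by rewrite exprn_gt0.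
  have -> : M * (cabs (zeta h) ^+ n / rho ^+ n * (cabs (zeta h) ^+ m / rho ^+ m)) =
    cabs (zeta h) ^+ n * (M / rho ^+ n * (cabs (zeta h) ^+ m / rho ^+ m)) by ring.
  rewrite ler_wpM2l ?(ltW zp) // ler_wpM2r ?divr_ge0 ?exprn_ge0 ?cabs_ge0 ?(ltW r0) //.
  by rewrite ler_wpM2r ?invr_ge0 ?(ltW rn) //; lra.
exists G; split=> //.
- exact: analytic_smooth.
- by move=> y Dy; have [] := analytic_cr aG Dy.
- move=> y Dy; have [->|ya] := eqVneq y a; last exact: FG.
  rewrite subrr zeta0 /G eqxx; have F0 := power_series0 ps.
  by case: n {G D' oD' z0 smooth_z crz dG FG crG aG} c0 => [|n] c0; rewrite ?expr0 ?mul1r // F0 c0 // expr0n mul0r.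
- by rewrite /G eqxx.
Qed.

End PowerSeries.

(** * Rank-one projectors and connectedness of the plane *)

Section RankOne.
Context {R : realType} {N : nat}.
Local Notation C := R[i].
Local Notation M := 'M[C]_N.
Implicit Types (P X Y : M).

(** A full-rank factorization P = C R of an idempotent has R C = 1, whence tr P = tr
    (R C). *)
Lemma idempotent_rank P : P *m P = P -> \tr P = (\rank P)%:R.
Proof.
move=> PP.
have rc : row_base P *m col_base P = 1%:M.
  have H : col_base P *m (row_base P *m col_base P) *m row_base P =
           col_base P *m 1%:M *m row_base P.
    by rewrite mulmx1 mulmxA -mulmxA !mulmx_base PP.
  have H2 := row_free_inj (row_base_free P) H.
  exact: (row_full_inj (col_base_full P) H2).
by rewrite -{1}(mulmx_base P) mxtrace_mulC rc mxtrace1.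
Qed.

(** P factors through a one-dimensional space, on which X acts as a scalar. *)
Lemma rank1_sandwich P X : P *m P = P -> \tr P = 1 -> P *m X *m P = \tr (P *m X) *: P.
Proof.
move=> PP tP; have rP : \rank P = 1%N.
  by have := idempotent_rank PP; rewrite tP -[1]/(1%:R) => /eqP; rewrite eqr_nat eq_sym => /eqP.
have [u [v ->]] : exists (u : 'M[C]_(N, 1)) (v : 'M[C]_(1, N)), P = u *m v.
  by move: (col_base P) (row_base P) (mulmx_base P); rewrite rP => u v <-; exists u, v.
rewrite -!mulmxA (mulmxA X) (mulmxA v) (mulmxA v) [v *m X *m u]mx11_scalar.
rewrite -trace_mx11 mul_scalar_mx -scalemxAr; congr (_ *: _).
by rewrite mxtrace_mulC mulmxA.
Qed.

Lemma tr_adjoint_mul X : \tr (adjoint X *m X) = (\sum_j \sum_k cabs (X k j) ^+ 2)%:C.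
Proof.
rewrite /mxtrace; rewrite (rmorph_sum (real_complex R)); apply: eq_bigr => j _.
rewrite mxE (rmorph_sum (real_complex R)); apply: eq_bigr => k _.
rewrite adjointE; case: (X k j) => a b; rewrite sqr_cabs.
by apply: complexP; rewrite ReImE /=; ring.
Qed.

Lemma tr_mul_adjoint X : \tr (X *m adjoint X) = \tr (adjoint X *m X).
Proof. exact: mxtrace_mulC. Qed.

Lemma tr_adjoint_mul_eq0 X : \tr (adjoint X *m X) = 0 -> X = 0.
Proof.
rewrite tr_adjoint_mul => /(congr1 (@complex.Re R)) /= /eqP.
rewrite psumr_eq0; last by move=> j _; apply: sumr_ge0 => k _; rewrite exprn_ge0 // cabs_ge0.
move=> /allP H; apply/matrixP => k j; rewrite mxE; apply/eqP.
have := H j (mem_index_enum j); rewrite /= psumr_eq0; last first.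
  by move=> l _; rewrite exprn_ge0 // cabs_ge0.
by move=> /allP /(_ k (mem_index_enum k)) /=; rewrite sqrf_eq0 cabs_eq0.
Qed.

Lemma tr_mul_adjoint_eq0 X : (\tr (X *m adjoint X) == 0) = (X == 0).
Proof.
apply/eqP/eqP => [|->]; last by rewrite mul0mx mxtrace0.
by rewrite tr_mul_adjoint; exact: tr_adjoint_mul_eq0.
Qed.

Lemma mul_adjoint_eq0 X : X *m adjoint X = 0 -> X = 0.
Proof. by move=> H; apply/eqP; rewrite -tr_mul_adjoint_eq0 H mxtrace0. Qed.

Lemma conj_tr_mul_adjoint X : conjc (\tr (X *m adjoint X)) = \tr (X *m adjoint X).
Proof. by rewrite -tr_adjoint adjointM adjointK. Qed.

(** When w = w P with P a rank-one projector, the range of w is a line and this is the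
    orthogonal projector on it. *)
Definition line_projector (w : M) : M := (\tr (w *m adjoint w))^-1 *: (w *m adjoint w).

Lemma line_projectorK P (w : M) : P *m P = P -> adjoint P = P -> \tr P = 1 -> w *m P = w ->
  w != 0 -> line_projector w *m w = w.
Proof.
move=> PP aP tP wP w0.
have Pw : P *m adjoint w = adjoint w by rewrite -{1}aP -adjointM wP.
rewrite /line_projector -scalemxAl -mulmxA.
have -> : adjoint w *m w = \tr (w *m adjoint w) *: P.
  rewrite -[X in adjoint w *m X]wP mulmxA -Pw -(mulmxA P) rank1_sandwich //.
  by rewrite mulmxA Pw tr_mul_adjoint.
by rewrite -scalemxAr wP scalerA mulVf ?scale1r // tr_mul_adjoint_eq0.
Qed.

Lemma line_projector_rank1 P (w : M) : P *m P = P -> adjoint P = P -> \tr P = 1 -> w *m P = w ->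
  w != 0 -> rank1_projector (line_projector w).
Proof.
move=> PP aP tP wP w0; split.
- rewrite {2}/line_projector -scalemxAr mulmxA (line_projectorK PP aP tP wP w0) //.
- by rewrite /line_projector adjointZ adjointM adjointK conjc_inv conj_tr_mul_adjoint.
- by rewrite /line_projector mxtraceZ mulVf // tr_mul_adjoint_eq0.
Qed.

Lemma line_projectorZ (c : C) (w : M) : c != 0 -> line_projector (c *: w) = line_projector w.
Proof.
move=> c0; rewrite /line_projector adjointZ -scalemxAl -scalemxAr !scalerA !mxtraceZ.
congr (_ *: _).
have cc : conjc c != 0 by rewrite conjc_eq0.
move: (\tr _) (conjc c) cc => t d d0; rewrite !invfM.
transitivity ((c^-1 * c) * (d^-1 * d) * t^-1); first by ring.
by rewrite !mulVf // !mul1r.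
Qed.

End RankOne.

Section PlaneTopology.
Context {R : realType}.
Local Notation C := R[i].
Implicit Types (f : R * R -> C) (x y : R * R) (D U : set (R * R)).

Lemma cdiff_ccont f x : cdiff f x -> ccont f x.
Proof.
move=> [d1 d2] e e0.
have := differentiable_continuous d1; move=> /(@cvgrPdist_lt _ R^o) /(_ (e / 2)).
rewrite divr_gt0 // => /(_ isT) H1.
have := differentiable_continuous d2; move=> /(@cvgrPdist_lt _ R^o) /(_ (e / 2)).
rewrite divr_gt0 // => /(_ isT) H2.
have /nbhs_normP [d /= d0 Hd] : \forall y \near x,
    `|complex.Re (f x) - complex.Re (f y)| < e / 2 /\ `|complex.Im (f x) - complex.Im (f y)| < e / 2.
  by apply: filterI.
exists d => // h hd; have [] := Hd (x + h); first by rewrite /= opprD addNKr normrN.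
rewrite distrC => k1; rewrite distrC => k2.
by apply: (le_lt_trans (cabs_le _)); rewrite !ReImE; lra.
Qed.

Lemma ccont_Re f x : ccont f x -> {for x, continuous (fun y => complex.Re (f y))}.
Proof.
move=> H; apply/(@cvgrPdist_lt _ R^o) => e e0; have [d d0 Hd] := H e e0.
suff : \forall y \near x, `|complex.Re (f x) - complex.Re (f y)| < e by [].
apply/nbhs_normP; exists d => //= y; rewrite /= distrC => yd.
rewrite distrC -ReN -ReD; apply: (le_lt_trans (le_Re_cabs _)).
by have := Hd (y - x) yd; rewrite [x + _]addrC subrK.
Qed.

Lemma ccont_Im f x : ccont f x -> {for x, continuous (fun y => complex.Im (f y))}.
Proof.
move=> H; apply/(@cvgrPdist_lt _ R^o) => e e0; have [d d0 Hd] := H e e0.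
suff : \forall y \near x, `|complex.Im (f x) - complex.Im (f y)| < e by [].
apply/nbhs_normP; exists d => //= y; rewrite /= distrC => yd.
rewrite distrC -ImN -ImD; apply: (le_lt_trans (le_Im_cabs _)).
by have := Hd (y - x) yd; rewrite [x + _]addrC subrK.
Qed.

Lemma ccont_neq0 f x : ccont f x -> f x != 0 -> {near x, forall y, f y != 0}.
Proof.
move=> cf fx; have [|d d0 Hd] := cf (cabs (f x)); first by rewrite cabs_gt0.
apply/nbhs_normP; exists d => //= y; rewrite /= distrC => yd.
have := Hd (y - x) yd; rewrite [x + _]addrC subrK; apply: contraTneq => ->.
by rewrite sub0r cabsN ltxx.
Qed.

Lemma open_ccont_neq0 D f : open D -> (forall x, D x -> ccont f x) ->
  open (D `&` [set y | f y != 0]).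
Proof.
move=> oD cf; rewrite openE => x [Dx /= fx].
have : nbhs x (D `&` [set y | f y != 0]); last by [].
by apply: filterI; [exact: open_nbhs_nbhs|exact: (ccont_neq0 (cf x Dx) fx)].
Qed.

Lemma ccont_eq f g x D : open D -> D x -> ccont f x -> ccont g x ->
  (forall y, D y -> y != x -> f y = g y) -> f x = g x.
Proof.
move=> oD Dx cf cg fg; apply/eqP; rewrite -subr_eq0; apply/negPn/negP => fx.
have cfg : ccont (fun y => f y + (-1) * g y) x.
  by apply: ccontD => //; apply: ccontM => //; apply: cder2_ccont; exact: cder2_cst.
have : {near x, forall y, f y + (-1) * g y != 0}.
  by apply: ccont_neq0 => //; rewrite mulN1r.
have nD : nbhs x D by exact: open_nbhs_nbhs.
move=> H; have /nbhs_normP [d /= d0 Hd] : \forall y \near x, D y /\ f y + (-1) * g y != 0.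
  exact: filterI nD H.
pose y := x + (d / 2, 0).
have yx : y - x = (d / 2, 0) by rewrite /y addrAC subrr add0r.
have n : `|(d / 2, 0) : R * R| = d / 2.
  by rewrite norm_pairE /= normr0 gtr0_norm ?divr_gt0 //; apply/max_idPl; rewrite divr_ge0 // ltW.
have [] := Hd y; first by rewrite /= distrC yx n; lra.
move=> Dy; rewrite mulN1r fg ?subrr ?eqxx // -subr_eq0 -normr_gt0 yx n.
by rewrite divr_gt0.
Qed.

Lemma ndiff_local n D (f : R * R -> R) :
  (forall x, D x -> exists D', [/\ open D', D' x & ndiff n D' f]) -> ndiff n D f.
Proof.
elim: n f => [|n IH] f H //; split.
- by move=> x /H [D' [oD D'x [d _ _]]]; exact: d.
- by apply: IH => x /H [D' [oD D'x [_ d _]]]; exists D'.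
- by apply: IH => x /H [D' [oD D'x [_ _ d]]]; exists D'.
Qed.

Lemma mndiff_local N n D (A : mxfun R N) :
  (forall x, D x -> exists D', [/\ open D', D' x & mndiff n D' A]) -> mndiff n D A.
Proof.
move=> H j k; split; apply: ndiff_local => x /H [D' [oD D'x d]]; exists D'; split=> //.
  by case: (d j k).
by case: (d j k).
Qed.

(** Along a segment from a point of U to another point, U traces a clopen subset of
    the real line. *)
Lemma plane_connected U : open U -> open (~` U) -> U !=set0 -> forall x, U x.
Proof.
move=> oU oCU [a Ua] b; apply: contrapT => nUb.
pose l (t : R) := a + t *: (b - a).
have cl : continuous l.
  move=> t; apply: cvgD; first exact: cvg_cst.
  by apply: cvgZ; [exact: cvg_id|exact: cvg_cst].
have cT : connected [set: R] by apply/connected_intervalP => x y _ _ z _.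
have E : l @^-1` U = [set: R].
  apply: cT.
  - by exists 0; rewrite /l /= scale0r addr0.
  - by exists (l @^-1` U); [apply: open_comp => // t _; exact: cl|rewrite setTI].
  - exists (l @^-1` U); last by rewrite setTI.
    rewrite -[l @^-1` U]setCK; apply: open_closedC.
    have -> : ~` (l @^-1` U) = l @^-1` (~` U) by [].
    by apply: open_comp => // t _; exact: cl.
by apply: nUb; have : (l @^-1` U) 1 by [rewrite E]; rewrite /l /= scale1r addrC subrK.
Qed.

End PlaneTopology.

(** * The Laplacian at a maximum *)

Section SecondDerivativeTest.
Context {R : realType}.
Local Notation C := R[i].
Implicit Types (f : R * R -> R) (x y h : R * R) (D : set (R * R)).

Lemma derive_coord f x h : differentiable f x ->
  'D_h f x = 'D_(1, 0) f x * h.1 + 'D_(0, 1) f x * h.2.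
Proof.
move=> df; rewrite !deriveE //.
have hE : h = h.1 *: (1, 0) + h.2 *: (0, 1).
  by case: h => u v; congr pair; rewrite /= /GRing.scale /=; ring.
by rewrite [X in _ X = _]hE linearD !linearZ /= /GRing.scale /= mulrC [h.2 * _]mulrC.
Qed.

Lemma is_derive_direction f x h (t : R) : differentiable f (x + t *: h) ->
  is_derive t 1 (fun s => f (x + s *: h)) ('D_h f (x + t *: h)).
Proof.
move=> df; rewrite derive_coord //.
by apply: is_derive_line; apply/frechetP.
Qed.

Lemma near_line x h (r : R) : 0 < r -> exists2 d, 0 < d &
  forall t, `|t| < d -> `|x + t *: h - x| < r.
Proof.
move=> r0; have k0 : 0 < `|h| + 1 by rewrite ltr_wpDl.
exists (r / (`|h| + 1)); first by rewrite divr_gt0.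
move=> t; rewrite addrAC subrr add0r normrZ ltr_pdivlMr // => H.
apply: le_lt_trans H; rewrite ler_wpM2l //; lra.
Qed.

Lemma pos_of_half_close (u v : R) : - (u / 2) <= v - u -> 0 < u -> 0 < v.
Proof. by move=> *; lra. Qed.

(** If the second derivative were positive, the first one would be positive just after
    the maximum, where it vanishes, and the function would increase. *)
Lemma second_derivative_test f x h (r : R) : 0 < r ->
  (forall y, `|y - x| < r -> differentiable f y) ->
  differentiable (fun y => 'D_h f y) x ->
  (forall y, `|y - x| < r -> f y <= f x) ->
  'D_h (fun y => 'D_h f y) x <= 0.
Proof.
move=> r0 df ddf fmax; rewrite leNgt; apply/negP => a0.
set a := 'D_h _ x in a0.
have [d d0 Hd] := near_line x h r0.
have dline (t : R) : `|t| < d -> is_derive t 1 (fun s => f (x + s *: h)) ('D_h f (x + t *: h)).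
  by move=> td; apply/is_derive_direction/df/Hd.
have x0 : x + 0 *: h = x by rewrite scale0r addr0.
have dN : - d < 0 by rewrite oppr_lt0.
have in_d (t : R) : t \in `]- d, d[%R -> `|t| < d.
  by rewrite in_itv /= => /andP[? ?]; rewrite ltr_norml; apply/andP.
have D0 : 'D_h f x = 0.
  have [||||_ <-] := @derive1_at_max R (fun s => f (x + s *: h)) (- d) d 0.
  - by lra.
  - by move=> t /in_d /dline [].
  - by rewrite in_itv /= dN d0.
  - by move=> t /in_d td; rewrite x0; apply/fmax/Hd.
  have [|_ ->] := dline 0; first by rewrite normr0.
  by rewrite x0.
have [e e0 He] : exists2 e, 0 < e & forall t, 0 < t < e -> 0 < 'D_h f (x + t *: h).
  pose p y := 'D_h f y.
  have fr : frechet p x ('D_(1, 0) p x) ('D_(0, 1) p x) by apply/frechetP.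
  have k0 : 0 < `|h| + 1 by rewrite ltr_wpDl.
  have k1 : 0 < a / 2 / (`|h| + 1) by rewrite !divr_gt0.
  have [e e0 He] := fr _ k1.
  exists (e / (`|h| + 1)); first by rewrite divr_gt0.
  move=> t /andP[t0 te].
  have th : `|t *: h| <= t * (`|h| + 1).
    by rewrite normrZ gtr0_norm // ler_wpM2l ?(ltW t0) //; lra.
  have /He : `|t *: h| < e by apply: le_lt_trans th _; rewrite -ltr_pdivlMr.
  rewrite {2}/p D0 subr0 => /le_trans H.
  have {}H := H _ (ler_wpM2l (ltW k1) th).
  have aE : 'D_(1, 0) p x * (t *: h).1 + 'D_(0, 1) p x * (t *: h).2 = t * a.
    have -> : a = 'D_(1, 0) p x * h.1 + 'D_(0, 1) p x * h.2 by exact: (derive_coord h ddf).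
    move: ('D_(1, 0) p x) ('D_(0, 1) p x) => u v.
    by rewrite /= /GRing.scale /=; ring.
  have gen (b k u : R) : k != 0 -> b / 2 / k * (u * k) = u * b / 2.
    by move=> k_neq0; field.
  rewrite aE (gen a (`|h| + 1) t (lt0r_neq0 k0)) in H; move: H; rewrite ler_norml => /andP[H _]; rewrite -/(p _).
  have ta0 : 0 < t * a by rewrite mulr_gt0.
  exact: (pos_of_half_close H ta0).
(* The increment t is small enough for the local maximum and for positivity of the
   derivative. *)
pose t := Num.min d e / 2.
have m0 : 0 < Num.min d e by rewrite lt_min d0.
have t0 : 0 < t by rewrite divr_gt0.
have /andP[td te] : (t < d) && (t < e) by rewrite -lt_min /t; lra.
have in_t (u : R) : 0 <= u <= t -> `|u| < d.
  by move=> /andP[u0 ut]; rewrite ger0_norm //; lra.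
have [||c cI] := @MVT R (fun s => f (x + s *: h)) (fun s => 'D_h f (x + s *: h)) 0 t t0.
- by move=> u; rewrite in_itv /= => /andP[u0 ut]; apply/dline/in_t; rewrite !ltW.
- apply: derivable_within_continuous => u; rewrite in_itv /= => ut.
  by have [] := dline u (in_t u ut).
rewrite x0 subr0 => E.
have c0 : 0 < 'D_h f (x + c *: h).
  by apply: He; move: cI; rewrite in_itv /= => /andP[? ?]; apply/andP; split; lra.
have : f (x + t *: h) <= f x by apply/fmax/Hd; rewrite gtr0_norm.
have : 0 < 'D_h f (x + c *: h) * t by rewrite mulr_gt0.
by lra.
Qed.

Lemma wirtinger_laplacian (F : R * R -> C) D x : open D -> D x -> cndiff 2 D F ->
  wirtinger false (wirtinger true F) x = 4^-1 *
   (cderive (1, 0) (cderive (1, 0) F) x + cderive (0, 1) (cderive (0, 1) F) x).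
Proof.
move=> oD Dx dF.
have [/cndiff_cdiff f1 /cndiff_cdiff f2] := cndiff_cderive oD dF.
have Hh h : cderive h (wirtinger true F) x = 2^-1 * (cderive h (cderive (1, 0) F) x +
    wsign true * cderive h (cderive (0, 1) F) x).
  have c1 := cdiff_cst (@wsign R true) x; have c2 := cdiff_cst (2^-1 : C) x.
  have m1 := cdiffM c1 (f2 x Dx).
  rewrite (_ : wirtinger true F = fun x =>
    2^-1 * (cderive (1, 0) F x + wsign true * cderive (0, 1) F x)); last first.
    by apply/funext => y; rewrite wirtingerE.
  rewrite [LHS](cderiveM h c2 (cdiffD (f1 x Dx) m1)) cderive_cst mul0r add0r.
  by rewrite (cderiveD h (f1 x Dx) m1) (cderiveM h c1 (f2 x Dx)) cderive_cst mul0r add0r.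
rewrite wirtingerE !Hh (cderiveC oD Dx dF).
have i2 : wsign false * wsign false = -1 :> C by rewrite -expr2; exact: sqr_i.
rewrite (_ : wsign true = - wsign false :> C) //.
move: (wsign false) i2 (cderive _ _ x) (cderive _ _ x) (cderive _ _ x) => i i2 a b c.
transitivity (4^-1 * (c - (i * i) * a)); last by rewrite i2 mulN1r opprK.
by field.
Qed.

(** Four times this mixed Wirtinger derivative is the Laplacian, whose two terms are
    nonpositive at a maximum of the real part. *)
Lemma Re_laplacian_max (F : R * R -> C) D x : open D -> D x -> cndiff 2 D F ->
  (forall y, D y -> complex.Re (F y) <= complex.Re (F x)) ->
  complex.Re (wirtinger false (wirtinger true F) x) <= 0.
Proof.
move=> oD Dx dF Fmax; rewrite (wirtinger_laplacian oD Dx dF).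
have /nbhs_normP [r /= r0 Hr] := open_nbhs_nbhs (conj oD Dx).
have Hr' y : `|y - x| < r -> D y by move=> H; apply: Hr; rewrite /= distrC.
have [[df d1 d2] _] := dF.
have key h : differentiable (fun y => 'D_h (fun y => complex.Re (F y)) y) x ->
    complex.Re (cderive h (cderive h F) x) <= 0.
  move=> dd; rewrite cderiveE /=.
  rewrite (_ : (fun y => complex.Re (cderive h F y)) = fun y => 'D_h (fun y => complex.Re (F y)) y).
    apply: (second_derivative_test r0) => //; last by move=> y /Hr'; exact: Fmax.
    by move=> y /Hr'; exact: df.
  by apply/funext => y; rewrite cderiveE.
have k1 : complex.Re (cderive (1, 0) (cderive (1, 0) F) x) <= 0.
  by apply: key; case: d1 => d1 _ _; exact: d1.
have k2 : complex.Re (cderive (0, 1) (cderive (0, 1) F) x) <= 0.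
  by apply: key; case: d2 => d2 _ _; exact: d2.
move: (cderive _ (cderive _ F) x) k1 (cderive _ (cderive _ F) x) k2 => u u0 v v0.
have : u + v = 4^-1 * (u + v) + 4^-1 * (u + v) + 4^-1 * (u + v) + 4^-1 * (u + v) by field.
by move=> /(congr1 (@complex.Re R)); rewrite !ReD => H; lra.
Qed.

End SecondDerivativeTest.

(** * Holomorphic pairs of projectors and their local form *)

Section HoloPair.
Context {R : realType} {N : nat}.
Local Notation C := R[i].
Local Notation M := 'M[C]_N.
Implicit Types (K P : mxfun R N) (x y : R * R) (s t : bool) (D : set (R * R)).

(** K and V = K + P project on an increasing pair of subbundles whose quotient is the
    line of P. With d = dd s and d' = dd (~~ s), the conditions d' V V = 0 and d' K K
    = 0 say that both are holomorphic with respect to d', and the last condition says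
    that d maps sections of K into V. *)
Record holo_pair s K P : Prop := HoloPair {
  hp_smoothK : mndiff 2 setT K;
  hp_smoothP : mndiff 2 setT P;
  hp_idem : forall x, K x *m K x = K x;
  hp_adj : forall x, adjoint (K x) = K x;
  hp_rank1 : forall x, rank1_projector (P x);
  hp_orth : forall x, K x *m P x = 0;
  hp_subV : forall x, dd (~~ s) (fun y => K y + P y) x *m (K x + P x) = 0;
  hp_subW : forall x, dd (~~ s) K x *m K x = 0;
  hp_next : forall x, (1%:M - (K x + P x)) *m dd s K x *m K x = 0 }.

Section Facts.
Variables (s : bool) (K P : mxfun R N).
Hypothesis hp : holo_pair s K P.
Let Pi : mxfun R N := fun y => K y + P y.
Let A : mxfun R N := fun y => dd s P y *m P y.

Lemma hp_mdiffK x : mdiff K x. Proof. exact: mndiff_mdiff (hp_smoothK hp) I. Qed.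
Lemma hp_mdiffP x : mdiff P x. Proof. exact: mndiff_mdiff (hp_smoothP hp) I. Qed.
Lemma hp_mdiffPi x : mdiff Pi x. Proof. exact: mdiffD (hp_mdiffK x) (hp_mdiffP x). Qed.
Lemma hp_smoothPi : mndiff 2 setT Pi.
Proof. exact: mndiffD openT (hp_smoothK hp) (hp_smoothP hp). Qed.

Lemma hp_PP x : P x *m P x = P x. Proof. by case: (hp_rank1 hp x). Qed.
Lemma hp_aP x : adjoint (P x) = P x. Proof. by case: (hp_rank1 hp x). Qed.
Lemma hp_PK x : P x *m K x = 0.
Proof. by rewrite -hp_aP -(hp_adj hp) -adjointM (hp_orth hp) adjoint0. Qed.
Lemma hp_PiPi x : Pi x *m Pi x = Pi x.
Proof.
by rewrite /Pi mulmxDl !mulmxDr (hp_idem hp) hp_PP hp_PK (hp_orth hp) addr0 add0r.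
Qed.
Lemma hp_aPi x : adjoint (Pi x) = Pi x.
Proof. by rewrite /Pi adjointD (hp_adj hp) hp_aP. Qed.
Lemma hp_PiP x : Pi x *m P x = P x.
Proof. by rewrite /Pi mulmxDl (hp_orth hp) hp_PP add0r. Qed.
Lemma hp_PPi x : P x *m Pi x = P x.
Proof. by rewrite /Pi mulmxDr hp_PK hp_PP add0r. Qed.
Lemma hp_PiK x : Pi x *m K x = K x.
Proof. by rewrite /Pi mulmxDl (hp_idem hp) hp_PK addr0. Qed.

Lemma hp_ddKP t x : dd t K x *m P x = - (K x *m dd t P x).
Proof.
have := ddM t (hp_mdiffK x) (hp_mdiffP x).
rewrite (_ : (fun y => K y *m P y) = fun=> 0); last first.
  by apply/funext => y; exact: (hp_orth hp).
by rewrite dd_cst => /esym/eqP; rewrite addr_eq0 => /eqP.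
Qed.

Lemma hp_ddP t x : dd t P x = dd t P x *m P x + P x *m dd t P x.
Proof.
rewrite -(ddM t (hp_mdiffP x) (hp_mdiffP x)); congr (dd t _ x).
by apply/funext => y; rewrite hp_PP.
Qed.

Lemma hp_ddK t x : dd t K x = dd t K x *m K x + K x *m dd t K x.
Proof.
rewrite -(ddM t (hp_mdiffK x) (hp_mdiffK x)); congr (dd t _ x).
by apply/funext => y; rewrite (hp_idem hp).
Qed.

Lemma hp_ddPi t x : dd t Pi x = dd t Pi x *m Pi x + Pi x *m dd t Pi x.
Proof.
rewrite -(ddM t (hp_mdiffPi x) (hp_mdiffPi x)); congr (dd t _ x).
by apply/funext => y; rewrite hp_PiPi.
Qed.

Lemma hp_ddPiD t x : dd t Pi x = dd t K x + dd t P x.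
Proof. exact: ddD (hp_mdiffK x) (hp_mdiffP x). Qed.

Lemma hp_PdPP t x : P x *m dd t P x *m P x = 0.
Proof.
have := congr1 (fun X => P x *m X) (hp_ddP t x).
rewrite mulmxDr !mulmxA hp_PP -[X in X = _]add0r => /addIr.
by rewrite -mulmxA.
Qed.

Lemma hp_addP x : adjoint (dd s P x) = dd (~~ s) P x.
Proof.
rewrite -{1}[s]negbK -(dd_adjoint _ (hp_mdiffP x)); congr (dd _ _ x).
by apply/funext => y; rewrite hp_aP.
Qed.

Lemma hp_KddK x : K x *m dd s K x = 0.
Proof.
have -> : dd s K x = adjoint (dd (~~ s) K x).
  rewrite -(dd_adjoint s (hp_mdiffK x)); congr (dd _ _ x).
  by apply/funext => y; rewrite (hp_adj hp).
by rewrite -{1}(hp_adj hp) -adjointM (hp_subW hp) adjoint0.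
Qed.

Lemma hp_PA x : P x *m A x = 0.
Proof. by rewrite /A mulmxA hp_PdPP. Qed.

Lemma hp_KA x : K x *m A x = 0.
Proof.
rewrite /A mulmxA -[K x *m dd s P x]opprK -hp_ddKP hp_ddK hp_KddK addr0.
by rewrite -(mulmxA _ (K x)) (hp_orth hp) mulmx0 oppr0 mul0mx.
Qed.

Lemma hp_PiA x : Pi x *m A x = 0.
Proof. by rewrite /Pi mulmxDl hp_KA hp_PA addr0. Qed.

Lemma hp_AP x : A x *m P x = A x.
Proof. by rewrite /A -mulmxA hp_PP. Qed.

Lemma hp_APi x : A x *m Pi x = A x.
Proof. by rewrite /A -mulmxA hp_PPi. Qed.

Lemma hp_subV_flip x : Pi x *m dd (~~ s) Pi x = dd (~~ s) Pi x.
Proof. by rewrite [RHS]hp_ddPi (hp_subV hp) add0r. Qed.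

Lemma hp_coPi (X : M) x : (1%:M - Pi x) *m (Pi x *m X) = 0.
Proof. by rewrite mulmxA mulmxBl mul1mx hp_PiPi subrr mul0mx. Qed.

(** Differentiating a section of V in the direction d leaves V only through its
    component along P. *)
Lemma hp_second_form (X : M) x : Pi x *m X = X -> (1%:M - Pi x) *m dd s Pi x *m X = A x *m X.
Proof.
move=> PX; have PXE : K x *m X + P x *m X = X by rewrite -mulmxDl.
rewrite hp_ddPiD mulmxDr mulmxDl -{1}PXE [X in X + _]mulmxDr.
rewrite [X in X + _ + _]mulmxA (hp_next hp) mul0mx add0r.
have -> : (1%:M - Pi x) *m dd s K x *m (P x *m X) = 0.
  rewrite mulmxA -(mulmxA _ _ (P x)) hp_ddKP mulmxN.
  by rewrite -(hp_PiK x) -(mulmxA (Pi x)) hp_coPi oppr0 mul0mx.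
rewrite add0r hp_ddP mulmxDr mulmxDl -/(A x).
have -> : (1%:M - Pi x) *m (P x *m dd s P x) = 0.
  by rewrite -(hp_PiP x) -(mulmxA (Pi x)) hp_coPi.
by rewrite mul0mx addr0 mulmxBl mul1mx hp_PiA subr0.
Qed.

End Facts.

(** Either the numerator of the ladder vanishes near x0, or it is a scalar function
    rho, nonzero off x0, times a nonvanishing w. The last clause says that d' w stays
    in the sum of V and the range of w. *)
Definition local_factor s K P x0 : Prop :=
  {near x0, forall y, dd s P y *m P y = 0} \/
  exists (D : set (R * R)) (rho : R * R -> C) (w : mxfun R N),
    [/\ open D, D x0, mndiff 2 D w, forall y, D y -> w y != 0 &
        forall y, D y -> dd s P y *m P y = rho y *: w y] /\
    [/\ forall y, D y -> y != x0 -> rho y != 0,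
        forall y, D y -> w y *m P y = w y,
        forall y, D y -> (K y + P y) *m w y = 0 &
        forall y, D y -> exists X : M,
          dd (~~ s) w y = - (dd (~~ s) (fun y => K y + P y) y *m w y) + w y *m X].

Lemma mdiff_entry_ccont (B : mxfun R N) x j k : mdiff B x -> ccont (fun y => B y j k) x.
Proof. by move=> dB; apply: cdiff_ccont. Qed.

Lemma mdiff_eq (B B' : mxfun R N) x D : open D -> D x -> mdiff B x -> mdiff B' x ->
  (forall y, D y -> y != x -> B y = B' y) -> B x = B' x.
Proof.
move=> oD Dx dB dB' E; apply/matrixP => j k.
apply: (@ccont_eq _ (fun y => B y j k) (fun y => B' y j k) x D) => //.
- exact: mdiff_entry_ccont.
- exact: mdiff_entry_ccont.
- by move=> y Dy yx; rewrite E.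
Qed.

Lemma near_matrix x (Q : 'I_N -> 'I_N -> R * R -> Prop) :
  (forall j k, {near x, forall y, Q j k y}) -> {near x, forall y, forall j k, Q j k y}.
Proof.
move=> H; suff : \forall y \near x, forall jk : 'I_N * 'I_N, Q jk.1 jk.2 y.
  by move=> H2; apply: filterS H2 => y Hy j k; exact: (Hy (j, k)).
have := @filter_forall _ _ (fun jk : 'I_N * 'I_N => [set y | Q jk.1 jk.2 y]) (nbhs x) _.
by apply => -[j k]; exact: H.
Qed.

Lemma open_shrink_neq0 (B : mxfun R N) x D : open D -> D x -> mndiff 1 D B -> B x != 0 ->
  exists D', [/\ open D', D' x, D' `<=` D & forall y, D' y -> B y != 0].
Proof.
move=> oD Dx dB Bx.
have [j [k Bjk]] : exists j k, B x j k != 0.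
  apply: contrapT => H; move/eqP: Bx; apply; apply/matrixP => j k; rewrite mxE.
  by apply/eqP/negPn/negP => H'; apply: H; exists j, k.
exists (D `&` [set y | B y j k != 0]); split.
- apply: open_ccont_neq0 => // y Dy; apply: mdiff_entry_ccont; exact: mndiff_mdiff dB Dy.
- by split.
- by move=> y; case.
- by move=> y [_ /=]; apply: contraNneq => ->; rewrite mxE.
Qed.

(** The exponent is the smallest order of vanishing among the entries. *)
Lemma matrix_hol_divide (H : mxfun R N) D a : open D -> D a -> mndiff 2 D H ->
  (forall y, D y -> dd false H y = 0) ->
  {near a, forall y, H y = 0} \/
  exists n (G : mxfun R N), [/\ forall m, mndiff m D G, forall y, D y -> dd false G y = 0,
    forall y, D y -> H y = zeta (y - a) ^+ n *: G y & G a != 0].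
Proof.
move=> oD Da dH cr.
have crE j k y : D y -> wirtinger false (fun y => H y j k) y = 0.
  by move=> Dy; rewrite -(ddE false H) cr // mxE.
pose c j k := sval (cid (hol_divide oD Da (dH j k) (crE j k))).
have [c0 cn] : (forall j k, (forall m, c j k m = 0) -> {near a, forall y, H y j k = 0}) /\
   forall j k n, (forall m, (m < n)%N -> c j k m = 0) ->
     exists G, [/\ forall m, cndiff m D G, forall y, D y -> wirtinger false G y = 0,
        forall y, D y -> H y j k = zeta (y - a) ^+ n * G y & G a = c j k n].
  by split=> j k; rewrite /c; case: (cid _) => /= ? [].
have [[n Hn]|Hn] := pselect (exists n, exists j k, c j k n != 0); last first.
  left; have : {near a, forall y, forall j k, H y j k = 0}.
    apply: near_matrix => j k; apply: c0 => m; apply/eqP/negPn/negP => cm.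
    by apply: Hn; exists m, j, k.
  by move=> H2; apply: filterS H2 => y Hy; apply/matrixP => j k; rewrite Hy mxE.
right.
have ex : exists n, `[< exists j k, c j k n != 0 >] by exists n; apply/asboolP.
case: (ex_minnP ex) => {n Hn}n /asboolP [j0 [k0 cjk]] nmin.
have small j k m : (m < n)%N -> c j k m = 0.
  move=> mn; apply/eqP/negPn/negP => cm; have := nmin m.
  by rewrite leqNgt mn => /(_ _)/negP; apply => //; apply/asboolP; exists j, k.
pose g j k := sval (cid (cn j k n (small j k))).
have gP j k : [/\ forall m, cndiff m D (g j k), forall y, D y -> wirtinger false (g j k) y = 0,
    forall y, D y -> H y j k = zeta (y - a) ^+ n * g j k y & g j k a = c j k n].
  by rewrite /g; case: (cid _).
exists n, (fun y => \matrix_(j, k) g j k y).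
have gE j k : (fun y => (\matrix_(j, k) g j k y : M) j k) = g j k.
  by apply/funext => y; rewrite mxE.
split.
- by move=> m j k; rewrite gE; have [] := gP j k.
- by move=> y Dy; apply/matrixP => j k; rewrite ddE gE mxE; have [_ ->] := gP j k.
- by move=> y Dy; apply/matrixP => j k; rewrite !mxE; have [_ _ ->] := gP j k.
- apply: contraNneq cjk => /matrixP /(_ j0 k0); rewrite !mxE.
  by have [_ _ _ ->] := gP j0 k0 => ->.
Qed.

(** Near x0 the idempotent b with the range of V and the kernel of V at x0 is
    holomorphic, so H = (1 - b) d b is holomorphic as well; modulo V it equals A b
    with A = d P P. Dividing H by its zero at x0 gives w. *)
Lemma local_factor_true K P x0 : holo_pair true K P -> local_factor true K P x0.
Proof.
move=> hp; pose Pi y := K y + P y; pose P0 := Pi x0; pose A y := dd true P y *m P y.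
have PiPi y : Pi y *m Pi y = Pi y := hp_PiPi hp y.
have PiP y : Pi y *m P y = P y := hp_PiP hp y.
have AP y : A y *m P y = A y := hp_AP hp y.
have P00 : P0 *m P0 = P0 := PiPi x0.
(* L y intertwines the projectors at y and at x0 and is the identity at x0, hence
   invertible nearby. *)
pose L y := P0 *m Pi y + (1%:M - P0) *m (1%:M - Pi y).
have sPi := hp_smoothPi hp.
have sL : mndiff 2 setT L.
  apply: mndiffD; first exact: openT.
    by apply: mndiffM; [exact: openT|exact: mndiff_cst openT|exact: sPi].
  apply: mndiffM; [exact: openT|exact: mndiff_cst openT|].
  by apply: mndiffB; [exact: openT|exact: mndiff_cst openT|exact: sPi].
pose D : set (R * R) := [set: R * R] `&` [set y | \det (L y) != 0].
have oD : open D.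
  apply: open_ccont_neq0; first exact: openT.
  move=> y _; apply/cdiff_ccont.
  have := cndiff_det openT sL; move=> /cndiff_cdiff; exact.
have uL y : D y -> L y \in unitmx by move=> [_ /=]; rewrite unitmxE unitfE.
have L0 : L x0 = 1%:M.
  rewrite /L -/P0 P00 mulmxBl mul1mx mulmxBr mulmx1 P00 subrr subr0.
  by rewrite addrC subrK.
have Dx0 : D x0 by split=> //=; rewrite L0 det1 oner_neq0.
(* b y has the range of Pi y and the kernel of P0. *)
pose b y := invmx (L y) *m P0.
have sb : mndiff 2 D b.
  apply: mndiffM => //; last exact: mndiff_cst.
  by apply: mndiff_inv => //; apply: mndiff_subset sL.
have coP0 : P0 *m (1%:M - P0) = 0 by rewrite mulmxBr mulmx1 P00 subrr.
have coPi1 y : (1%:M - Pi y) *m Pi y = 0 by rewrite mulmxBl mul1mx PiPi subrr.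
have LPi y : L y *m Pi y = P0 *m L y.
  rewrite /L [LHS]mulmxDl [RHS]mulmxDr -(mulmxA P0) PiPi -(mulmxA (1%:M - P0)) coPi1 mulmx0.
  by rewrite !(mulmxA P0) P00 coP0 mul0mx.
have PiV y : D y -> Pi y *m invmx (L y) = invmx (L y) *m P0.
  move=> Dy; rewrite -[LHS]mul1mx -(mulVmx (uL y Dy)) -!mulmxA.
  by rewrite [L y *m _]mulmxA LPi -mulmxA (mulmxV (uL y Dy)) mulmx1.
have bPi y : D y -> b y *m Pi y = Pi y.
  move=> Dy; rewrite /b -mulmxA.
  have -> : P0 *m Pi y = L y *m Pi y.
    by rewrite LPi /L mulmxDr !(mulmxA P0) P00 coP0 mul0mx addr0.
  by rewrite mulmxA (mulVmx (uL y Dy)) mul1mx.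
have Pib y : D y -> Pi y *m b y = b y.
  by move=> Dy; rewrite /b mulmxA PiV // -mulmxA P00.
have Lb y : D y -> L y *m b y = P0 by move=> Dy; rewrite /b mulmxA (mulmxV (uL y Dy)) mul1mx.
have Lfix y (X : M) : D y -> Pi y *m X = X -> L y *m X = P0 *m X.
  move=> Dy PX; rewrite /L mulmxDl -!mulmxA mulmxBl mul1mx PX.
  by rewrite mulmxBl mul1mx PX subrr !mulmx0 subr0 addr0.
have P0b y : D y -> P0 *m b y = P0 by move=> Dy; rewrite -(Lfix y (b y) Dy (Pib y Dy)) Lb.
have bb y : D y -> b y *m b y = b y by move=> Dy; rewrite -{2}Pib // mulmxA bPi // Pib.
have mb y : D y -> mdiff b y by move=> Dy; exact: mndiff_mdiff sb Dy.
have nearD y : D y -> nbhs y D by move=> Dy; exact: open_nbhs_nbhs.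
have ddbPi t y : D y -> dd t b y = dd t Pi y *m b y + Pi y *m dd t b y.
  move=> Dy; rewrite -(ddM t (hp_mdiffPi hp y) (mb y Dy)); apply: dd_near.
  by apply: filterS (nearD y Dy) => z Dz; rewrite Pib.
have crb y : D y -> dd false b y = 0.
  move=> Dy; have cPi : Pi y *m dd false b y = dd false b y.
    rewrite [RHS]ddbPi // -(Pib y Dy) mulmxA.
    by have := hp_subV hp y; rewrite -/(Pi y) -/Pi /= => ->; rewrite mul0mx add0r.
  have c0 : P0 *m dd false b y = 0.
    have := ddM false (mdiff_cst P0 y) (mb y Dy).
    rewrite dd_cst mul0mx add0r => <-.
    rewrite -(dd_cst false P0 y); apply: dd_near.
    by apply: filterS (nearD y Dy) => z Dz; rewrite P0b.
  by rewrite -[LHS]mul1mx -(mulVmx (uL y Dy)) -mulmxA (Lfix y _ Dy cPi) c0 mulmx0.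
have sbn n : mndiff n D b.
  move=> j k; apply: analytic_smooth => // y Dy.
  apply: (@cr_analytic _ D) => // z Dz.
  by rewrite -(ddE false b) crb // mxE.
pose H y := (1%:M - b y) *m dd true b y.
have m1b y : D y -> mdiff (fun y => 1%:M - b y) y.
  by move=> Dy; apply: mdiffB; [exact: mdiff_cst|exact: mb].
have mdb y : D y -> mdiff (dd true b) y.
  by move=> Dy; apply: (mndiff_mdiff (mndiff_dd true oD (sbn 2)) Dy).
have sH : mndiff 2 D H.
  apply: mndiffM => //; first by apply: mndiffB => //; exact: mndiff_cst.
  exact: mndiff_dd.
have crH y : D y -> dd false H y = 0.
  move=> Dy; rewrite /H (ddM false (m1b y Dy) (mdb y Dy)).
  rewrite (ddB false (mdiff_cst 1%:M y) (mb y Dy)) dd_cst (crb y Dy) subr0 mul0mx add0r.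
  rewrite (ddC _ _ oD Dy sb) -(mulmx0 _ (1%:M - b y)); congr (_ *m _).
  rewrite -(dd_cst true 0 y); apply: dd_near.
  by apply: filterS (nearD y Dy) => z Dz; rewrite crb.
have coPi_b y : D y -> (1%:M - Pi y) *m (1%:M - b y) = 1%:M - Pi y.
  by move=> Dy; rewrite mulmxBr mulmx1 mulmxBl mul1mx Pib // subrr subr0.
have PiH y : D y -> (1%:M - Pi y) *m H y = A y *m b y.
  move=> Dy; rewrite /H mulmxA coPi_b // ddbPi // mulmxDr mulmxA.
  by rewrite (hp_coPi hp) addr0 (hp_second_form hp) // Pib.
have bP y : D y -> b y *m P y = P y.
  by move=> Dy; rewrite -{1}(PiP y) mulmxA bPi // PiP.
have AHP y : D y -> A y = (1%:M - Pi y) *m H y *m P y.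
  by move=> Dy; rewrite PiH // -mulmxA bP // AP.
have [H0|[n [G [sG crG HG Ga]]]] := matrix_hol_divide oD Dx0 sH crH.
  left; have : nbhs x0 [set y | D y /\ H y = 0] by apply: filterI => //; exact: nearD.
  by move=> H2; apply: filterS H2 => y [Dy Hy]; rewrite -/(A y) AHP // Hy mulmx0 mul0mx.
right.
pose z y := zeta (y - x0) ^+ n.
have z0 y : y != x0 -> z y != 0 by move=> yx; rewrite expf_neq0 // zeta_eq0 subr_eq0.
(* Y is A b divided by the power z; identities for Y hold off x0 and extend to x0 by
   continuity. *)
pose Y y := (1%:M - Pi y) *m G y.
have mPi y : mdiff Pi y by exact: (hp_mdiffPi hp y).
have mP y : mdiff P y by exact: (hp_mdiffP hp y).
have mG y : D y -> mdiff G y by move=> Dy; exact: mndiff_mdiff (sG 1%N) Dy.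
have m1Pi y : mdiff (fun y => 1%:M - Pi y) y by apply: mdiffB => //; exact: mdiff_cst.
have mY y : D y -> mdiff Y y by move=> Dy; apply: mdiffM => //; exact: mG.
have zY y : D y -> z y *: Y y = A y *m b y.
  by move=> Dy; rewrite /Y scalemxAr -HG // PiH.
have YPb y : D y -> Y y = Y y *m P y *m b y.
  have off y0 : D y0 -> y0 != x0 -> Y y0 = Y y0 *m P y0 *m b y0.
    move=> Dy yx; apply: (scalerI (z0 _ yx)).
    rewrite (scalemxAl (z y0) (Y y0 *m P y0) (b y0)) (scalemxAl (z y0) (Y y0) (P y0)) zY // -(mulmxA (A y0)) bP //.
    by rewrite AP.
  move=> Dy; have [->|yx] := eqVneq y x0; last exact: off.
  apply: (mdiff_eq oD Dx0 (mY _ Dx0) _ off).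
  by apply: mdiffM; [apply: mdiffM => //; exact: mY|exact: mb].
have b0 : b x0 = P0 by rewrite /b L0 invmx1 mul1mx.
have bG0 : b x0 *m G x0 = 0.
  apply: (mdiff_eq oD Dx0 (mdiffM (mb _ Dx0) (mG _ Dx0)) (mdiff_cst (0 : M) x0)).
  move=> y Dy yx; apply: (scalerI (z0 _ yx)); rewrite scalemxAr -HG // scaler0.
  by rewrite /H mulmxA mulmxBr mulmx1 bb // subrr mul0mx.
have Y0 : Y x0 = G x0 by rewrite /Y mulmxBl mul1mx -/P0 -b0 bG0 subr0.
pose w y := Y y *m P y.
have sw : mndiff 2 D w.
  apply: mndiffM => //; last by apply: mndiff_subset (hp_smoothP hp).
  apply: mndiffM => //; apply: mndiffB => //; first exact: mndiff_cst.
  by apply: mndiff_subset sPi.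
have w0 : w x0 != 0.
  by apply: contraNneq Ga => w0; rewrite -Y0 YPb // -/(w x0) w0 mul0mx.
have [D' [oD' D'x sD' wD']] := open_shrink_neq0 oD Dx0 (mndiff_le (isT : 1 <= 2)%N sw) w0.
exists D', z, w; split; split=> //.
- exact: mndiff_subset sD' sw.
- move=> y /sD' Dy; rewrite -/(A y) /w (scalemxAl (z y) (Y y) (P y)) zY //.
  by rewrite -(mulmxA (A y)) bP // AP.
- by move=> y D'y yx; exact: z0.
- by move=> y _; rewrite /w -mulmxA (hp_PP hp).
- by move=> y _; rewrite /w /Y !mulmxA mulmxBr mulmx1 -/(Pi y) PiPi subrr !mul0mx.
- move=> y /sD' Dy; exists (b y *m dd false P y) => /=.
  have mPy := mP y; have mYy := mY y Dy; have mGy := mG y Dy; have m1 := m1Pi y.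
  rewrite /w (ddM _ mYy mPy) /Y (ddM _ m1 mGy) crG // mulmx0 addr0.
  rewrite (ddB _ (mdiff_cst 1%:M y) (mPi y)) dd_cst sub0r.
  have -> : Y y *m P y *m (b y *m dd false P y) = Y y *m dd false P y.
    by rewrite mulmxA -YPb.
  congr (_ + _); rewrite !mulNmx; congr (- _).
  have -> : dd false (fun y => K y + P y) y *m (Y y *m P y) =
      dd false Pi y *m (1%:M - Pi y) *m G y *m P y by rewrite /Y !mulmxA.
  by rewrite mulmxBr mulmx1 (hp_subV hp y) subr0.
Qed.

End HoloPair.

(** * The ladder acts on holomorphic pairs *)

Section Conjugation.
Context {R : realType} {N : nat}.
Local Notation C := R[i].
Local Notation M := 'M[C]_N.
Implicit Types (A K P : mxfun R N) (x y : R * R) (s t : bool) (D : set (R * R)).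

(** Entrywise conjugation exchanges the two operators d_+ and d_-, hence the two kinds
    of pairs. *)
Definition mconj (X : M) : M := map_mx conjc X.

Lemma mconjE (X : M) j k : mconj X j k = conjc (X j k).
Proof. by rewrite mxE. Qed.
Lemma mconjM (X Y : M) : mconj (X *m Y) = mconj X *m mconj Y.
Proof. exact: map_mxM. Qed.
Lemma mconjD (X Y : M) : mconj (X + Y) = mconj X + mconj Y.
Proof. exact: map_mxD. Qed.
Lemma mconjN (X : M) : mconj (- X) = - mconj X.
Proof. exact: map_mxN. Qed.
Lemma mconj0 : mconj 0 = 0.
Proof. by apply/matrixP => j k; rewrite mconjE !mxE conjc0. Qed.
Lemma mconj1 : mconj 1%:M = 1%:M.
Proof. by apply/matrixP => j k; rewrite mconjE !mxE conjc_nat. Qed.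
Lemma mconjK (X : M) : mconj (mconj X) = X.
Proof. by apply/matrixP => j k; rewrite !mconjE conjcK. Qed.
Lemma mconjZ (c : C) (X : M) : mconj (c *: X) = conjc c *: mconj X.
Proof. by apply/matrixP => j k; rewrite !(mconjE, mxE) conjcM. Qed.
Lemma mconj_adjoint (X : M) : mconj (adjoint X) = adjoint (mconj X).
Proof. by apply/matrixP => j k; rewrite !(adjointE, mconjE). Qed.
Lemma mconj_tr (X : M) : \tr (mconj X) = conjc (\tr X).
Proof. by rewrite /mxtrace rmorph_sum; apply: eq_bigr => j _; rewrite mxE. Qed.

Lemma dd_mconj s A x : mdiff A x -> dd s (fun y => mconj (A y)) x = mconj (dd (~~ s) A x).
Proof.
move=> dA; apply/matrixP => j k; rewrite mconjE !ddE -(wirtinger_conj _ (dA j k)).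
by congr (wirtinger s _ x); apply/funext => y; rewrite mconjE.
Qed.

Lemma mndiff_mconj n D A : open D -> mndiff n D A -> mndiff n D (fun y => mconj (A y)).
Proof.
move=> oD dA j k; apply: cndiff_eq (cndiff_conj oD (dA j k)) => // x _.
by rewrite mconjE.
Qed.

Lemma holo_pair_mconj s K P : holo_pair (~~ s) K P ->
  holo_pair s (fun y => mconj (K y)) (fun y => mconj (P y)).
Proof.
move=> hp; have mK := hp_mdiffK hp; have mP := hp_mdiffP hp; have mPi := hp_mdiffPi hp.
have PiE x : mconj (K x) + mconj (P x) = mconj (K x + P x) by rewrite mconjD.
split.
- exact: mndiff_mconj openT (hp_smoothK hp).
- exact: mndiff_mconj openT (hp_smoothP hp).
- by move=> x; rewrite -mconjM (hp_idem hp).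
- by move=> x; rewrite -mconj_adjoint (hp_adj hp).
- move=> x; have [PP aP tP] := hp_rank1 hp x; split.
  + by rewrite -mconjM PP.
  + by rewrite -mconj_adjoint aP.
  + by rewrite mconj_tr tP conjc1.
- by move=> x; rewrite -mconjM (hp_orth hp) mconj0.
- move=> x; rewrite (_ : (fun y => _) = fun y => mconj (K y + P y)); last first.
    by apply/funext => y; rewrite PiE.
  by rewrite PiE (dd_mconj _ (mPi x)) -mconjM (hp_subV hp) mconj0.
- by move=> x; rewrite (dd_mconj _ (mK x)) -mconjM (hp_subW hp) mconj0.
- move=> x; rewrite (dd_mconj _ (mK x)) -mconj1 PiE -mconjN -mconjD -!mconjM.
  by rewrite (hp_next hp) mconj0.
Qed.

Lemma local_factorP s K P x0 : holo_pair s K P -> local_factor s K P x0.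
Proof.
case: s => [|hp]; first exact: local_factor_true.
have mP := hp_mdiffP hp; have mPi := hp_mdiffPi hp.
have AE y : dd true (fun y => mconj (P y)) y *m mconj (P y) = mconj (dd false P y *m P y).
  by rewrite (dd_mconj _ (mP y)) mconjM.
have [H|[D [rho [w [[oD Dx0 sw w0 Aw] [r0 wP Piw dw]]]]]] :=
  local_factor_true x0 (@holo_pair_mconj true K P hp).
  left; apply: filterS H => y; rewrite AE => /(congr1 mconj).
  by rewrite mconjK mconj0.
right; exists D, (fun y => conjc (rho y)), (fun y => mconj (w y)).
split; split=> //.
- exact: mndiff_mconj.
- move=> y Dy; apply: contra (w0 y Dy) => /eqP /(congr1 mconj).
  by rewrite mconjK mconj0 => ->.
- move=> y Dy; have := Aw y Dy; rewrite AE => /(congr1 mconj).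
  by rewrite mconjK mconjZ.
- by move=> y Dy yx; rewrite conjc_eq0; exact: r0.
- move=> y Dy; have := wP y Dy => /(congr1 mconj).
  by rewrite mconjM mconjK.
- move=> y Dy; have := Piw y Dy => /(congr1 mconj).
  by rewrite mconjM mconjD !mconjK mconj0.
- move=> y Dy; have [X dX] := dw y Dy; exists (mconj X).
  have mw : mdiff w y by exact: mndiff_mdiff sw Dy.
  rewrite (dd_mconj _ mw) /= dX mconjD mconjN !mconjM; congr (- (_ *m _) + _).
  rewrite (_ : (fun y => mconj (K y) + mconj (P y)) = fun y => mconj (K y + P y)).
    by rewrite (dd_mconj _ (mPi y)) mconjK.
  by apply/funext => z; rewrite mconjD.
Qed.

End Conjugation.

Section LadderStep.
Context {R : realType} {N : nat}.
Local Notation C := R[i].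
Local Notation M := 'M[C]_N.
Implicit Types (A K P : mxfun R N) (x y : R * R) (s t : bool) (D : set (R * R)).

Lemma lim_within_eq (f g : R * R -> R) (E D : set (R * R)) x : open D -> D x ->
  {for x, continuous g} -> closure E x -> (forall y, D y -> E y -> f y = g y) ->
  lim (f @ within E (nbhs x)) = g x.
Proof.
move=> oD Dx cg clE fg.
have pf : ProperFilter (within E (nbhs x)) by exact: within_nbhs_proper.
apply: cvg_lim => //.
have cg' : g @ within E (nbhs x) --> g x by exact: cvg_within_filter.
apply: cvg_trans cg'; apply: near_eq_cvg.
have nD : nbhs x D by exact: open_nbhs_nbhs.
by rewrite near_withinE; apply: filterS nD => y Dy Ey; rewrite fg.
Qed.

Lemma closure_punctured (E D : set (R * R)) x : open D -> D x ->
  (forall y, D y -> y != x -> E y) -> closure E x.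
Proof.
move=> oD Dx H B nB; have nD : nbhs x D by exact: open_nbhs_nbhs.
have /nbhs_normP [d /= d0 Hd] : \forall y \near x, D y /\ B y by exact: filterI nD nB.
pose y := x + (d / 2, 0).
have yx : y - x = (d / 2, 0) by rewrite /y addrAC subrr add0r.
have n : `|(d / 2, 0) : R * R| = d / 2.
  by rewrite norm_pairE /= normr0 gtr0_norm ?divr_gt0 //; apply/max_idPl; rewrite divr_ge0 // ltW.
have [] := Hd y; first by rewrite /= distrC yx n; lra.
move=> Dy By; exists y; split=> //; apply: H => //.
by rewrite -subr_eq0 -normr_gt0 yx n divr_gt0.
Qed.

Section Step.
Variables (s : bool) (K P : mxfun R N).
Hypothesis hp : holo_pair s K P.
Let Pi : mxfun R N := fun y => K y + P y.
Let A : mxfun R N := fun y => dd s P y *m P y.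
Let Q : mxfun R N := ladder (dd s) (dd (~~ s)) P.

(** The numerator in the definition of the ladder is A A^* with A = d P P; the ladder
    is thus the projector on the range of A. *)
Lemma ladder_num x : dd s P x *m P x *m dd (~~ s) P x = A x *m adjoint (A x).
Proof.
by rewrite /A adjointM (hp_aP hp) (hp_addP hp) -[in LHS](hp_PP hp) !mulmxA.
Qed.

Hypothesis nonzero : ~ (forall x, A x = 0).

Lemma ladderE x : Q x = if A x != 0 then line_projector (A x) else
  mx_lim_within [set y | A y != 0] (fun y => line_projector (A y)) x.
Proof.
rewrite /Q /ladder; case: asboolP => [H|_].
  by case: nonzero => y; apply: mul_adjoint_eq0; rewrite -ladder_num.
have -> : (fun x => (\tr (dd s P x *m P x *m dd (~~ s) P x))^-1 *:
    (dd s P x *m P x *m dd (~~ s) P x)) = fun x => line_projector (A x).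
  by apply/funext => y; rewrite ladder_num.
have E y : (\tr (dd s P y *m P y *m dd (~~ s) P y) != 0) = (A y != 0).
  by rewrite ladder_num tr_mul_adjoint_eq0.
rewrite E ladder_num; case: ifP => // _; congr (mx_lim_within _ _ x).
by apply/seteqP; split => y /=; rewrite E.
Qed.

(** Where rho does not vanish the ladder is the projector on the range of w; at x0 the
    limit of these projectors is taken over a set that accumulates at x0. *)
Lemma ladder_local x0 (D : set (R * R)) (rho : R * R -> C) (w : mxfun R N) :
  open D -> D x0 -> mndiff 2 D w -> (forall y, D y -> w y != 0) ->
  (forall y, D y -> A y = rho y *: w y) -> (forall y, D y -> y != x0 -> rho y != 0) ->
  forall y, D y -> Q y = line_projector (w y).
Proof.
move=> oD Dx0 sw w0 Aw r0.
have reg y : D y -> rho y != 0 -> Q y = line_projector (w y).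
  by move=> Dy ry; rewrite ladderE Aw // scaler_eq0 negb_or ry w0 //= line_projectorZ.
move=> y Dy; have [->|yx] := eqVneq y x0; last by apply: reg => //; exact: r0.
have [rx|rx] := eqVneq (rho x0) 0; last exact: reg.
have lpD z : D z -> A z != 0 -> line_projector (A z) = line_projector (w z).
  by move=> Dz; rewrite Aw // scaler_eq0 negb_or => /andP[rz _]; rewrite line_projectorZ.
have clE : closure [set y | A y != 0] x0.
  apply: (closure_punctured oD Dx0) => z Dz zx /=.
  by rewrite Aw // scaler_eq0 negb_or w0 // r0.
have slp : mndiff 2 D (fun z => line_projector (w z)).
  have saw : mndiff 2 D (fun z => w z *m adjoint (w z)).
    by apply: mndiffM => //; exact: mndiff_adjoint.
  apply: mndiffZ => //; apply: cndiffV => //; last exact: cndiff_tr.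
  by move=> z Dz; rewrite tr_mul_adjoint_eq0 w0.
have cont j k : ccont (fun z => line_projector (w z) j k) x0.
  exact: cdiff_ccont (cndiff_cdiff (slp j k) Dx0).
rewrite ladderE Aw // rx scale0r eqxx /=.
apply/matrixP => j k; rewrite mxE; apply: complexP => /=.
  apply: (lim_within_eq oD Dx0 (ccont_Re (cont j k)) clE) => z Dz /= Az.
  by rewrite /re_entry lpD.
apply: (lim_within_eq oD Dx0 (ccont_Im (cont j k)) clE) => z Dz /= Az.
by rewrite /im_entry lpD.
Qed.

(** If A vanished near some point, the set of such points would be open, and its
    complement too because the other alternative of the local form isolates zeros;
    then A would vanish identically. *)
Lemma ladder_frame x0 : exists D (rho : R * R -> C) (w : mxfun R N),
  [/\ open D, D x0, mndiff 2 D w, forall y, D y -> w y != 0 &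
      forall y, D y -> A y = rho y *: w y] /\
  [/\ forall y, D y -> w y *m P y = w y, forall y, D y -> Pi y *m w y = 0,
      forall y, D y -> exists X : M,
        dd (~~ s) w y = - (dd (~~ s) Pi y *m w y) + w y *m X &
      forall y, D y -> Q y = line_projector (w y)].
Proof.
suff [D [rho [w [[oD Dx0 sw w0 Aw] [r0 wP Piw dw]]]]] :
    exists (D : set (R * R)) (rho : R * R -> C) (w : mxfun R N),
    [/\ open D, D x0, mndiff 2 D w, forall y, D y -> w y != 0 &
        forall y, D y -> A y = rho y *: w y] /\
    [/\ forall y, D y -> y != x0 -> rho y != 0,
        forall y, D y -> w y *m P y = w y,
        forall y, D y -> Pi y *m w y = 0 &
        forall y, D y -> exists X : M,
          dd (~~ s) w y = - (dd (~~ s) Pi y *m w y) + w y *m X].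
  exists D, rho, w; split; split=> //.
  exact: (@ladder_local x0 D rho w).
have [H|//] := local_factorP x0 hp; exfalso.
pose U : set (R * R) := [set x : R * R | nbhs x [set y | A y = 0]].
have oU : open U.
  by rewrite openE => x Ux; apply/nbhs_interior: Ux.
apply: nonzero => x; suff : U x by exact: nbhs_singleton.
apply: plane_connected => //; last by exists x0.
rewrite openE => y nUy.
have [//|[D [rho [w [[oD Dy sw w0 Aw] [r0 wP Piw dw]]]]]] := local_factorP y hp.
have nD : nbhs y D by exact: open_nbhs_nbhs.
have : nbhs y (~` U); last by [].
apply: filterS nD => z Dz Uz; have [zy|zy] := eqVneq z y.
  by apply: nUy; rewrite -zy.
have Az : A z = 0 := nbhs_singleton Uz.
have := Aw z Dz; rewrite -/(A z) Az => /esym/eqP; rewrite scaler_eq0.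
by rewrite (negbTE (r0 z Dz zy)) (negbTE (w0 z Dz)).
Qed.

Lemma holo_pair_ladder : holo_pair s Pi Q.
Proof.
have mPi := hp_mdiffPi hp.
have dPiflip := hp_subV_flip hp.
have sQ : mndiff 2 setT Q.
  apply: mndiff_local => x _.
  have [D [rho [w [[oD Dx sw w0 Aw] [wP Piw dw Qw]]]]] := ladder_frame x.
  exists D; split=> //; apply: (@mndiff_eq _ _ _ _ (fun z => line_projector (w z))) => //.
    by move=> y Dy; rewrite Qw.
  have saw : mndiff 2 D (fun z => w z *m adjoint (w z)).
    by apply: mndiffM => //; exact: mndiff_adjoint.
  apply: mndiffZ => //; apply: cndiffV => //; last exact: cndiff_tr.
  by move=> z Dz; rewrite tr_mul_adjoint_eq0 w0.
have mQ x : mdiff Q x by exact: mndiff_mdiff sQ I.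
have Qr1 x : rank1_projector (Q x).
  have [D [rho [w [[oD Dx sw w0 Aw] [wP Piw dw Qw]]]]] := ladder_frame x.
  rewrite Qw //; have [PP aP tP] := hp_rank1 hp x.
  exact: line_projector_rank1 PP aP tP (wP x Dx) (w0 x Dx).
have PiQ x : Pi x *m Q x = 0.
  have [D [rho [w [[oD Dx sw w0 Aw] [wP Piw dw Qw]]]]] := ladder_frame x.
  by rewrite Qw // /line_projector -scalemxAr mulmxA Piw // mul0mx scaler0.
have QPi x : Q x *m Pi x = 0.
  have [_ aQ _] := Qr1 x.
  have aPi : adjoint (Pi x) = Pi x := hp_aPi hp x.
  by rewrite -aQ -aPi -adjointM PiQ adjoint0.
have QA x : Q x *m A x = A x.
  have [D [rho [w [[oD Dx sw w0 Aw] [wP Piw dw Qw]]]]] := ladder_frame x.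
  have [PP aP tP] := hp_rank1 hp x.
  by rewrite Qw // Aw // -scalemxAr (line_projectorK PP aP tP (wP x Dx) (w0 x Dx)).
have QdPi x : Q x *m dd (~~ s) Pi x = 0 by rewrite -dPiflip mulmxA QPi mul0mx.
have dQPi x : dd (~~ s) Q x *m Pi x = 0.
  have := ddM (~~ s) (mQ x) (mPi x).
  rewrite (_ : (fun y => Q y *m (K y + P y)) = fun=> 0); last by apply/funext => y; exact: QPi.
  by rewrite dd_cst QdPi addr0.
have dPiQ x : dd (~~ s) Pi x *m Q x + dd (~~ s) Q x *m Q x = 0.
  have [D [rho [w [[oD Dx sw w0 Aw] [wP Piw dw Qw]]]]] := ladder_frame x.
  have [PP aP tP] := hp_rank1 hp x.
  have Qw1 y : D y -> Q y *m w y = w y.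
    move=> Dy; have [PP' aP' tP'] := hp_rank1 hp y.
    by rewrite Qw // (line_projectorK PP' aP' tP' (wP y Dy) (w0 y Dy)).
  have mw : mdiff w x by exact: mndiff_mdiff sw Dx.
  suff E : dd (~~ s) Q x *m w x = - (dd (~~ s) Pi x *m w x).
    rewrite Qw // /line_projector -!scalemxAr !mulmxA E mulNmx scalerN subrr //.
  have dE : dd (~~ s) w x = dd (~~ s) Q x *m w x + Q x *m dd (~~ s) w x.
    rewrite -(ddM _ (mQ x) mw); apply: dd_near.
    have nD : nbhs x D by exact: open_nbhs_nbhs.
    by apply: filterS nD => y Dy; rewrite Qw1.
  have [X dX] := dw x Dx.
  have QdX : Q x *m dd (~~ s) w x = w x *m X.
    by rewrite dX mulmxDr mulmxN (mulmxA (Q x) (dd (~~ s) Pi x)) QdPi mul0mx oppr0 add0r mulmxA Qw1.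
  by move: dE; rewrite QdX {1}dX => /addIr.
split=> //.
- exact: hp_smoothPi hp.
- exact: hp_PiPi hp.
- exact: hp_aPi hp.
- move=> x; rewrite (ddD _ (mPi x) (mQ x)) mulmxDr !mulmxDl dQPi addr0 dPiQ addr0.
  exact: (hp_subV hp x).
- exact: (hp_subV hp).
- move=> x; have -> : 1%:M - (Pi x + Q x) = (1%:M - Q x) *m (1%:M - Pi x).
    by rewrite mulmxBr mulmx1 mulmxBl mul1mx QPi subr0 opprD addrA addrAC.
  rewrite -(mulmxA (1%:M - Q x)) -(mulmxA (1%:M - Q x)).
  rewrite (hp_second_form hp (hp_PiPi hp x)) (hp_APi hp x).
  by rewrite mulmxBl mul1mx QA subrr.
Qed.

End Step.

(** The new line is the range of d P modulo V, so that V is the new K and the three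
    conditions for it are the old conditions for V together with the equation for d'
    w. *)
Lemma ladder_step s K P : holo_pair s K P ->
  ladder (dd s) (dd (~~ s)) P = (fun=> 0) \/
  holo_pair s (fun y => K y + P y) (ladder (dd s) (dd (~~ s)) P).
Proof.
move=> hp; have [H|H] := pselect (forall x, dd s P x *m P x = 0); last first.
  by right; exact: holo_pair_ladder.
left; apply/funext => x; rewrite /ladder; case: asboolP => // -[] y.
by rewrite (ladder_num hp) H mul0mx.
Qed.

Lemma ladder0 (d d' : mxfun R N -> mxfun R N) : ladder d d' (fun=> 0) = fun=> 0.
Proof.
apply/funext => x; rewrite /ladder; case: asboolP => // -[] y.
by rewrite mulmx0 mul0mx.
Qed.

(** The projectors K of the successive pairs increase, and from the first step on they
    contain P. *)
Lemma ladder_iterates s K P k : holo_pair s K P ->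
  iter k (ladder (dd s) (dd (~~ s))) P = (fun=> 0) \/
  exists2 K', holo_pair s K' (iter k (ladder (dd s) (dd (~~ s))) P) &
    (k != 0)%N -> forall x, K' x *m P x = P x.
Proof.
move=> hp; elim: k => [|k IH]; first by right; exists K.
rewrite iterS; case: IH => [->|[K' hp' KP]]; first by left; exact: ladder0.
have [H|H] := ladder_step hp'; first by left.
right; exists (fun y => K' y + iter k (ladder (dd s) (dd (~~ s))) P y) => // _ x.
have [k0|k0] := eqVneq k 0%N; first by subst k; exact: (hp_PiP hp' x).
have E := KP k0 x; rewrite mulmxDl E -[X in _ + _ *m X]E mulmxA (hp_PK hp') mul0mx.
by rewrite addr0.
Qed.

Lemma ladder_orthogonal s K P k : holo_pair s K P -> (k != 0)%N ->
  forall x, iter k (ladder (dd s) (dd (~~ s))) P x *m P x = 0 /\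
            P x *m iter k (ladder (dd s) (dd (~~ s))) P x = 0.
Proof.
move=> hp k0 x; case: (ladder_iterates k hp) => [->|[K' hp' KP]].
  by rewrite mul0mx mulmx0.
have H : iter k (ladder (dd s) (dd (~~ s))) P x *m P x = 0.
  by rewrite -(KP k0 x) mulmxA (hp_PK hp') mul0mx.
split=> //; have := congr1 (@adjoint R N) H.
by rewrite adjointM (hp_aP hp) (hp_aP hp') adjoint0.
Qed.

End LadderStep.

(** * A Bochner inequality for linear first-order systems *)

Section Bochner.
Context {R : realType} {N : nat}.
Local Notation C := R[i].
Local Notation M := 'M[C]_N.
Implicit Types (A B L Q : mxfun R N) (x y z : R * R) (D : set (R * R)).

(** The square of the Hilbert-Schmidt norm. *)
Definition sqnorm (X : M) : R := \sum_j \sum_k cabs (X k j) ^+ 2.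

Lemma sqnormE (X : M) : \tr (adjoint X *m X) = (sqnorm X)%:C.
Proof. exact: tr_adjoint_mul. Qed.

Lemma sqnorm_ge0 (X : M) : 0 <= sqnorm X.
Proof. by apply: sumr_ge0 => j _; apply: sumr_ge0 => k _; rewrite exprn_ge0 // cabs_ge0. Qed.

Lemma sqnorm_eq0 (X : M) : sqnorm X = 0 -> X = 0.
Proof. by move=> X0; apply: tr_adjoint_mul_eq0; rewrite sqnormE X0. Qed.

Lemma sqnorm_gt0 (X : M) : X != 0 -> 0 < sqnorm X.
Proof.
move=> X0; rewrite lt_neqAle sqnorm_ge0 andbT eq_sym.
by apply: contra X0 => /eqP /sqnorm_eq0 ->.
Qed.

Lemma sqnormZ (c : C) (X : M) : sqnorm (c *: X) = cabs c ^+ 2 * sqnorm X.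
Proof.
rewrite /sqnorm big_distrr; apply: eq_bigr => j _; rewrite big_distrr; apply: eq_bigr => k _.
by rewrite mxE cabsM exprMn.
Qed.

Lemma sqnorm0 : sqnorm 0 = 0.
Proof. by rewrite -(scale0r (0 : M)) sqnormZ cabs0 expr0n mul0r. Qed.

Lemma cabs_sum (I : Type) (r : seq I) (F : I -> C) :
  cabs (\sum_(i <- r) F i) <= \sum_(i <- r) cabs (F i).
Proof.
elim: r => [|i r IH]; first by rewrite !big_nil cabs0.
by rewrite !big_cons; apply: (le_trans (ler_cabsD _ _)); rewrite lerD2l.
Qed.

Lemma cabs_conj (z : C) : cabs (conjc z) = cabs z.
Proof. by rewrite !cabsE; case: z => a b /=; rewrite sqrrN. Qed.

Lemma mul_le_sqr (a b : R) : a * b <= a ^+ 2 + b ^+ 2.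
Proof. by have := sqr_ge0 (a - b); have := sqr_ge0 (a + b); rewrite !expr2; lra. Qed.

Lemma cabs_tr_adjoint_mul (X Y : M) :
  cabs (\tr (adjoint X *m Y)) <= \sum_j \sum_k cabs (X k j) * cabs (Y k j).
Proof.
apply: (le_trans (cabs_sum _ _)); apply: ler_sum => j _; rewrite mxE.
apply: (le_trans (cabs_sum _ _)); apply: ler_sum => k _.
by rewrite cabsM adjointE cabs_conj.
Qed.

Lemma sum_pairs (sg : R) (a : 'I_N -> R) :
  \sum_(k < N) \sum_(l < N) sg * (a l + a k) = 2 * sg * N%:R * \sum_k a k.
Proof.
under eq_bigr => k _ do rewrite -big_distrr big_split /= sumr_const card_ord -mulr_natl.
rewrite -big_distrr /= big_split /= sumr_const card_ord -mulr_natl -big_distrr /=.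
by ring.
Qed.

Lemma tr_bound_left (S B : M) (sg : R) : 0 <= sg -> (forall j k, cabs (S j k) <= sg) ->
  cabs (\tr (adjoint (S *m B) *m B)) <= 2 * sg * N%:R * sqnorm B.
Proof.
move=> sg0 Sb; apply: (le_trans (cabs_tr_adjoint_mul _ _)).
have -> : 2 * sg * N%:R * sqnorm B = \sum_j (2 * sg * N%:R * \sum_k cabs (B k j) ^+ 2).
  by rewrite -big_distrr.
apply: ler_sum => j _.
have : \sum_k cabs ((S *m B) k j) * cabs (B k j) <=
    \sum_(k < N) \sum_(l < N) sg * (cabs (B l j) ^+ 2 + cabs (B k j) ^+ 2).
  apply: ler_sum => k _; rewrite mxE.
  apply: (le_trans (ler_wpM2r (cabs_ge0 _) (cabs_sum _ _))).
  rewrite big_distrl /=; apply: ler_sum => l _; rewrite cabsM -mulrA.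
  apply: ler_pM; rewrite ?mulr_ge0 ?cabs_ge0 //; exact: mul_le_sqr.
move/le_trans; apply.
by rewrite (sum_pairs sg (fun k => cabs (B k j) ^+ 2)).
Qed.

Lemma tr_bound_right (S B : M) (sg : R) : 0 <= sg -> (forall j k, cabs (S j k) <= sg) ->
  cabs (\tr (adjoint (B *m S) *m B)) <= 2 * sg * N%:R * sqnorm B.
Proof.
move=> sg0 Sb; apply: (le_trans (cabs_tr_adjoint_mul _ _)).
rewrite exchange_big /=.
have -> : 2 * sg * N%:R * sqnorm B = \sum_j (2 * sg * N%:R * \sum_i cabs (B j i) ^+ 2).
  by rewrite /sqnorm exchange_big -big_distrr.
apply: ler_sum => j _.
have : \sum_k cabs ((B *m S) j k) * cabs (B j k) <=
    \sum_(k < N) \sum_(l < N) sg * (cabs (B j l) ^+ 2 + cabs (B j k) ^+ 2).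
  apply: ler_sum => k _; rewrite mxE.
  apply: (le_trans (ler_wpM2r (cabs_ge0 _) (cabs_sum _ _))).
  rewrite big_distrl /=; apply: ler_sum => l _; rewrite cabsM mulrAC mulrC.
  apply: ler_pM; rewrite ?mulr_ge0 ?cabs_ge0 //.
  exact: mul_le_sqr.
move/le_trans; apply.
by rewrite (sum_pairs sg (fun k => cabs (B j k) ^+ 2)).
Qed.

(** The commutator of d_+ - L and d_- + L^*, that is the curvature of the unitary
    connection that L determines. *)
Definition curvL L y : M :=
  dd false L y + dd true (fun z => adjoint (L z)) y + adjoint (L y) *m L y - L y *m adjoint (L y).
Definition curvR L y : M :=
  dd false L y + dd true (fun z => adjoint (L z)) y + L y *m adjoint (L y) - adjoint (L y) *m L y.

Section Formula.
Variables (D : set (R * R)) (B L Q : mxfun R N).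
Hypotheses (oD : open D) (sB : mndiff 2 D B) (sL : mndiff 2 D L) (sQ : mndiff 2 D Q).
Hypothesis eqB : forall z, D z -> dd true B z = L z *m B z + B z *m Q z.
Let X : mxfun R N := dd false B.
Let W y : M := X y + adjoint (L y) *m B y + B y *m adjoint (Q y).

Let mB y : D y -> mdiff B y. Proof. by move=> Dy; exact: mndiff_mdiff sB Dy. Qed.
Let mL y : D y -> mdiff L y. Proof. by move=> Dy; exact: mndiff_mdiff sL Dy. Qed.
Let mQ y : D y -> mdiff Q y. Proof. by move=> Dy; exact: mndiff_mdiff sQ Dy. Qed.
Let mX y : D y -> mdiff X y.
Proof. by move=> Dy; exact: mndiff_mdiff (mndiff_dd false oD sB) Dy. Qed.
Let mLB y : D y -> mdiff (fun z => adjoint (L z) *m B z) y.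
Proof. by move=> Dy; apply: mdiffM; [apply: mdiff_adjoint; exact: mL|exact: mB]. Qed.
Let mBQ y : D y -> mdiff (fun z => B z *m adjoint (Q z)) y.
Proof. by move=> Dy; apply: mdiffM; [exact: mB|apply: mdiff_adjoint; exact: mQ]. Qed.
Let mW y : D y -> mdiff W y.
Proof. by move=> Dy; apply: mdiffD; [apply: mdiffD; [exact: mX|exact: mLB]|exact: mBQ]. Qed.

Lemma bochner_first y : D y ->
  wirtinger true (fun z => \tr (adjoint (B z) *m B z)) y = \tr (adjoint (W y) *m B y).
Proof.
move=> Dy; have aB := mdiff_adjoint (mB Dy).
rewrite (wirtinger_tr _ (mdiffM aB (mB Dy))) (ddM _ aB (mB Dy)) (dd_adjoint _ (mB Dy)) /= eqB //.
rewrite /W !adjointD !adjointM !adjointK !mulmxDl mulmxDr !mxtraceD -addrA.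
by congr (_ + (_ + _)); rewrite ?mulmxA // [LHS]mxtrace_mulC mulmxA.
Qed.

Lemma bochner_dW y : D y -> dd true W y =
  L y *m W y + W y *m Q y + (curvL L y *m B y + B y *m curvR Q y).
Proof.
move=> Dy; have aL := mdiff_adjoint (mL Dy); have aQ := mdiff_adjoint (mQ Dy).
rewrite (ddD _ (mdiffD (mX Dy) (mLB Dy)) (mBQ Dy)) (ddD _ (mX Dy) (mLB Dy)).
rewrite (ddM _ aL (mB Dy)) (ddM _ (mB Dy) aQ) eqB //.
have -> : dd true X y = dd false L y *m B y + L y *m X y + (X y *m Q y + B y *m dd false Q y).
  rewrite /X (ddC _ _ oD Dy sB) -(ddM _ (mL Dy) (mB Dy)) -(ddM _ (mB Dy) (mQ Dy)).
  rewrite -(ddD _ (mdiffM (mL Dy) (mB Dy)) (mdiffM (mB Dy) (mQ Dy))).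
  have nD : nbhs y D by exact: open_nbhs_nbhs.
  by apply: dd_near; apply: filterS nD => z Dz; rewrite eqB.
rewrite /W /curvL /curvR !(mulmxDl, mulmxDr, mulmxBl, mulmxBr, mulmxN, mulNmx) !mulmxA.
move: (dd false L y *m B y) (L y *m X y) (X y *m Q y) (B y *m dd false Q y)
  (dd true (fun z => adjoint (L z)) y *m B y) (adjoint (L y) *m L y *m B y)
  (adjoint (L y) *m B y *m Q y) (L y *m B y *m adjoint (Q y)) (B y *m Q y *m adjoint (Q y))
  (B y *m dd true (fun z => adjoint (Q z)) y) (L y *m adjoint (L y) *m B y)
  (B y *m adjoint (Q y) *m Q y) => a1 a2 a3 a4 a5 a6 a7 a8 a9 a10 a11 a12.
by apply/matrixP => j k; rewrite !mxE; ring.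
Qed.

(** Here W0 is the adjoint covariant derivative of B0; the terms with L0 and Q0
    recombine into its squared norm. *)
Lemma bochner_algebra (L0 Q0 B0 X0 K1 K2 : M) :
  let W0 := X0 + adjoint L0 *m B0 + B0 *m adjoint Q0 in
  \tr (adjoint (L0 *m W0 + W0 *m Q0 + (K1 *m B0 + B0 *m K2)) *m B0 + adjoint W0 *m X0) =
  \tr (adjoint W0 *m W0) + \tr (adjoint (K1 *m B0) *m B0) + \tr (adjoint (B0 *m K2) *m B0).
Proof.
set W0 := X0 + _ + _ => /=.
have E : \tr (adjoint W0 *m W0) = \tr (adjoint W0 *m X0) +
    \tr (adjoint (L0 *m W0) *m B0) + \tr (adjoint (W0 *m Q0) *m B0).
  transitivity (\tr (adjoint W0 *m (X0 + adjoint L0 *m B0 + B0 *m adjoint Q0))) => //.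
  clearbody W0; rewrite !mulmxDr !mxtraceD; congr (_ + _ + _).
    by rewrite adjointM mulmxA.
  by rewrite adjointM -mulmxA [RHS]mxtrace_mulC mulmxA.
rewrite mxtraceD E !adjointD !mulmxDl !mxtraceD.
move: (\tr _) (\tr _) (\tr _) (\tr _) (\tr _) => a1 a2 a3 a4 a5.
by ring.
Qed.

(** The Laplacian of the squared norm of a solution is the squared norm of the adjoint
    covariant derivative plus curvature terms. *)
Lemma bochner_formula y : D y ->
  wirtinger false (wirtinger true (fun z => \tr (adjoint (B z) *m B z))) y =
  \tr (adjoint (W y) *m W y) + \tr (adjoint (curvL L y *m B y) *m B y)
   + \tr (adjoint (B y *m curvR Q y) *m B y).
Proof.
move=> Dy; have nD : nbhs y D by exact: open_nbhs_nbhs.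
have aW := mdiff_adjoint (mW Dy).
have -> : wirtinger false (wirtinger true (fun z => \tr (adjoint (B z) *m B z))) y =
    wirtinger false (fun z => \tr (adjoint (W z) *m B z)) y.
  by apply: wirtinger_near; apply: filterS nD => z Dz; rewrite bochner_first.
rewrite (wirtinger_tr _ (mdiffM aW (mB Dy))) (ddM _ aW (mB Dy)) (dd_adjoint _ (mW Dy)) /=.
rewrite bochner_dW // -/X.
by rewrite -bochner_algebra /W.
Qed.

Lemma bochner_ge y (sg : R) : D y -> 0 <= sg ->
  (forall j k, cabs (curvL L y j k) <= sg) -> (forall j k, cabs (curvR Q y j k) <= sg) ->
  - (4 * sg * N%:R * sqnorm (B y)) <=
    complex.Re (wirtinger false (wirtinger true (fun z => \tr (adjoint (B z) *m B z))) y).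
Proof.
move=> Dy sg0 bL bQ; rewrite bochner_formula // !ReD sqnormE /=.
have h1 := le_trans (le_Re_cabs _) (tr_bound_left (B y) sg0 bL).
have h2 := le_trans (le_Re_cabs _) (tr_bound_right (B y) sg0 bQ).
have h0 := sqnorm_ge0 (W y).
by move: h1 h2; rewrite !ler_norml => /andP[h1 _] /andP[h2 _]; lra.
Qed.

End Formula.

End Bochner.

(** * Barrier functions *)

Section Barrier.
Context {R : realType}.
Local Notation C := R[i].
Implicit Types (f g : R * R -> C) (x y z p : R * R) (D : set (R * R)).

Lemma ccont_conj f x : ccont f x -> ccont (fun y => conjc (f y)) x.
Proof.
move=> cf e e0; have [d d0 Hd] := cf e e0; exists d => // h hd.
by rewrite -(rmorphB (@conjc R)) cabs_conj; exact: Hd.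
Qed.

Lemma ccont_cst (c : C) x : ccont (fun=> c) x.
Proof. by apply: cdiff_ccont; exact: cdiff_cst. Qed.

Lemma ccont_sum (I : Type) (r : seq I) (F : I -> R * R -> C) x :
  (forall i, ccont (F i) x) -> ccont (fun y => \sum_(i <- r) F i y) x.
Proof.
move=> cF; elim: r => [|i r IH].
  by rewrite (_ : (fun y => _) = fun=> 0); [exact: ccont_cst|apply/funext => y; rewrite big_nil].
rewrite (_ : (fun y => _) = fun y => F i y + \sum_(j <- r) F j y); first exact: ccontD.
by apply/funext => y; rewrite big_cons.
Qed.

Lemma cndiffX n D f K : open D -> cndiff n D f -> cndiff n D (fun y => f y ^+ K).
Proof.
move=> oD sf; elim: K => [|K IH].
  by apply: cndiff_eq (cndiff_cst n 1 oD) => // y _; rewrite expr0.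
by apply: cndiff_eq (cndiffM oD sf IH) => // y _; rewrite exprS.
Qed.

Lemma wirtingerX_eq0 t f x K : cdiff f x -> wirtinger t f x = 0 ->
  cdiff (fun y => f y ^+ K) x /\ wirtinger t (fun y => f y ^+ K) x = 0.
Proof.
move=> df wf; elim: K => [|K [IH1 IH2]].
  by rewrite (_ : (fun y => _) = fun=> 1) ?wirtinger_cst //; split=> //; exact: cdiff_cst.
rewrite (_ : (fun y => _) = fun y => f y * f y ^+ K); last first.
  by apply/funext => y; rewrite exprS.
by split; [exact: cdiffM|rewrite wirtingerM // wf IH2 mul0r mulr0 addr0].
Qed.

Lemma zeta_shift p : (fun y => zeta (y - p)) = fun y => zeta y + - zeta p :> C.
Proof. by apply/funext => y; rewrite zetaB. Qed.

Lemma cndiff_zeta_shift n D p : open D -> cndiff n D (fun y => zeta (y - p)).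
Proof. by move=> oD; rewrite zeta_shift; apply: cndiffD => //; [exact: cndiff_zeta|exact: cndiff_cst]. Qed.

(** An antiholomorphic function with a pole at p and modulus 1 on the circle with
    radius r; multiplying a solution of the system by it gives a solution, with values
    amplified inside the circle. *)
Definition blowup p (r : R) (K : nat) y : C := conjc (r%:C * (zeta (y - p))^-1) ^+ K.

Lemma cabs_blowup p r K y : 0 <= r -> cabs (blowup p r K y) = (r / cabs (zeta (y - p))) ^+ K.
Proof. by move=> r0; rewrite cabsX cabs_conj cabsM cabs_real cabsV ger0_norm. Qed.

Lemma cndiff_blowup n D p r K : open D -> ~ D p -> cndiff n D (blowup p r K).
Proof.
move=> oD nDp; apply: cndiffX => //; apply: cndiff_conj => //; apply: cndiffM => //.
  exact: cndiff_cst.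
apply: cndiffV => //; last exact: cndiff_zeta_shift.
by move=> y Dy; rewrite zeta_eq0 subr_eq0; apply/eqP => E; apply: nDp; rewrite -E.
Qed.

Lemma blowup_antiholomorphic p r K y : y != p ->
  cdiff (blowup p r K) y /\ wirtinger true (blowup p r K) y = 0.
Proof.
move=> yp; have [c /cderP[dv _ wv]] := cder2_cder (cder2V_zeta yp).
have dv2 : cdiff (fun y => r%:C * (zeta (y - p))^-1) y.
  apply: cdiffM; first exact: cdiff_cst.
  by rewrite (_ : (fun y => _) = fun y => (zeta y - zeta p)^-1) //; apply/funext => u; rewrite zetaB.
apply: wirtingerX_eq0; first exact: cdiff_conj.
rewrite wirtinger_conj //= (_ : (fun y => _) = fun y => r%:C * (zeta y - zeta p)^-1); last first.
  by apply/funext => u; rewrite zetaB.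
rewrite (wirtingerM _ (cdiff_cst _ _) dv) wv wirtinger_cst mul0r mulr0 addr0.
by rewrite conjc0.
Qed.

Lemma wirtinger_zeta_shift t p y : wirtinger t (fun y => zeta (y - p)) y = (if t then 1 else 0) :> C.
Proof.
rewrite zeta_shift wirtingerD ?wirtinger_cst ?addr0 ?wirtinger_zeta //; exact: cdiff_zeta.
Qed.

Lemma wirtinger_conj_zeta_shift t p y :
  wirtinger t (fun y => conjc (zeta (y - p))) y = (if t then 0 else 1) :> C.
Proof.
rewrite wirtinger_conj ?wirtinger_zeta_shift; first by case: t; apply: complexP; rewrite /= ?oppr0.
by have := cndiff_zeta_shift 1 p openT => /cndiff_cdiff; exact.
Qed.

Lemma laplacian_sqr_zeta p (a b : C) y :
  wirtinger false (wirtinger true (fun y => a + b * (zeta (y - p) * conjc (zeta (y - p))))) y = b.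
Proof.
have dz u : cdiff (fun y => zeta (y - p)) u.
  by have := cndiff_zeta_shift 1 p openT => /cndiff_cdiff; exact.
have dc u := cdiff_conj (dz u).
rewrite (_ : wirtinger true _ = fun y => b * conjc (zeta (y - p))).
  rewrite (wirtingerM _ (cdiff_cst _ _) (dc y)) wirtinger_cst mul0r add0r.
  by rewrite wirtinger_conj_zeta_shift mulr1.
apply/funext => u.
have d1 := cdiffM (dz u) (dc u).
rewrite (wirtingerD _ (cdiff_cst _ _) (cdiffM (cdiff_cst _ _) d1)) wirtinger_cst add0r.
rewrite (wirtingerM _ (cdiff_cst _ _) d1) wirtinger_cst mul0r add0r.
rewrite (wirtingerM _ (dz u) (dc u)) wirtinger_zeta_shift wirtinger_conj_zeta_shift.
by rewrite mul1r mulr0 addr0.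
Qed.

Lemma zeta_conj y : zeta y * conjc (zeta y) = (cabs (zeta y) ^+ 2)%:C :> C.
Proof. by rewrite sqr_cabs; apply: complexP; rewrite ReImE /=; ring. Qed.

Lemma Re_quadratic (a b : R) y :
  complex.Re (a%:C + b%:C * (zeta y * conjc (zeta y))) = a + b * cabs (zeta y) ^+ 2.
Proof. by rewrite zeta_conj ReD ReImE /=; ring. Qed.

Lemma cndiff_quadratic n D p (a b : C) : open D ->
  cndiff n D (fun y => a + b * (zeta (y - p) * conjc (zeta (y - p)))).
Proof.
move=> oD; have sz := cndiff_zeta_shift n p oD.
apply: (cndiffD oD (cndiff_cst n a oD)); apply: (cndiffM oD (cndiff_cst n b oD)).
exact: (cndiffM oD sz (cndiff_conj oD sz)).
Qed.

End Barrier.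

(** * Zeros spread over discs *)

Section Vanishing.
Context {R : realType} {N : nat}.
Local Notation C := R[i].
Local Notation M := 'M[C]_N.
Implicit Types (A B L Q chi : mxfun R N) (x y z p : R * R) (D : set (R * R)).

Lemma sqnorm_continuous B x : (forall j k, ccont (fun y => B y j k) x) ->
  {for x, continuous (fun y => sqnorm (B y))}.
Proof.
move=> cB; rewrite (_ : (fun y => _) =
    fun y => complex.Re (\sum_j \sum_k conjc (B y k j) * B y k j)).
  apply: ccont_Re; apply: ccont_sum => j; apply: ccont_sum => k.
  by apply: ccontM => //; exact: ccont_conj.
apply/funext => y; rewrite -[LHS]/(complex.Re (sqnorm (B y))%:C) -sqnormE; congr complex.Re.
by apply: eq_bigr => j _; rewrite mxE; apply: eq_bigr => k _; rewrite adjointE.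
Qed.

Lemma entries_bounded A p (r : R) : 0 < r ->
  (forall y, cdisc p r y -> forall j k, ccont (fun z => A z j k) y) ->
  exists2 sg, 0 <= sg & forall y, cdisc p r y -> forall j k, cabs (A y j k) <= sg.
Proof.
move=> r0 cA.
have H (jk : 'I_N * 'I_N) : exists M, 0 <= M /\ forall y, cdisc p r y -> cabs (A y jk.1 jk.2) <= M.
  have [y yd|M M0 HM] := @cdisc_ccont_bounded _ (fun z => A z jk.1 jk.2) p r r0; first exact: cA.
  by exists M.
have [f Hf] := choice H; exists (\sum_jk f jk).
  by apply: sumr_ge0 => jk _; case: (Hf jk).
move=> y yd j k; have [_ /(_ y yd)] := Hf (j, k); move/le_trans; apply.
by rewrite (bigD1 (j, k)) //= lerDl; apply: sumr_ge0 => jk _; case: (Hf jk).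
Qed.

Lemma sqnorm_bounded B p (r : R) : 0 < r ->
  (forall y, cdisc p r y -> forall j k, ccont (fun z => B z j k) y) ->
  exists2 M, 0 <= M & forall y, cdisc p r y -> sqnorm (B y) <= M.
Proof.
move=> r0 cB.
have [||c] := @compact_EVT_max _ _ (fun y => sqnorm (B y)) (cdisc p r) _ (@compact_cdisc _ p r (ltW r0)).
- by exists p; rewrite /cdisc /= subrr zeta0 cabs0 ltW.
- by apply: continuous_in_subspaceT => z; rewrite inE => zd; apply/sqnorm_continuous/cB.
rewrite inE => cd cm; exists (sqnorm (B c)); first exact: sqnorm_ge0.
by move=> y yd; apply: cm; rewrite inE.
Qed.

Definition linear_system D L Q B := forall y, D y -> dd true B y = L y *m B y + B y *m Q y.

(** At such a maximum the Bochner inequality and the Laplacian of the barrier s (1 - c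
    |zeta|^2) would have a positive sum, against the second derivative test. *)
Lemma barrier_no_interior_max D L Q B p x (c s sg : R) : open D -> D x ->
  mndiff 2 D B -> mndiff 2 D L -> mndiff 2 D Q -> linear_system D L Q B ->
  0 <= sg -> (forall j k, cabs (curvL L x j k) <= sg) -> (forall j k, cabs (curvR Q x j k) <= sg) ->
  0 < s -> sqnorm (B x) <= s -> 4 * sg * N%:R < c ->
  ~ (forall y, D y -> sqnorm (B y) - s * (1 - c * cabs (zeta (y - p)) ^+ 2) <=
     sqnorm (B x) - s * (1 - c * cabs (zeta (x - p)) ^+ 2)).
Proof.
move=> oD Dx sB sL sQ eqB sg0 bL bQ s0 Bs sc Hmax.
pose n y := \tr (adjoint (B y) *m B y).
pose w y : C := (- s)%:C + (s * c)%:C * (zeta (y - p) * conjc (zeta (y - p))).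
have sn : cndiff 2 D n by exact: cndiff_tr oD (mndiffM oD (mndiff_adjoint oD sB) sB).
have sw : cndiff 2 D w := cndiff_quadratic 2 p (- s)%:C (s * c)%:C oD.
have E y : complex.Re (n y + w y) = sqnorm (B y) - s * (1 - c * cabs (zeta (y - p)) ^+ 2).
  by rewrite ReD /n sqnormE /w Re_quadratic /=; ring.
have := @Re_laplacian_max _ (fun y => n y + w y) D x oD Dx (cndiffD oD sn sw).
have -> : wirtinger false (wirtinger true (fun y => n y + w y)) x =
    wirtinger false (wirtinger true n) x + (s * c)%:C.
  rewrite -(laplacian_sqr_zeta p (- s)%:C (s * c)%:C x) -wirtingerD.
  - apply: wirtinger_near; have nD : nbhs x D by exact: open_nbhs_nbhs.
    by apply: filterS nD => y Dy; exact: (wirtingerD true (cndiff_cdiff sn Dy) (cndiff_cdiff sw Dy)).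
  - exact: cndiff_cdiff (cndiff_wirtinger true oD sn) Dx.
  - exact: cndiff_cdiff (cndiff_wirtinger true oD sw) Dx.
move=> H; have {}H : complex.Re (wirtinger false (wirtinger true n) x) + s * c <= 0.
  rewrite -[X in _ + X]/(complex.Re (s * c)%:C) -ReD.
  by apply: H => y Dy; rewrite !E; exact: Hmax.
have := bochner_ge oD sB sL sQ eqB Dx sg0 bL bQ; rewrite -/n => H2.
have k0 : 0 <= 4 * sg * N%:R by rewrite !mulr_ge0.
have h1 : 4 * sg * N%:R * sqnorm (B x) <= 4 * sg * N%:R * s by rewrite ler_wpM2l.
have h2 : 4 * sg * N%:R * s < s * c by rewrite mulrC ltr_pM2l.
by move: h1 h2 H H2; move: (4 * sg * N%:R * _) (s * c) (4 * sg * N%:R * _) (complex.Re _) => *; lra.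
Qed.

End Vanishing.

Section Spreading.
Context {R : realType} {N : nat}.
Local Notation C := R[i].
Local Notation M := 'M[C]_N.
Implicit Types (A B L Q chi : mxfun R N) (x y z p : R * R) (D : set (R * R)).

Lemma open_disc p (r : R) : open [set y | cabs (zeta (y - p)) < r].
Proof.
apply: (@open_comp _ _ (fun y => cabs (zeta (y - p))) [set t | t < r]); last exact: open_lt.
move=> y _; apply: (@ccont_cabs _ (fun y => zeta (y - p))); apply: cdiff_ccont.
by have := cndiff_zeta_shift 1 p openT => /cndiff_cdiff; exact.
Qed.

Lemma near_disc p (r : R) : 0 < r -> {near p, forall y, cabs (zeta (y - p)) < r}.
Proof.
move=> r0; have : nbhs p [set y | cabs (zeta (y - p)) < r]; last by [].
by apply: open_nbhs_nbhs; split; [exact: open_disc|rewrite /= subrr zeta0 cabs0].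
Qed.

(** The function is only required to be smooth and to solve the system near the points
    where it is nonzero, so that a solution on a component may be extended by zero. *)
Definition local_system D L Q chi := forall y, D y -> chi y != 0 ->
  exists D', [/\ open D', D' y, D' `<=` D, mndiff 2 D' chi & linear_system D' L Q chi].

Lemma ccont_blowup p r K chi (r0 : R) : 0 < r0 -> (forall y, cdisc p r0 y -> chi y = 0) ->
  forall y j k, ccont (fun z => chi z j k) y -> ccont (fun z => (blowup p r K z *: chi z) j k) y.
Proof.
move=> r00 chi0 y j k cc; have [->|yp] := eqVneq y p.
  apply: ccont_near (ccont_cst 0 p); apply: filterS (near_disc p r00) => z zr.
  by rewrite mxE chi0 ?mxE ?mulr0 //; exact: ltW.
rewrite (_ : (fun z => _) = fun z => blowup p r K z * chi z j k).
  by apply: ccontM => //; apply: cdiff_ccont; have [] := blowup_antiholomorphic r K yp.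
by apply/funext => z; rewrite mxE.
Qed.

Lemma blowup_system D L Q chi p r K : open D -> ~ D p -> mndiff 2 D chi ->
  linear_system D L Q chi ->
  mndiff 2 D (fun y => blowup p r K y *: chi y) /\
  linear_system D L Q (fun y => blowup p r K y *: chi y).
Proof.
move=> oD nDp sc eqc; split; first exact: mndiffZ oD (cndiff_blowup 2 r K oD nDp) sc.
move=> y Dy; have yp : y != p by apply/eqP => E; apply: nDp; rewrite -E.
have [d0 w0] := blowup_antiholomorphic r K yp.
rewrite (ddZ true d0 (mndiff_mdiff sc Dy)) w0 scale0r add0r eqc //.
by rewrite scalerDr -scalemxAr -scalemxAl.
Qed.

(** The squared norm divided by the barrier has its maximum on the circle, where the
    amplifying factor has modulus 1; the bound does not depend on the exponent K. *)
Lemma blowup_bound D L Q chi p (r r0 sg M0 : R) K : open D -> mndiff 2 D L -> mndiff 2 D Q ->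
  (forall y, D y -> forall j k, ccont (fun z => chi z j k) y) -> local_system D L Q chi ->
  cdisc p r `<=` D -> 0 < r0 -> 0 < r -> 0 <= sg ->
  (forall y, cdisc p r y -> forall j k, cabs (curvL L y j k) <= sg) ->
  (forall y, cdisc p r y -> forall j k, cabs (curvR Q y j k) <= sg) ->
  (4 * sg * N%:R + 1) * r ^+ 2 < 1 -> (forall y, cdisc p r0 y -> chi y = 0) ->
  (forall y, cdisc p r y -> sqnorm (chi y) <= M0) ->
  forall y, cdisc p r y ->
    sqnorm (blowup p r K y *: chi y) <= M0 / (1 - (4 * sg * N%:R + 1) * r ^+ 2).
Proof.
move=> oD sL sQ cchi lchi rD r00 r_gt0 sg0 bL bQ.
have : 0 < 4 * sg * N%:R + 1 by rewrite ltr_wpDl // !mulr_ge0.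
have : 4 * sg * N%:R < 4 * sg * N%:R + 1 by rewrite ltrDl.
move: (4 * sg * N%:R + 1) => c scc c0 cr chi0 HM0.
pose B y := blowup p r K y *: chi y; pose w y : R := 1 - c * cabs (zeta (y - p)) ^+ 2.
have k0 : 0 < 1 - c * r ^+ 2 by rewrite subr_gt0.
have wk y : cdisc p r y -> 1 - c * r ^+ 2 <= w y.
  move=> yr; rewrite /w lerD2l lerN2 ler_pM2l //.
  by rewrite lerXn2r // nnegrE ?cabs_ge0 // ltW.
have w0 y : cdisc p r y -> 0 < w y by move/wk; exact: lt_le_trans.
have w1 y : w y <= 1.
  by rewrite /w lerBlDr lerDl mulr_ge0 ?exprn_ge0 ?cabs_ge0 // ltW.
have M00 : 0 <= M0.
  apply: le_trans (HM0 p _); first exact: sqnorm_ge0.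
  by rewrite /cdisc /= subrr zeta0 cabs0 ltW.
have [||x] := @compact_EVT_max _ _ (fun y => sqnorm (B y) * (w y)^-1) (cdisc p r) _
    (@compact_cdisc _ p r (ltW r_gt0)).
- by exists p; rewrite /cdisc /= subrr zeta0 cabs0 ltW.
- apply: continuous_in_subspaceT => z; rewrite inE => zd; apply: cvgM.
    apply: sqnorm_continuous => j k.
    exact: (ccont_blowup r K r00 chi0 (cchi z (rD z zd) j k)).
  apply: cvgV; first by rewrite gt_eqF // w0.
  apply: cvgB; first exact: cvg_cst.
  by apply: cvgM; [exact: cvg_cst|exact: continuous_sqr_zeta].
rewrite inE => xr xmax; set s := sqnorm (B x) * (w x)^-1 in xmax.
have Bs y : cdisc p r y -> sqnorm (B y) <= s * w y.
  by move=> yr; rewrite -ler_pdivrMr ?w0 //; apply: xmax; rewrite inE.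
have Ex : sqnorm (B x) = s * w x by rewrite /s mulfVK // gt_eqF // w0.
have s0 : 0 <= s by rewrite /s mulr_ge0 ?sqnorm_ge0 // invr_ge0 ltW // w0.
suff sM : s <= M0 / (1 - c * r ^+ 2).
  move=> y yr; apply: le_trans (Bs y yr) _; apply: le_trans sM.
  by rewrite -[leRHS]mulr1 ler_wpM2l.
have [B0|B0] := eqVneq (B x) 0.
  by rewrite /s B0 sqnorm0 mul0r divr_ge0 // ltW.
have [xr'|xr'] := ltP (cabs (zeta (x - p))) r; last first.
  have xE : cabs (zeta (x - p)) = r by apply/eqP; rewrite eq_le xr' andbT.
  have -> : s = sqnorm (chi x) * (w x)^-1.
    by rewrite /s /B sqnormZ cabs_blowup ?xE ?divff ?gt_eqF ?ltW // expr1n expr1n mul1r.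
  apply: ler_pM; rewrite ?sqnorm_ge0 ?HM0 ?invr_ge0 ?(ltW (w0 _ xr)) //.
  by rewrite lef_pV2 ?posrE ?w0 // wk.
have chix : chi x != 0 by apply: contraNneq B0 => E; rewrite /B E scaler0.
have xp : x != p.
  apply: contraNneq chix => ->; rewrite chi0 // /cdisc /= subrr zeta0 cabs0; exact: ltW.
have [D' [oD' D'x D'D sD' eqD']] := lchi x (rD _ xr) chix.
pose D2 := D' `&` [set y | y != p] `&` [set y | cabs (zeta (y - p)) < r].
have oD2 : open D2 by exact: (openI (openI oD' (@open_punctured _ p)) (@open_disc p r)).
have D2x : D2 x by split=> //; split.
have D2D' : D2 `<=` D' by move=> y [[]].
have nD2p : ~ D2 p by move=> [[_ /=]]; rewrite eqxx.
have [sB eqB] := blowup_system r K oD2 nD2p (mndiff_subset D2D' sD') (fun y Hy => eqD' y (D2D' y Hy)).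
exfalso.
have D2D : D2 `<=` D by move=> y /D2D' /D'D.
apply: (barrier_no_interior_max (p := p) (c := c) (s := s) oD2 D2x sB (mndiff_subset D2D sL)
  (mndiff_subset D2D sQ) eqB sg0 (bL x xr) (bQ x xr)) => //.
- by rewrite lt_neqAle s0 andbT eq_sym; apply: contra B0 => /eqP E; apply/eqP/sqnorm_eq0; rewrite Ex E mul0r.
- by rewrite -/(B x) Ex -[leRHS]mulr1 ler_wpM2l.
move=> y [_ yr]; rewrite -/(B x) -/(B y) -/(w x) -/(w y) Ex subrr subr_le0.
by apply: Bs; exact: ltW.
Qed.

(** Inside the circle the factor grows geometrically with the exponent while the bound
    stays fixed, so the solution vanishes. The smaller disc with radius r0 absorbs the
    pole. *)
Lemma vanish_spread D L Q chi p (r r0 sg : R) : open D -> mndiff 2 D L -> mndiff 2 D Q ->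
  (forall y, D y -> forall j k, ccont (fun z => chi z j k) y) -> local_system D L Q chi ->
  cdisc p r `<=` D -> 0 < r0 -> 0 < r -> 0 <= sg ->
  (forall y, cdisc p r y -> forall j k, cabs (curvL L y j k) <= sg) ->
  (forall y, cdisc p r y -> forall j k, cabs (curvR Q y j k) <= sg) ->
  (4 * sg * N%:R + 1) * r ^+ 2 < 1 -> (forall y, cdisc p r0 y -> chi y = 0) ->
  forall y, cabs (zeta (y - p)) < r -> chi y = 0.
Proof.
move=> oD sL sQ cchi lchi rD r00 r_gt0 sg0 bL bQ cr chi0 y yr.
have [||M0 M00 HM0] := @sqnorm_bounded _ _ chi p r => //; first by move=> z /rD /cchi.
have Bb K := blowup_bound K oD sL sQ cchi lchi rD r00 r_gt0 sg0 bL bQ cr chi0 HM0 (ltW yr).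
move: (M0 / _) Bb => M1 Bb.
have [->|yp] := eqVneq y p; first by apply: chi0; rewrite /cdisc /= subrr zeta0 cabs0 ltW.
apply/eqP/negPn/negP => /sqnorm_gt0 n0.
have z0 : 0 < cabs (zeta (y - p)) by rewrite cabs_gt0 zeta_eq0 subr_eq0.
have q1 : 1 < (r / cabs (zeta (y - p))) ^+ 2.
  by rewrite exprn_egt1 // ltr_pdivlMr // mul1r.
have [K HK] := expr_unbounded (M1 / sqnorm (chi y)) q1.
have := Bb K; rewrite sqnormZ cabs_blowup ?(ltW r_gt0) // -exprM mulnC exprM leNgt.
by rewrite -ltr_pdivrMr // HK.
Qed.

End Spreading.

(** * Unique continuation *)

Section Continuation.
Context {R : realType} {N : nat}.
Local Notation C := R[i].
Local Notation M := 'M[C]_N.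
Implicit Types (A B L Q T chi : mxfun R N) (x y z p : R * R) (D U : set (R * R)).

(** Connectedness of an open set, in the form in which it is used. *)
Definition sconnected D := forall U, open U -> U `<=` D -> open (D `\` U) -> U !=set0 -> D `<=` U.

Lemma open_by_near D : (forall x, D x -> {near x, forall y, D y}) -> open D.
Proof. by move=> H; rewrite openE => x /H. Qed.

Lemma mdiff_curv D L y : open D -> mndiff 2 D L -> D y -> mdiff (curvL L) y /\ mdiff (curvR L) y.
Proof.
move=> oD sL Dy; have mL := mndiff_mdiff sL Dy; have aL := mdiff_adjoint mL.
have m1 := mndiff_mdiff (mndiff_dd false oD sL) Dy.
have m2 := mndiff_mdiff (mndiff_dd true oD (mndiff_adjoint oD sL)) Dy.
have m12 := mdiffD m1 m2.
split; first exact: mdiffB (mdiffD m12 (mdiffM aL mL)) (mdiffM mL aL).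
exact: mdiffB (mdiffD m12 (mdiffM mL aL)) (mdiffM aL mL).
Qed.

(** The interior of the zero set is closed in D: near each point of D zeros spread
    over discs with a uniform radius, since the curvatures are locally bounded. *)
Lemma unique_continuation D L Q chi (U : set (R * R)) : open D -> sconnected D ->
  mndiff 2 D L -> mndiff 2 D Q ->
  (forall y, D y -> forall j k, ccont (fun z => chi z j k) y) -> local_system D L Q chi ->
  open U -> U `<=` D -> U !=set0 -> (forall y, U y -> chi y = 0) ->
  forall y, D y -> chi y = 0.
Proof.
move=> oD cD sL sQ cchi lchi oU UD [u Uu] chiU.
pose Z x := D x /\ exists2 r, 0 < r & forall y, cabs (zeta (y - x)) < r -> chi y = 0.
have step x : D x -> exists2 d, 0 < d &
    forall z, cabs (zeta (z - x)) < d -> Z z -> Z x.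
  move=> Dx; have [r r0 Hr] := open_cdisc oD Dx.
  have r20 : 0 < r / 2 by rewrite divr_gt0.
  have rD : cdisc x (r / 2) `<=` D by move=> y /= yr; apply: Hr; apply: le_lt_trans yr _; lra.
  have [y /rD Dy j k|s1 s10 Hs1] := @entries_bounded _ _ (curvL L) x _ r20.
    by apply: mdiff_entry_ccont; have [] := mdiff_curv oD sL Dy.
  have [y /rD Dy j k|s2 s20 Hs2] := @entries_bounded _ _ (curvR Q) x _ r20.
    by apply: mdiff_entry_ccont; have [] := mdiff_curv oD sQ Dy.
  pose sg := s1 + s2; have sg0 : 0 <= sg by rewrite addr_ge0.
  pose c : R := 4 * sg * N%:R + 1.
  have c0 : 0 < c by rewrite ltr_wpDl // !mulr_ge0.
  (* The second bound makes the barrier 1 - c |zeta|^2 positive on discs with radius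
     rho. *)
  pose rho := Num.min (r / 4) (1 / (c + 1)).
  have rho0 : 0 < rho by rewrite lt_min !divr_gt0 // addr_gt0.
  have rhor : rho <= r / 4 by rewrite ge_min lexx.
  have rhoc : c * rho ^+ 2 < 1.
    have h1 : rho <= 1 / (c + 1) by rewrite ge_min lexx orbT.
    have h2 : rho * (c + 1) <= 1 by rewrite -ler_pdivlMr // addr_gt0.
    have h3 : c * rho < 1 by nra.
    have h4 : rho < 1 by nra.
    by rewrite expr2 mulrA; nra.
  exists (rho / 2); first by rewrite divr_gt0.
  move=> z zx [Dz [r1 r10 Hr1]].
  have zD : cdisc z rho `<=` cdisc x (r / 2).
    move=> y; rewrite /cdisc /= => yz.
    rewrite (_ : y - x = (y - z) + (z - x)); last by rewrite addrA subrK.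
    by rewrite zetaD; apply: (le_trans (ler_cabsD _ _)); lra.
  split=> //; exists (rho / 2) => [|y yx]; first by rewrite divr_gt0.
  have r120 : 0 < r1 / 2 by rewrite divr_gt0.
  apply: (@vanish_spread _ _ D L Q chi z rho (r1 / 2) sg oD sL sQ cchi lchi) => //.
  - by move=> v /zD /rD.
  - by move=> v /zD /Hs1 b j k; apply: le_trans (b j k) _; rewrite lerDl.
  - by move=> v /zD /Hs2 b j k; apply: le_trans (b j k) _; rewrite lerDr.
  - by move=> v; rewrite /cdisc /= => vr; apply: Hr1; lra.
  rewrite (_ : y - z = (y - x) - (z - x)); last by rewrite opprB addrA subrK.
  by rewrite zetaB; apply: (le_lt_trans (ler_cabsB _ _)); lra.
have oZ : open (Z : set (R * R)).
  apply: open_by_near => x [Dx [r r0 Hr]].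
  have nD : nbhs x D by exact: open_nbhs_nbhs.
  have r20 : 0 < r / 2 by rewrite divr_gt0.
  apply: filterS2 nD (near_disc x r20) => y Dy yr; split=> //.
  exists (r / 2) => // v vy; apply: Hr.
  rewrite (_ : v - x = (v - y) + (y - x)); last by rewrite addrA subrK.
  by rewrite zetaD; apply: (le_lt_trans (ler_cabsD _ _)); lra.
have oDZ : open (D `\` Z).
  apply: open_by_near => x [Dx nZx]; have [d d0 Hd] := step x Dx.
  have nD : nbhs x D by exact: open_nbhs_nbhs.
  by apply: filterS2 nD (near_disc x d0) => y Dy yd; split=> // Zy; apply: nZx; exact: Hd Zy.
have Zu : Z u.
  split; first exact: UD.
  by have [r r0 Hr] := open_cdisc oU Uu; exists r => // y /Hr /chiU.
move=> y /(cD Z oZ (fun x => @proj1 _ _) oDZ (ex_intro _ u Zu)) [_ [r r0 Hr]].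
by apply: Hr; rewrite subrr zeta0 cabs0.
Qed.

Lemma near_mx_neq0 T x : mdiff T x -> T x != 0 -> {near x, forall y, T y != 0}.
Proof.
move=> mT Tx; have [[j k] /= jk] : exists jk : 'I_N * 'I_N, T x jk.1 jk.2 != 0.
  apply: contrapT => H; move/eqP: Tx; apply; apply/matrixP => j k; rewrite mxE.
  by apply/eqP/negPn/negP => jk; apply: H; exists (j, k).
apply: filterS (ccont_neq0 (mdiff_entry_ccont j k mT) jk) => y; apply: contraNneq => ->.
by rewrite mxE.
Qed.

Definition nonvanishing D T : set (R * R) := D `&` [set y | T y != 0].

Lemma open_nonvanishing D T : open D -> mndiff 2 D T -> open (nonvanishing D T).
Proof.
move=> oD sT; apply: open_by_near => x [Dx Tx].
have nD : nbhs x D by exact: open_nbhs_nbhs.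
by apply: filterS2 nD (near_mx_neq0 (mndiff_mdiff sT Dx) Tx).
Qed.

Section Nonvanishing.
Variables (D : set (R * R)) (L Q T : mxfun R N).
Hypotheses (oD : open D) (cD : sconnected D) (sL : mndiff 2 D L) (sQ : mndiff 2 D Q).
Hypotheses (sT : mndiff 2 D T) (eqT : linear_system D L Q T).
Hypothesis T_neq0 : nonvanishing D T !=set0.

Lemma nonvanishing_dense U : open U -> U `<=` D -> U !=set0 ->
  (U `&` nonvanishing D T) !=set0.
Proof.
move=> oU UD U0; apply: contrapT => H; have [e [De /= /eqP]] := T_neq0; apply.
apply: (unique_continuation oD cD sL sQ _ _ oU UD U0) => //.
- by move=> y Dy j k; apply: mdiff_entry_ccont; exact: mndiff_mdiff sT Dy.
- by move=> y Dy _; exists D; split.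
by move=> y Uy; apply: contrapT => /eqP Ty; apply: H; exists y; split=> //; split=> //; exact: UD.
Qed.

(** A clopen part of the nonvanishing set would give a solution equal to T on that
    part and to 0 elsewhere, vanishing on a nonempty open set. *)
Lemma nonvanishing_sconnected : sconnected (nonvanishing D T).
Proof.
move=> U oU UE oEU [x0 Ux0] e Ee; apply: contrapT => nUe.
(* Off U the function chi is 0; it is continuous at the zeros of T since it is bounded
   by T. *)
pose chi y := if `[< U y >] then T y else 0.
have chiU y : U y -> chi y = T y by rewrite /chi; case: asboolP.
have chiN y : ~ U y -> chi y = 0 by rewrite /chi; case: asboolP.
have [_ /= /eqP] := UE _ Ux0; apply; rewrite -chiU //.
apply: (unique_continuation oD cD sL sQ _ _ oEU _ _ _).
- move=> y Dy j k; have cT := mdiff_entry_ccont j k (mndiff_mdiff sT Dy).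
  have [Uy|nUy] := pselect (U y).
    apply: ccont_near cT; have nU : nbhs y U by exact: open_nbhs_nbhs.
    by apply: filterS nU => z Uz; rewrite chiU.
  have [Ty|/eqP Ty] := pselect (T y = 0).
    move=> r r0; have [d d0 Hd] := cT r r0; exists d => // h /Hd.
    rewrite (chiN y) // Ty; have [Uh|nUh] := pselect (U (y + h)); first by rewrite chiU.
    by rewrite chiN // subrr cabs0.
  have Ey : (nonvanishing D T `\` U) y by split.
  apply: ccont_near (ccont_cst 0 y).
  have nU : nbhs y (nonvanishing D T `\` U) by exact: open_nbhs_nbhs.
  by apply: filterS nU => z [_ nUz]; rewrite chiN // mxE.
- move=> y Dy chiy; have Uy : U y by apply: contrapT => /chiN E; rewrite E eqxx in chiy.
  exists U; split=> //; first by move=> z /UE [].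
    apply: (mndiff_eq oU (fun z Uz => esym (chiU z Uz))).
    by apply: mndiff_subset sT => z /UE [].
  move=> z Uz; have [Dz _] := UE _ Uz; rewrite chiU // -eqT //; apply: dd_near.
  have nU : nbhs z U by exact: open_nbhs_nbhs.
  by apply: filterS nU => v Uv; rewrite chiU.
- by move=> y [[]].
- by exists e.
- by move=> y [_ nUy]; exact: chiN.
- by have [] := UE _ Ux0.
Qed.

End Nonvanishing.

Lemma zero_gradient_disc (f : R * R -> R) x (r : R) : 
  (forall y, `|y - x| < r -> [/\ differentiable f y, 'D_(1, 0) f y = 0 & 'D_(0, 1) f y = 0]) ->
  forall y, `|y - x| < r -> f y = f x.
Proof.
move=> Hf y yr; pose h := y - x.
have inr (t : R) : 0 <= t <= 1 -> `|x + t *: h - x| < r.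
  move=> /andP[t0 t1]; rewrite addrAC subrr add0r normrZ ger0_norm //.
  by apply: le_lt_trans yr; rewrite -[leRHS]mul1r ler_wpM2r.
have dline (t : R) : 0 <= t <= 1 -> is_derive t 1 (fun s => f (x + s *: h)) (0 : R).
  move=> /inr /Hf [df d1 d2]; have := is_derive_direction df.
  by rewrite derive_coord // d1 d2 !mul0r addr0.
have [||c cI] := @MVT R (fun s => f (x + s *: h)) (fun=> 0) 0 1 ltr01.
- by move=> u; rewrite in_itv /= => /andP[u0 u1]; apply/dline; rewrite !ltW.
- apply: derivable_within_continuous => u; rewrite in_itv /= => /dline.
  by case.
rewrite scale1r scale0r addr0 mul0r => /eqP; rewrite subr_eq0 => /eqP <-.
by rewrite /h addrC subrK.
Qed.

Lemma sconnected_constant D A p : open D -> sconnected D -> D p ->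
  (forall x, D x -> [/\ mdiff A x, dd true A x = 0 & dd false A x = 0]) ->
  forall x, D x -> A x = A p.
Proof.
move=> oD cD Dp HA; pose U : set (R * R) := D `&` [set y | A y = A p].
have oU : open U.
  apply: open_by_near => x [Dx /= Ax].
  have /nbhs_normP [r /= r0 Hr] := open_nbhs_nbhs (conj oD Dx).
  apply/nbhs_normP; exists r => //= y yr; split; first exact: Hr.
  have Hr' z : `|z - x| < r -> D z by move=> H; apply: Hr; rewrite /= distrC.
  rewrite /= -Ax; apply/matrixP => j k.
  have H z : `|z - x| < r -> cdiff (fun v => A v j k) z /\
      forall h, h = (1, 0) \/ h = (0, 1) -> cderive h (fun v => A v j k) z = 0.
    move=> /Hr' /HA [mA d1 d2]; split=> // h.
    have w1 : wirtinger true (fun v => A v j k) z = 0 by rewrite -ddE d1 mxE.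
    have w2 : wirtinger false (fun v => A v j k) z = 0 by rewrite -ddE d2 mxE.
    by case=> ->; rewrite ?wirtinger_ex ?wirtinger_ey w1 w2 ?subrr ?addr0 ?mulr0.
  apply: complexP.
    apply: (@zero_gradient_disc (fun v => complex.Re (A v j k)) x r _ y) => [z zr|]; last by rewrite distrC.
    have [[d1 d2] cz] := H z zr; split=> //.
      by have := cz _ (or_introl erefl); rewrite cderiveE => -[].
    by have := cz _ (or_intror erefl); rewrite cderiveE => -[].
  apply: (@zero_gradient_disc (fun v => complex.Im (A v j k)) x r _ y) => [z zr|]; last by rewrite distrC.
  have [[d1 d2] cz] := H z zr; split=> //.
    by have := cz _ (or_introl erefl); rewrite cderiveE => -[].
  by have := cz _ (or_intror erefl); rewrite cderiveE => -[].
have oDU : open (D `\` U).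
  apply: open_by_near => x [Dx nUx].
  have [mA _ _] := HA x Dx.
  have mB : mdiff (fun y => A y - A p) x by exact: mdiffB mA (mdiff_cst (A p) x).
  have Bx : A x - A p != 0 by rewrite subr_eq0; apply/eqP => E; apply: nUx; split.
  have nD : nbhs x D by exact: open_nbhs_nbhs.
  apply: filterS2 nD (near_mx_neq0 mB Bx) => y Dy; rewrite subr_eq0 => /eqP Ay.
  by split=> // -[].
by move=> x Dx; have [] := cD U oU (fun x => @proj1 _ _) oDU (ex_intro _ p (conj Dp erefl)) x Dx.
Qed.

Lemma sconnected_setT : sconnected setT.
Proof.
move=> U oU _ oCU U0 x _; apply: plane_connected oU _ U0 x.
by rewrite -setTD.
Qed.

End Continuation.

(** * Behaviour at infinity and the Liouville theorem *)

Section ChainRule.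
Context {R : realType}.
Local Notation C := R[i].
Implicit Types (f : R * R -> R) (F : R * R -> C) (g : R * R -> R) (x h : R * R).

Lemma derive_comp2 f g1 g2 x h : differentiable g1 x -> differentiable g2 x ->
  differentiable f (g1 x, g2 x) ->
  differentiable (fun y => f (g1 y, g2 y)) x /\
  'D_h (fun y => f (g1 y, g2 y)) x =
    'D_(1, 0) f (g1 x, g2 x) * 'D_h g1 x + 'D_(0, 1) f (g1 x, g2 x) * 'D_h g2 x.
Proof.
move=> d1 d2 df; have dg := differentiable_pair d1 d2.
have dfg : differentiable (f \o (fun y => (g1 y, g2 y))) x by exact: differentiable_comp.
split=> //.
rewrite -[LHS]/('D_h (f \o (fun y => (g1 y, g2 y))) x) (deriveE _ dfg) diff_comp // diff_pair //=.
rewrite -(deriveE _ df) (derive_coord _ df) /=.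
by rewrite -!deriveE.
Qed.

Lemma chain_algebra t (c : C) (p q r s : R) :
  (p * complex.Re c + q * complex.Im c) +i* (r * complex.Re c + s * complex.Im c)
   + wsign t * ((p * - complex.Im c + q * complex.Re c) +i* (r * - complex.Im c + s * complex.Re c))
  = (if t then c else conjc c) * (p +i* r + wsign t * (q +i* s)).
Proof. by case: c => a b; case: t; apply: complexP; rewrite !ReImE /=; ring. Qed.

(** Composition with a holomorphic map multiplies d_+ by its derivative and d_- by the
    conjugate of its derivative. *)
Lemma wirtinger_comp_holomorphic t F g1 g2 x (c : C) :
  cdiff F (g1 x, g2 x) -> cder (fun y => g1 y +i* g2 y) x c ->
  cdiff (fun y => F (g1 y, g2 y)) x /\
  wirtinger t (fun y => F (g1 y, g2 y)) x =
    (if t then c else conjc c) * wirtinger t F (g1 x, g2 x).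
Proof.
move=> [dRe dIm] /cder_frechet[/frechetP[/= d1 x1 y1] /frechetP[/= d2 x2 y2]].
split; first by split; [have [] := derive_comp2 (0 : R * R) d1 d2 dRe|have [] := derive_comp2 (0 : R * R) d1 d2 dIm].
rewrite !wirtingerE !cderiveE.
have [_ ->] := derive_comp2 (1, 0) d1 d2 dRe; have [_ ->] := derive_comp2 (1, 0) d1 d2 dIm.
have [_ ->] := derive_comp2 (0, 1) d1 d2 dRe; have [_ ->] := derive_comp2 (0, 1) d1 d2 dIm.
rewrite x1 x2 y1 y2 mulrCA; congr (_ * _).
exact: chain_algebra.
Qed.

Lemma zeta_recip x : zeta (recip x) = (zeta x)^-1.
Proof. by rewrite /zeta /recip; case: (_^-1). Qed.

Lemma recip_eq0 x : (recip x == 0) = (x == 0).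
Proof. by rewrite -!zeta_eq0 zeta_recip invr_eq0. Qed.

Lemma recipK x : recip (recip x) = x.
Proof. by apply: zeta_inj; rewrite !zeta_recip invrK. Qed.

Lemma cder_inv_zeta x : x != 0 -> cder (fun y => (zeta y)^-1) x (- (zeta x)^-1 ^+ 2).
Proof.
move=> x0; have [c] := cder2_cder (cder2V_zeta x0).
rewrite (_ : (fun y => _) = fun y => (zeta y)^-1); last first.
  by apply/funext => y; rewrite zeta0 subr0.
move=> Hc; suff -> : - (zeta x)^-1 ^+ 2 = c by [].
have zx : zeta x != 0 by rewrite zeta_eq0.
have H1 : cder (fun y => zeta (y - 0) * (zeta y)^-1) x (1 * (zeta x)^-1 + zeta (x - 0) * c).
  by apply: cderM => //; exact: cder_zeta_sub.
have H2 : cder (fun y => zeta (y - 0) * (zeta y)^-1) x 0.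
  apply: cder_near (cder_cst 1 x).
  apply: filterS (open_nbhs_nbhs (conj (@open_punctured _ 0) x0)) => y /= y0.
  by rewrite subr0 mulfV // zeta_eq0.
have /eqP := cder_unique H1 H2; rewrite subr0 mul1r addr_eq0 => /eqP E.
by rewrite expr2 {1}E mulNr opprK mulrC mulrA mulVf // mul1r.
Qed.

Lemma wirtinger_recip F x : x != 0 -> cdiff F (recip x) ->
  cdiff (fun y => F (recip y)) x /\
  wirtinger false (fun y => F (recip y)) x =
    - conjc (zeta (recip x)) ^+ 2 * wirtinger false F (recip x).
Proof.
move=> x0 dF.
have H := cder_inv_zeta x0.
have [||d ->] := @wirtinger_comp_holomorphic false F (fun y => complex.Re (zeta y)^-1)
  (fun y => complex.Im (zeta y)^-1) x (- (zeta x)^-1 ^+ 2).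
- exact: dF.
- by rewrite (_ : (fun y => _) = fun y => (zeta y)^-1) //; apply/funext => y; case: (_^-1).
split=> //; congr (_ * _); rewrite zeta_recip.
exact: (etrans (rmorphN (@conjc R) _) (congr1 (fun z => - z) (rmorphXn (@conjc R) 2 _))).
Qed.

End ChainRule.

Section AtInfinity.
Context {R : realType} {N : nat}.
Local Notation C := R[i].
Local Notation M := 'M[C]_N.
Implicit Types (A B : mxfun R N) (x : R * R).

Definition smooth_at_infinity n A := exists At : mxfun R N,
  mndiff n setT At /\ forall x, x != 0 -> A x = At (recip x).

(** In the coordinate 1 / x the function extends smoothly to the origin, with value 0
    there. *)
Definition vanishing_at_infinity n A := exists At : mxfun R N,
  [/\ mndiff n setT At, forall x, x != 0 -> A x = At (recip x) & At 0 = 0].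

Lemma infinity_cst n (X : M) : smooth_at_infinity n (fun=> X).
Proof. by exists (fun=> X); split=> //; exact: mndiff_cst openT. Qed.

Lemma infinity_le m n A : (m <= n)%N -> smooth_at_infinity n A -> smooth_at_infinity m A.
Proof. by move=> mn [At [sA EA]]; exists At; split=> //; exact: mndiff_le mn sA. Qed.

Lemma infinity_B n A B : smooth_at_infinity n A -> smooth_at_infinity n B ->
  smooth_at_infinity n (fun x => A x - B x).
Proof.
move=> [At [sA EA]] [Bt [sB EB]]; exists (fun w => At w - Bt w); split; first exact: mndiffB openT _ _.
by move=> x x0; rewrite EA ?EB.
Qed.

Lemma infinity_M n A B : smooth_at_infinity n A -> smooth_at_infinity n B ->
  smooth_at_infinity n (fun x => A x *m B x).
Proof.
move=> [At [sA EA]] [Bt [sB EB]]; exists (fun w => At w *m Bt w).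
by split=> [|x x0]; [exact: mndiffM openT _ _|rewrite EA ?EB].
Qed.

(** In the coordinate w the operator d_- becomes - conj(w)^2 d_-, and this factor
    vanishes at infinity. *)
Lemma infinity_dd n A : smooth_at_infinity n.+1 A -> vanishing_at_infinity n (dd false A).
Proof.
move=> [At [sA EA]].
exists (fun w => - conjc (zeta w) ^+ 2 *: dd false At w); split.
- apply: (mndiffZ openT); last by exact: mndiff_dd openT sA.
  apply: (cndiffN openT); apply: (cndiffX _ openT); apply: (cndiff_conj openT).
  exact: cndiff_zeta openT.
- move=> x x0; have nx : nbhs x [set y : R * R | y != 0].
    by apply: open_nbhs_nbhs; split=> //; exact: open_punctured.
  have -> : dd false A x = dd false (fun y => At (recip y)) x.
    by apply: dd_near; apply: filterS nx => y; exact: EA.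
  apply/matrixP => j k; rewrite mxE !ddE.
  by have [_ ->] := wirtinger_recip x0 (mndiff_mdiff sA I j k).
by rewrite zeta0 conjc0 expr0n oppr0 scale0r.
Qed.

Lemma vanishing_infinity n A : vanishing_at_infinity n A -> smooth_at_infinity n A.
Proof. by move=> [At [sA EA _]]; exists At. Qed.

Lemma vanishing_mulr n A B : vanishing_at_infinity n A -> smooth_at_infinity n B ->
  vanishing_at_infinity n (fun x => A x *m B x).
Proof.
move=> [At [sA EA A0]] [Bt [sB EB]]; exists (fun w => At w *m Bt w).
by split=> [|x x0|]; [exact: mndiffM openT _ _|rewrite EA ?EB|rewrite A0 mul0mx].
Qed.

(** The conjugate of b is holomorphic; the maximum principle on large discs bounds it
    by its values near infinity. *)
Lemma liouville (b : R * R -> C) : cndiff 2 setT b ->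
  (forall x, wirtinger true b x = 0) ->
  (forall e, 0 < e -> exists2 r, 0 < r & forall x, cabs (zeta x) >= r -> cabs (b x) < e) ->
  forall x, b x = 0.
Proof.
move=> sb wb lb x; apply/eqP; rewrite -cabs_eq0; apply/negPn/negP => bx.
have bx0 : 0 < cabs (b x) by rewrite lt_neqAle eq_sym bx cabs_ge0.
have e0 : 0 < cabs (b x) / 2 by rewrite divr_gt0.
have [r r0 Hr] := lb _ e0.
have c2 y : cder2 (fun z => conjc (b z)) y.
  apply: (cr_cder2 openT (cndiff_conj openT sb)) => // z _.
  by rewrite wirtinger_conj /= ?wb ?conjc0 //; exact: cndiff_cdiff sb I.
pose r' := Num.max r (cabs (zeta x)).
have r'0 : 0 < r' by rewrite lt_max r0.
have rr' : r <= r' by rewrite le_max lexx.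
have xr' : cabs (zeta x) <= r' by rewrite le_max lexx orbT.
have : cabs (conjc (b x)) <= cabs (b x) / 2.
  apply: (@max_modulus _ (fun z => conjc (b z)) 0 r' (cabs (b x) / 2) [::] r'0 (ltW e0)) => //.
  - by move=> y _; apply: cder2_ccont.
  - by move=> y yr; rewrite cabs_conj; apply/ltW/Hr; move: yr; rewrite subr0 => ->.
  - by rewrite /cdisc /= subr0.
by rewrite cabs_conj; lra.
Qed.

Lemma vanishing_tr_small n A : vanishing_at_infinity n.+1 A -> forall e, 0 < e ->
  exists2 r, 0 < r & forall x, cabs (zeta x) >= r -> cabs (\tr (A x)) < e.
Proof.
move=> [At [sA EA A0]] e e0.
have ct : ccont (fun w => \tr (At w)) 0.
  by apply: cdiff_ccont; apply: cdiff_tr; exact: mndiff_mdiff sA I.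
have [d d0 Hd] := ct e e0; exists (2 / d) => [|x xr]; first by rewrite divr_gt0.
have z0 : 0 < cabs (zeta x) by apply: lt_le_trans xr; rewrite divr_gt0.
have x0 : x != 0 by rewrite -zeta_eq0 -cabs_gt0.
rewrite EA //; have := Hd (recip x); rewrite add0r A0 mxtrace0 subr0; apply.
apply: le_lt_trans (norm_le_zeta _) _; rewrite zeta_recip cabsV.
rewrite invf_plt ?posrE //; apply: lt_le_trans xr.
by rewrite -[ltLHS]mul1r ltr_pM2r ?invr_gt0 // ltr1n.
Qed.

End AtInfinity.

(** * Osculating sections of a harmonic projector *)

Lemma dd_sum (R : realType) (N : nat) s (I : Type) (r : seq I) (F : I -> mxfun R N) x :
  (forall i, mdiff (F i) x) ->
  dd s (fun y => \sum_(i <- r) F i y) x = \sum_(i <- r) dd s (F i) x.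
Proof.
move=> mF; apply/matrixP => j k; rewrite ddE summxE.
rewrite (_ : (fun y => _) = fun y => \sum_(i <- r) F i y j k); last first.
  by apply/funext => y; rewrite summxE.
by rewrite wirtinger_sum; [apply: eq_bigr => i _; rewrite ddE|move=> i; exact: mF].
Qed.

Section Osculating.
Context {R : realType} {N : nat}.
Local Notation C := R[i].
Local Notation M := 'M[C]_N.
Variable P : mxfun R N.
Hypothesis P_rank1 : forall x, rank1_projector (P x).
Hypothesis P_smooth : mndiff N.+2 setT P.
Implicit Types (X Y : mxfun R N) (x : R * R) (s t : bool).

Let PP x : P x *m P x = P x. Proof. by case: (P_rank1 x). Qed.
Let aP x : adjoint (P x) = P x. Proof. by case: (P_rank1 x). Qed.
Let trP x : \tr (P x) = 1. Proof. by case: (P_rank1 x). Qed.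
Let mP x : mdiff P x. Proof. exact: mndiff_mdiff P_smooth I. Qed.
Let mQ x : mdiff (fun y => 1%:M - P y) x.
Proof. exact: mdiffB (mdiff_cst _ x) (mP x). Qed.

Lemma proj_dd t x : dd t P x = dd t P x *m P x + P x *m dd t P x.
Proof.
rewrite -(ddM t (mP x) (mP x)); congr (dd t _ x).
by apply/funext => y; rewrite PP.
Qed.

Lemma proj_sandwich_dd t x : P x *m dd t P x *m P x = 0.
Proof.
have := congr1 (fun Y : M => P x *m Y) (proj_dd t x).
rewrite mulmxDr !mulmxA PP -[X in X = _]add0r => /addIr.
by rewrite -mulmxA.
Qed.

Lemma adjoint_dd_proj t x : adjoint (dd t P x) = dd (~~ t) P x.
Proof.
rewrite -{1}[t]negbK -(dd_adjoint _ (mP x)); congr (dd _ _ x).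
by apply/funext => y; rewrite aP.
Qed.

(** Homomorphisms from the line of P to its orthogonal complement. *)
Definition hom_section X := forall x, P x *m X x = 0 /\ X x *m P x = X x.

(** The covariant derivative of homomorphisms induced by the flat connection. *)
Definition twisted t X : mxfun R N := fun x => (1%:M - P x) *m dd t X x *m P x.

Lemma twisted_hom t X : hom_section (twisted t X).
Proof.
move=> x; rewrite /twisted; split; last by rewrite -!mulmxA PP.
by rewrite !mulmxA mulmxBr mulmx1 PP subrr !mul0mx.
Qed.

Section Hom.
Variable X : mxfun R N.
Hypothesis hX : hom_section X.

Lemma hom_left x : P x *m X x = 0. Proof. by case: (hX x). Qed.
Lemma hom_right x : X x *m P x = X x. Proof. by case: (hX x). Qed.

Lemma hom_ddl t x : mdiff X x -> P x *m dd t X x = - (dd t P x *m X x).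
Proof.
move=> mX; have := ddM t (mP x) mX.
rewrite (_ : (fun y => P y *m X y) = fun=> 0); last by apply/funext => y; exact: hom_left.
by rewrite dd_cst => /esym/eqP; rewrite addrC addr_eq0 => /eqP.
Qed.

Lemma hom_ddr t x : mdiff X x -> dd t X x *m P x = dd t X x - X x *m dd t P x.
Proof.
move=> mX; have := ddM t mX (mP x).
rewrite (_ : (fun y => X y *m P y) = X); last by apply/funext => y; exact: hom_right.
by move=> {2}->; rewrite addrK.
Qed.

Lemma hom_dd_proj t x : dd t P x *m X x = P x *m dd t P x *m X x.
Proof. by rewrite {1}proj_dd mulmxDl -(mulmxA _ (P x)) hom_left mulmx0 add0r. Qed.

Lemma twistedE t x : mdiff X x ->
  twisted t X x = dd t X x + dd t P x *m X x - X x *m dd t P x.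
Proof.
move=> mX; rewrite /twisted mulmxBl mul1mx (hom_ddl t mX) opprK mulmxDl (hom_ddr t mX).
by rewrite -mulmxA hom_right addrAC.
Qed.

(** The first term is symmetric in s and t, so that the difference of both orders is
    of order zero in X. *)
Lemma twisted_twisted s t x : mndiff 2 setT X ->
  twisted s (twisted t X) x = (1%:M - P x) *m dd s (dd t X) x *m P x
    + dd s P x *m dd t P x *m X x + X x *m dd t P x *m dd s P x *m P x.
Proof.
move=> sX; have mX : mdiff X x by exact: mndiff_mdiff sX I.
have mY : mdiff (dd t X) x by exact: mndiff_mdiff (mndiff_dd t openT sX) I.
rewrite {1}/twisted (ddM s (mdiffM (mQ x) mY) (mP x)) (ddM s (mQ x) mY).
rewrite (ddB s (mdiff_cst _ x) (mP x)) dd_cst sub0r.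
have QQ : (1%:M - P x) *m (1%:M - P x) = 1%:M - P x.
  by rewrite mulmxBr mulmx1 mulmxBl mul1mx PP subrr subr0.
have QdP : (1%:M - P x) *m dd s P x = dd s P x *m P x.
  by rewrite mulmxBl mul1mx {1}proj_dd addrK.
have dXQ : dd t X x *m (1%:M - P x) = X x *m dd t P x.
  by rewrite mulmxBr mulmx1 (hom_ddr t mX) opprB addrC subrK.
have QX : (1%:M - P x) *m X x = X x by rewrite mulmxBl mul1mx hom_left subr0.
move: (1%:M - P x) QQ QdP dXQ QX => q QQ QdP dXQ QX.
rewrite !mulmxDl !mulmxDr !mulmxDl.
have -> : q *m (- dd s P x *m dd t X x *m P x) *m P x = dd s P x *m dd t P x *m X x.
  rewrite -!mulmxA PP mulNmx mulmxN !mulmxA QdP -(mulmxA _ (P x)) (hom_ddl t mX).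
  by rewrite !mulmxN !mulNmx opprK -!mulmxA hom_right.
have -> : q *m (q *m dd s (dd t X) x *m P x) *m P x = q *m dd s (dd t X) x *m P x.
  by rewrite -!mulmxA PP !mulmxA QQ.
have -> : q *m (q *m dd t X x *m dd s P x) *m P x = X x *m dd t P x *m dd s P x *m P x.
  have dPP : dd s P x *m P x = q *m (dd s P x *m P x) by rewrite mulmxA QdP -mulmxA PP.
  by rewrite -!mulmxA [in LHS]dPP (mulmxA (dd t X x)) dXQ !mulmxA QQ QX.
by rewrite [X in X + _ = _]addrC.
Qed.

End Hom.


Lemma hom_tr_proj X (Y : M) x : hom_section X -> P x *m Y *m X x = \tr (P x *m Y *m X x) *: P x.
Proof.
move=> hX; rewrite -{1}(hom_right hX) -!mulmxA (mulmxA Y) (mulmxA (P x)).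
by rewrite (rank1_sandwich _ (PP x) (trP x)).
Qed.

(** The hypothesis d_- P X = 0 removes one curvature term; the others are multiples of
    X and of d_- P P. *)
Lemma curvature_formula X x : hom_section X -> mndiff 2 setT X -> dd false P x *m X x = 0 ->
  twisted true (twisted false X) x = twisted false (twisted true X) x
   + (\tr (P x *m (dd false P x *m dd true P x)) - \tr (P x *m (dd true P x *m dd false P x))) *: X x
   - \tr (P x *m dd true P x *m X x) *: (dd false P x *m P x).
Proof.
move=> hX sX X0; rewrite !(twisted_twisted hX) // (ddC false true openT I sX).
have E s t : X x *m dd s P x *m dd t P x *m P x = \tr (P x *m (dd s P x *m dd t P x)) *: X x.
  rewrite -{1}(hom_right hX) -!mulmxA (mulmxA (dd s P x)) (mulmxA (P x)).
  by rewrite (rank1_sandwich _ (PP x) (trP x)) -scalemxAr (hom_right hX).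
have E2 : dd false P x *m dd true P x *m X x =
    \tr (P x *m dd true P x *m X x) *: (dd false P x *m P x).
  by rewrite -mulmxA (hom_dd_proj hX) {1}(hom_tr_proj _ _ hX) -scalemxAr.
rewrite !E E2 -(mulmxA (dd true P x)) X0 mulmx0 addr0 scalerBl.
move: ((1%:M - _) *m _ *m _) (_ *: (_ *m P x)) (_ *: X x) (_ *: X x) => a b c d.
by apply/matrixP => j k; rewrite !mxE; ring.
Qed.

(** Iterated covariant derivatives of d_- P P; at each point their ranges span the
    osculating space of the map. *)
Fixpoint oscul n : mxfun R N :=
  if n is m.+1 then twisted false (oscul m) else fun x => dd false P x *m P x.

Lemma oscul_hom n : hom_section (oscul n).
Proof.
case: n => [|n] x; last exact: twisted_hom.
by rewrite /= mulmxA proj_sandwich_dd -mulmxA PP.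
Qed.

Lemma mndiff_twisted t n X : mndiff n.+1 setT X -> (n <= N.+2)%N -> mndiff n setT (twisted t X).
Proof.
move=> sX nN; have sP := mndiff_le nN P_smooth.
apply: (mndiffM openT _ sP); apply: (mndiffM openT _ (mndiff_dd t openT sX)).
exact: (mndiffB openT (mndiff_cst n 1%:M openT) sP).
Qed.

Lemma mndiff0 D X : mndiff 0 D X. Proof. by []. Qed.

Lemma mndiff_oscul n : mndiff (N.+1 - n) setT (oscul n).
Proof.
elim: n => [|n IH].
  rewrite subn0 /=; apply: (mndiffM openT (mndiff_dd false openT P_smooth)).
  exact: mndiff_le (leqnSn _) P_smooth.
have [nN|Nn] := leqP n N; last by rewrite (_ : (N.+1 - n.+1)%N = 0%N) //; lia.
apply: mndiff_twisted; last by lia.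
by rewrite (_ : (N.+1 - n.+1).+1 = (N.+1 - n)%N) //; lia.
Qed.

Lemma infinity_oscul n : smooth_at_infinity N.+2 P ->
  smooth_at_infinity (N.+1 - n) (oscul n).
Proof.
move=> iP; elim: n => [|n IH].
  rewrite subn0; apply: infinity_M; last exact: infinity_le (leqnSn _) iP.
  exact: vanishing_infinity (infinity_dd iP).
have [nN|Nn] := leqP n N; last first.
  rewrite (_ : (N.+1 - n.+1)%N = 0%N); last by lia.
  exists (fun w => oscul n.+1 (recip w)); split; first exact: mndiff0.
  by move=> x _; rewrite recipK.
have iP' : smooth_at_infinity (N.+1 - n.+1) P by apply: infinity_le iP; lia.
apply: infinity_M => //; apply: infinity_M.
  by apply: infinity_B => //; exact: infinity_cst.
apply: vanishing_infinity; apply: infinity_dd.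
by rewrite (_ : (N.+1 - n.+1).+1 = (N.+1 - n)%N) //; lia.
Qed.

Definition in_span k n X := exists c : nat -> R * R -> C,
  (forall i, cndiff k setT (c i)) /\ forall x, X x = \sum_(i < n) c i x *: oscul i x.

Lemma in_span_le k k' n X : (k' <= k)%N -> in_span k n X -> in_span k' n X.
Proof. by move=> kk [c [sc E]]; exists c; split=> // i; exact: cndiff_le kk (sc i). Qed.

Lemma in_span_eq k n X Y : (forall x, X x = Y x) -> in_span k n X -> in_span k n Y.
Proof. by move=> XY [c [sc E]]; exists c; split=> // x; rewrite -XY. Qed.

Lemma in_span0 k n : in_span k n (fun=> 0).
Proof.
exists (fun _ _ => 0); split=> [i|x]; first exact: cndiff_cst openT.
by rewrite big1 // => i _; rewrite scale0r.
Qed.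

Lemma in_spanD k n X Y : in_span k n X -> in_span k n Y -> in_span k n (fun x => X x + Y x).
Proof.
move=> [c [sc EX]] [e [se EY]]; exists (fun i x => c i x + e i x); split=> [i|x].
  exact: cndiffD openT (sc i) (se i).
by rewrite EX EY -big_split; apply: eq_bigr => i _; rewrite scalerDl.
Qed.

Lemma in_span_gen k n i (f : R * R -> C) : (i < n)%N -> cndiff k setT f ->
  in_span k n (fun x => f x *: oscul i x).
Proof.
move=> ni sf; exists (fun j x => if j == i then f x else 0); split=> [j|x].
  by case: (j == i) => //; exact: cndiff_cst openT.
rewrite (bigD1 (Ordinal ni)) //= eqxx big1 ?addr0 // => j jE.
by rewrite ifN ?scale0r //; apply: contra jE => /eqP jE; apply/eqP/val_inj.
Qed.

Lemma in_span_sum k n m (F : nat -> mxfun R N) : (forall i, (i < m)%N -> in_span k n (F i)) ->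
  in_span k n (fun x => \sum_(i < m) F i x).
Proof.
elim: m => [|m IH] HF.
  by apply: in_span_eq (in_span0 k n) => x; rewrite big_ord0.
apply: in_span_eq (in_spanD (IH _) (HF m _)) => // [x|i im]; first by rewrite big_ord_recr.
by apply: HF; exact: ltnW.
Qed.

Lemma mdiff_oscul i x : (i <= N)%N -> mdiff (oscul i) x.
Proof.
move=> iN; apply: (@mndiff_mdiff _ _ (N - i) setT) => //.
by have := mndiff_oscul i; rewrite subSn.
Qed.

Lemma in_span_twisted k n X : (n <= N.+1)%N -> in_span k.+1 n X -> in_span k n.+1 (twisted false X).
Proof.
move=> nN [c [sc E]].
pose F i x := wirtinger false (c i) x *: oscul i x + c i x *: oscul i.+1 x.
have FE x : \sum_(i < n) F i x = twisted false X x.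
  have mO (i : 'I_n) : mdiff (oscul i) x by apply: mdiff_oscul; have := ltn_ord i; lia.
  have mc i : cdiff (c i) x by exact: cndiff_cdiff (sc i) I.
  have XE : X = fun x => \sum_(i < n) c i x *: oscul i x by exact/funext.
  rewrite /twisted XE dd_sum; last by move=> i; exact: mdiffZ (mc i) (mO i).
  rewrite mulmx_sumr mulmx_suml; apply: eq_bigr => i _.
  rewrite (ddZ false (mc i) (mO i)) mulmxDr mulmxDl -!scalemxAr -!scalemxAl /F; congr (_ *: _ + _).
  by rewrite mulmxBl mul1mx (hom_left (oscul_hom i)) subr0 (hom_right (oscul_hom i)).
apply: (in_span_eq FE); apply: in_span_sum => i ni; apply: in_spanD.
  by apply: in_span_gen; [exact: ltnW|exact: (cndiff_wirtinger false openT (sc i))].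
by apply: in_span_gen => //; exact: cndiff_le (leqnSn k) (sc i).
Qed.


Hypothesis P_harmonic : forall x, commutator (dd true (dd false P) x) (P x) = 0.

Lemma harmonic_comm x : dd true (dd false P) x *m P x = P x *m dd true (dd false P) x.
Proof. by have /eqP := P_harmonic x; rewrite subr_eq0 => /eqP. Qed.

Lemma mndiff_ddP t : mndiff N.+1 setT (dd t P).
Proof. exact: (mndiff_dd t openT P_smooth). Qed.

Lemma mdiff_ddP t x : mdiff (dd t P) x.
Proof. exact: mndiff_mdiff (mndiff_ddP t) I. Qed.

(** This is the Euler-Lagrange equation read on the orthogonal complement of P. *)
Lemma twisted_oscul0 x : twisted true (oscul 0) x = 0.
Proof.
rewrite /twisted /= (ddM true (mdiff_ddP false x) (mP x)) harmonic_comm.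
rewrite mulmxDr mulmxDl.
have QP : (1%:M - P x) *m P x = 0 by rewrite mulmxBl mul1mx PP subrr.
rewrite (mulmxA (1%:M - P x)) QP !mul0mx add0r.
rewrite mulmxA -mulmxA mulmxBl mul1mx {1}proj_dd addrK -mulmxA (mulmxA (P x)).
by rewrite proj_sandwich_dd mulmx0.
Qed.

(** All other terms of the product rule vanish because they contain P d P P or, by the
    Euler-Lagrange equation, P X. *)
Lemma tr_dd_hom X x : hom_section X -> mdiff X x ->
  wirtinger true (fun y => \tr (dd false P y *m X y)) x = \tr (dd false P x *m twisted true X x).
Proof.
move=> hX mX; have md := mdiff_ddP false x.
rewrite (wirtinger_tr true (mdiffM md mX)) (ddM true md mX) (twistedE hX true mX).
rewrite mulmxBr mulmxDr !raddfB /= !raddfD /=.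
have -> : \tr (dd true (dd false P) x *m X x) = 0.
  rewrite -{1}(hom_right hX) mulmxA mxtrace_mulC mulmxA -harmonic_comm.
  by rewrite -mulmxA (hom_left hX) mulmx0 mxtrace0.
have -> : \tr (dd false P x *m (dd true P x *m X x)) = 0.
  rewrite (hom_dd_proj hX) -{1}(hom_right hX) !mulmxA mxtrace_mulC !mulmxA.
  by rewrite proj_sandwich_dd !mul0mx mxtrace0.
have -> : \tr (dd false P x *m (X x *m dd true P x)) = 0.
  rewrite mulmxA (hom_dd_proj hX) -{1}(hom_right hX) -!mulmxA mxtrace_mulC -!mulmxA.
  rewrite (mulmxA (P x) (dd true P x)) proj_sandwich_dd !mulmx0 mxtrace0 //.
by rewrite add0r addr0 subr0.
Qed.

Hypothesis P_infinity : smooth_at_infinity N.+2 P.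

(** The matrix d_- P A_n is P times its trace, and the trace is annihilated by d_+ and
    vanishes at infinity. *)
Lemma dd_oscul_eq0 n : (n < N)%N ->
  (forall x, \tr (dd false P x *m twisted true (oscul n) x) = 0) ->
  forall x, dd false P x *m oscul n x = 0.
Proof.
move=> nN H x; have hO := oscul_hom n.
have k2 : (2 <= N.+1 - n)%N by lia.
have sO : mndiff 2 setT (oscul n) := mndiff_le k2 (mndiff_oscul n).
have sd : mndiff 2 setT (dd false P) by apply: mndiff_le (mndiff_ddP false); lia.
have b0 : \tr (dd false P x *m oscul n x) = 0.
  apply: (liouville (b := fun y => \tr (dd false P y *m oscul n y))).
  - exact: cndiff_tr openT (mndiffM openT sd sO).
  - by move=> y; rewrite tr_dd_hom //; exact: mndiff_mdiff sO I.
  move=> e e0; apply: (@vanishing_tr_small _ _ 0 (fun y => dd false P y *m oscul n y)) => //.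
  apply: vanishing_mulr; last by apply: infinity_le (infinity_oscul n P_infinity); lia.
  apply: infinity_dd; apply: infinity_le P_infinity; lia.
rewrite (hom_dd_proj hO) (hom_tr_proj _ _ hO).
by rewrite -(hom_dd_proj hO) b0 scale0r.
Qed.

(** Strong induction: the span condition for n makes the derivative of tr (d_- P A_n)
    a combination of traces that vanish, and the resulting equation d_- P A_n = 0 is
    what the curvature formula needs at n + 1. *)
Theorem oscul_system n : (n < N)%N ->
  (forall x, dd false P x *m oscul n x = 0) /\ in_span (N.+2 - n) n (twisted true (oscul n)).
Proof.
elim/ltn_ind: n => n IH nN.
have span_n : in_span (N.+2 - n) n (twisted true (oscul n)).
  case: n IH nN => [|n] IH nN.
    by apply: in_span_eq (in_span0 _ 0) => x; rewrite twisted_oscul0.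
  have [dO sp] := IH n (ltnSn n) (ltnW nN).
  have k2 : (2 <= N.+1 - n)%N by lia.
  have sO : mndiff 2 setT (oscul n) := mndiff_le k2 (mndiff_oscul n).
  have sub : (N.+2 - n.+1 <= N.+1)%N by lia.
  have sd t : mndiff (N.+2 - n.+1) setT (dd t P) := mndiff_le sub (mndiff_ddP t).
  have sub2 : (N.+2 - n.+1 <= N.+2)%N by lia.
  have sP := mndiff_le sub2 P_smooth.
  have sO' : mndiff (N.+2 - n.+1) setT (oscul n).
    by apply: mndiff_le (mndiff_oscul n); lia.
  apply: (in_span_eq (fun x => esym (curvature_formula (oscul_hom n) sO (dO x)))).
  apply: in_spanD; first apply: in_spanD.
  - by apply: in_span_twisted; [lia|apply: in_span_le sp; lia].
  - apply: in_span_gen => //; apply: (cndiffD openT).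
      exact: cndiff_tr openT (mndiffM openT sP (mndiffM openT (sd _) (sd _))).
    apply: (cndiffN openT).
    exact: cndiff_tr openT (mndiffM openT sP (mndiffM openT (sd _) (sd _))).
  apply: (@in_span_eq _ _ (fun x => - \tr (P x *m dd true P x *m oscul n x) *: oscul 0 x)).
    by move=> x; rewrite scaleNr.
  apply: in_span_gen => //; apply: (cndiffN openT).
  exact: cndiff_tr openT (mndiffM openT (mndiffM openT sP (sd _)) sO').
split=> //; apply: dd_oscul_eq0 => // x; have [c [_ ->]] := span_n.
rewrite mulmx_sumr raddf_sum big1 //= => i _.
have [dO _] := IH i (ltn_ord i) (ltn_trans (ltn_ord i) nN).
by rewrite -scalemxAr dO scaler0 mxtrace0.
Qed.

End Osculating.

(** * The projector on the osculating space *)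

Section Stages.
Context {R : realType} {N : nat}.
Local Notation C := R[i].
Local Notation M := 'M[C]_N.
Variable P : mxfun R N.
Hypothesis P_rank1 : forall x, rank1_projector (P x).
Hypothesis P_smooth : mndiff N.+2 setT P.
Hypothesis P_harmonic : forall x, commutator (dd true (dd false P) x) (P x) = 0.
Hypothesis P_infinity : smooth_at_infinity N.+2 P.
Implicit Types (K X : mxfun R N) (x y : R * R) (s t : bool) (D U : set (R * R)).

Local Notation a := (oscul P).

Let PP x : P x *m P x = P x. Proof. by case: (P_rank1 x). Qed.
Let aP x : adjoint (P x) = P x. Proof. by case: (P_rank1 x). Qed.
Let trP x : \tr (P x) = 1. Proof. by case: (P_rank1 x). Qed.
Let mP x : mdiff P x. Proof. exact: mndiff_mdiff P_smooth I. Qed.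
Let ha n : hom_section P (a n) := oscul_hom P_rank1 P_smooth n.
Let Pa n x : P x *m a n x = 0 := hom_left (ha n) x.
Let aP_ n x : a n x *m P x = a n x := hom_right (ha n) x.

Lemma hom_dd X t x : hom_section P X -> mdiff X x ->
  dd t X x = twisted P t X x - dd t P x *m X x + X x *m dd t P x.
Proof.
by move=> hX mX; rewrite (twistedE P_smooth hX t mX) [X in _ = X + _]addrAC addrK subrK.
Qed.

(** On the dense connected open set D the matrix K is the orthogonal projector on the
    span of the first j osculating sections, which has dimension j; the last field
    expresses that the range of K is contained in this span. *)
Record stage j D K : Prop := Stage {
  st_open : open D;
  st_conn : sconnected D;
  st_dense : forall U, open U -> U !=set0 -> (U `&` D) !=set0;
  st_smooth : mndiff (N.+2 - j) D K;
  st_idem : forall x, D x -> K x *m K x = K x;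
  st_adj : forall x, D x -> adjoint (K x) = K x;
  st_orth : forall x, D x -> K x *m P x = 0;
  st_tr : forall x, D x -> \tr (K x) = j%:R;
  st_fix : forall x, D x -> forall i, (i < j)%N -> K x *m a i x = a i x;
  st_span : forall x, D x -> forall Z : M, (forall i, (i < j)%N -> Z *m a i x = 0) -> Z *m K x = 0 }.

Lemma stage0 : stage 0 setT (fun=> 0).
Proof.
split.
- exact: openT.
- exact: sconnected_setT.
- by move=> U _ [x Ux]; exists x.
- exact: mndiff_cst openT.
- by move=> x _; rewrite mul0mx.
- by move=> x _; rewrite adjoint0.
- by move=> x _; rewrite mul0mx.
- by move=> x _; rewrite mxtrace0.
- by [].
- by move=> x _ Z _; rewrite mulmx0.
Qed.

Section Facts.
Variables (j : nat) (D : set (R * R)) (K : mxfun R N).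
Hypotheses (jN : (j < N)%N) (st : stage j D K).
Let oD := st_open st.

Lemma st_mdiff x : D x -> mdiff K x.
Proof.
move=> Dx; apply: (@mndiff_mdiff _ _ (N.+1 - j) D) => //.
by rewrite -subSn; [exact: st_smooth st|lia].
Qed.

Lemma st_near x (A B : mxfun R N) : (forall y, D y -> A y = B y) -> D x ->
  {near x, A =1 B}.
Proof.
move=> AB Dx; have nD : nbhs x D by exact: open_nbhs_nbhs.
by apply: filterS nD => y; exact: AB.
Qed.

Lemma st_PK x : D x -> P x *m K x = 0.
Proof. by move=> Dx; rewrite -aP -(st_adj st Dx) -adjointM (st_orth st Dx) adjoint0. Qed.

Lemma st_ddKP t x : D x -> dd t K x *m P x = - (K x *m dd t P x).
Proof.
move=> Dx; have := ddM t (st_mdiff Dx) (mP x).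
rewrite (dd_near t (st_near (B := fun=> 0) (fun y Dy => st_orth st Dy) Dx)) dd_cst.
by move/esym/eqP; rewrite addr_eq0 => /eqP.
Qed.

Lemma st_PddK t x : D x -> P x *m dd t K x = - (dd t P x *m K x).
Proof.
move=> Dx; have := ddM t (mP x) (st_mdiff Dx).
rewrite (dd_near t (st_near (B := fun=> 0) st_PK Dx)) dd_cst.
by move/esym/eqP; rewrite addrC addr_eq0 => /eqP.
Qed.

Lemma st_ddK t x : D x -> dd t K x = dd t K x *m K x + K x *m dd t K x.
Proof.
move=> Dx; rewrite -(ddM t (st_mdiff Dx) (st_mdiff Dx)).
by apply/esym/dd_near; apply: st_near Dx => y Dy; exact: (st_idem st Dy).
Qed.

Lemma st_adj_dd t x : D x -> adjoint (dd t K x) = dd (~~ t) K x.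
Proof.
move=> Dx; rewrite -{1}[t]negbK -(dd_adjoint _ (st_mdiff Dx)).
by apply/dd_near; apply: st_near Dx => y Dy; exact: (st_adj st Dy).
Qed.

Lemma st_KddKK t x : D x -> K x *m dd t K x *m K x = 0.
Proof.
move=> Dx; have := congr1 (fun Y : M => K x *m Y) (st_ddK t Dx).
rewrite mulmxDr !mulmxA (st_idem st Dx) -[X in X = _]add0r => /addIr.
by rewrite -mulmxA.
Qed.

Let Q x : M := 1%:M - K x - P x.

Lemma st_QP x : D x -> Q x *m P x = 0.
Proof. by move=> Dx; rewrite /Q !mulmxBl mul1mx (st_orth st Dx) subr0 PP subrr. Qed.

Lemma st_QK x : D x -> Q x *m K x = 0.
Proof. by move=> Dx; rewrite /Q !mulmxBl mul1mx (st_idem st Dx) (st_PK Dx) subrr subr0. Qed.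

Lemma st_Qa i x : D x -> K x *m a i x = a i x -> Q x *m a i x = 0.
Proof. by move=> Dx Ka; rewrite /Q !mulmxBl mul1mx Ka Pa subrr subr0. Qed.

(** The derivative of K maps an osculating section to the component of its own
    derivative outside K, so the derivative of K has its range in that of K + P as
    soon as covariant derivatives of the osculating sections lie in the range of K +
    P. *)
Lemma st_horizontal t x : D x ->
  (forall i, (i < j)%N -> Q x *m twisted P t (a i) x = 0) -> Q x *m dd t K x = 0.
Proof.
move=> Dx H; have E i : (i < j)%N -> Q x *m dd t K x *m a i x = 0.
  move=> ij; have ma : mdiff (a i) x by apply: (mdiff_oscul P_smooth); lia.
  have E1 : dd t K x *m a i x = dd t (a i) x - K x *m dd t (a i) x.
    apply/eqP; rewrite eq_sym subr_eq -(ddM t (st_mdiff Dx) ma); apply/eqP/esym/dd_near.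
    by apply: st_near Dx => y Dy; exact: (st_fix st Dy).
  rewrite -mulmxA E1 mulmxBr mulmxA (st_QK Dx) mul0mx subr0.
  have -> : dd t (a i) x = twisted P t (a i) x - dd t P x *m a i x + a i x *m dd t P x.
    exact: hom_dd (ha i) ma.
  rewrite mulmxDr mulmxBr H // (hom_dd_proj P_rank1 P_smooth (ha i)) !mulmxA (st_QP Dx).
  by rewrite (st_Qa Dx (st_fix st Dx ij)) !mul0mx subrr addr0.
have QK0 := st_span st Dx E.
rewrite (st_ddK t Dx) mulmxDr !mulmxA (st_QK Dx) mul0mx addr0.
exact: QK0.
Qed.

Lemma span_fix i x : D x -> (i <= j)%N -> (1%:M - K x) *m twisted P true (a i) x = 0.
Proof.
move=> Dx ij; have [|_ [c [_ ->]]] := oscul_system P_rank1 P_smooth P_harmonic P_infinity (n := i).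
  by lia.
rewrite mulmx_sumr big1 // => k _; rewrite -scalemxAr mulmxBl mul1mx.
by rewrite (st_fix st Dx) ?subrr ?scaler0 //; apply: leq_trans ij.
Qed.

Lemma st_ddKK x : D x -> dd true K x *m K x = - (dd true P x *m K x).
Proof.
move=> Dx; have : Q x *m dd true K x = 0.
  apply: st_horizontal => // i ij; rewrite /Q mulmxBl span_fix ?(ltnW ij) // sub0r.
  by rewrite (hom_left (twisted_hom P_rank1 true (a i))) oppr0.
move=> /(congr1 (fun Y : M => Y *m K x)); rewrite mul0mx /Q !mulmxBl mul1mx.
rewrite (st_KddKK _ Dx) subr0 (st_PddK true Dx) mulNmx opprK -(mulmxA _ (K x)) (st_idem st Dx).
by move/eqP; rewrite addr_eq0 => /eqP.
Qed.

Let T : mxfun R N := fun y => (1%:M - K y) *m a j y.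

Lemma mndiff_T : mndiff (N.+1 - j) D T.
Proof.
apply: (mndiffM oD); last exact: mndiff_subset (mndiff_oscul P_smooth j).
apply: (mndiffB oD (mndiff_cst _ _ oD)); apply: mndiff_le (st_smooth st); lia.
Qed.

(** The derivatives of K and P recombine because (d_+ K + d_+ P) K = 0. *)
Lemma T_system : linear_system D (fun y => - (dd true K y + dd true P y)) (dd true P) T.
Proof.
move=> x Dx; have ma : mdiff (a j) x by apply: (mdiff_oscul P_smooth); lia.
have mK := st_mdiff Dx.
rewrite /T (ddM true (mdiffB (mdiff_cst 1%:M x) mK) ma) (ddB true (mdiff_cst 1%:M x) mK).
rewrite dd_cst sub0r.
have -> : dd true (a j) x = twisted P true (a j) x - dd true P x *m a j x + a j x *m dd true P x.
  exact: hom_dd (ha j) ma.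
rewrite mulmxDr mulmxBr (span_fix Dx (leqnn j)) sub0r.
have -> : (1%:M - K x) *m (dd true P x *m a j x) = dd true P x *m a j x.
  rewrite (hom_dd_proj P_rank1 P_smooth (ha j)) !mulmxA !mulmxBl mul1mx.
  by rewrite (st_orth st Dx) !mul0mx subr0.
rewrite addrA mulmxA mulNmx -opprD -mulmxDl; congr (_ + _).
have z : (dd true K x + dd true P x) *m K x = 0 by rewrite mulmxDl (st_ddKK Dx) addNr.
by rewrite mulNmx mulmxBl mul1mx mulmxBr (mulmxA _ (K x)) z mul0mx subr0.
Qed.

(** If T = 0 the span of the osculating sections is stable under both covariant
    derivatives; the component of d K outside K + P vanishes for both operators, and
    only the terms with d P remain. *)
Lemma stop_facts : (forall x, D x -> T x = 0) -> forall x, D x ->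
  [/\ dd true K x = - (P x *m dd true P x), dd false K x = - (dd false P x *m P x),
      K x *m (dd false P x *m P x) = dd false P x *m P x & dd false P x *m K x = 0].
Proof.
move=> T0 x Dx.
have fix_ i : (i <= j)%N -> K x *m a i x = a i x.
  rewrite leq_eqVlt => /orP[/eqP ->|ij]; last exact: (st_fix st Dx).
  by have /eqP := T0 x Dx; rewrite /T mulmxBl mul1mx subr_eq0 => /eqP.
have Ka0 : K x *m (dd false P x *m P x) = dd false P x *m P x := fix_ 0 (leq0n j).
have dPK : dd false P x *m K x = 0.
  apply: (st_span st Dx) => i ij.
  by have [dO _] := oscul_system P_rank1 P_smooth P_harmonic P_infinity (ltn_trans ij jN).
have KdP : K x *m dd true P x = 0.
  have := congr1 (@adjoint R N) dPK.
  by rewrite adjointM (st_adj st Dx) (adjoint_dd_proj P_rank1 P_smooth) adjoint0.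
have dPK' : dd true P x *m K x = P x *m dd true P x.
  rewrite {1}(proj_dd P_rank1 P_smooth) mulmxDl -(mulmxA _ (P x)) (st_PK Dx) mulmx0 add0r.
  have := congr1 (@adjoint R N) Ka0.
  by rewrite !adjointM (st_adj st Dx) aP (adjoint_dd_proj P_rank1 P_smooth).
have h2 : Q x *m dd false K x = 0.
  apply: st_horizontal => // i ij; rewrite -[twisted P false (a i)]/(a i.+1).
  by apply: st_Qa => //; exact: fix_.
have E1 : dd true K x = - (P x *m dd true P x).
  have := congr1 (@adjoint R N) h2; rewrite adjointM (st_adj_dd false Dx) adjoint0 /=.
  rewrite /Q !adjointB adjoint1 (st_adj st Dx) aP !mulmxBr mulmx1 (st_ddKK Dx) (st_ddKP true Dx).
  by rewrite KdP oppr0 subr0 opprK dPK' => /eqP; rewrite addr_eq0 => /eqP.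
split=> //; rewrite -[false]/(~~ true) -(st_adj_dd true Dx) E1 adjointN adjointM aP.
by rewrite (adjoint_dd_proj P_rank1 P_smooth).
Qed.

(** The range of T is a line orthogonal to K and to P, and T does not vanish on a
    dense connected open set. *)
Lemma stage_step : nonvanishing D T !=set0 ->
  stage j.+1 (nonvanishing D T) (fun y => K y + line_projector (T y)).
Proof.
move=> T_neq0.
have sT := mndiff_T.
have sT2 : mndiff 2 D T by apply: mndiff_le sT; lia.
have sK' : mndiff (N.+1 - j).+1 D K by apply: mndiff_le (st_smooth st); lia.
have sL : mndiff 2 D (fun y => - (dd true K y + dd true P y)).
  apply: (mndiffN oD); apply: (mndiffD oD).
    by apply: mndiff_le (mndiff_dd true oD sK'); lia.
  by apply: mndiff_le (mndiff_subset (@subsetT _ D) (mndiff_ddP P_smooth true)); lia.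
have sQ : mndiff 2 D (dd true P).
  by apply: mndiff_le (mndiff_subset (@subsetT _ D) (mndiff_ddP P_smooth true)); lia.
have TP x : T x *m P x = T x by rewrite /T -mulmxA aP_.
have KT x : D x -> K x *m T x = 0.
  by move=> Dx; rewrite /T mulmxA mulmxBr mulmx1 (st_idem st Dx) subrr mul0mx.
have PT x : D x -> P x *m T x = 0.
  by move=> Dx; rewrite /T mulmxA mulmxBr mulmx1 (st_PK Dx) subr0 Pa.
have mulL x (Z : M) : Z *m T x = 0 -> Z *m line_projector (T x) = 0.
  by move=> ZT; rewrite /line_projector -scalemxAr mulmxA ZT mul0mx scaler0.
have adjL x : adjoint (line_projector (T x)) = line_projector (T x).
  by rewrite /line_projector adjointZ adjointM adjointK conjc_inv conj_tr_mul_adjoint.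
have KL x : D x -> K x *m line_projector (T x) = 0 by move/KT/mulL.
have LK x : D x -> line_projector (T x) *m K x = 0.
  by move=> Dx; rewrite -adjL -(st_adj st Dx) -adjointM KL // adjoint0.
have LP x : D x -> line_projector (T x) *m P x = 0.
  by move=> Dx; rewrite -adjL -aP -adjointM (mulL _ _ (PT _ Dx)) adjoint0.
have L1 x : nonvanishing D T x -> rank1_projector (line_projector (T x)).
  by move=> [_ Tx]; exact: line_projector_rank1 (PP x) (aP x) (trP x) (TP x) Tx.
split.
- exact: open_nonvanishing oD sT2.
- exact: (nonvanishing_sconnected oD (st_conn st) sL sQ sT2 T_system).
- move=> U oU /(st_dense st oU) UD.
  have oUD : open (U `&` D) by exact: openI.
  have [x [[Ux _] Ex]] := nonvanishing_dense oD (st_conn st) sL sQ sT2 T_system T_neq0 oUD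
    (@subIsetr _ U D) UD.
  by exists x.
- have oE := open_nonvanishing oD sT2.
  have ED : nonvanishing D T `<=` D by move=> x [].
  have sTE : mndiff (N.+2 - j.+1) (nonvanishing D T) T by rewrite subSS; exact: mndiff_subset ED sT.
  have sTT := mndiffM oE sTE (mndiff_adjoint oE sTE).
  apply: (mndiffD oE); first by apply: mndiff_subset ED (mndiff_le _ (st_smooth st)); lia.
  apply: (mndiffZ oE _ sTT); apply: (cndiffV oE _ (cndiff_tr oE sTT)).
  by move=> x [_ Tx]; rewrite tr_mul_adjoint_eq0.
- move=> x Ex; have [Dx _] := Ex; have [LL _ _] := L1 x Ex.
  by rewrite mulmxDl !mulmxDr (st_idem st Dx) KL // LK // LL addr0 add0r.
- by move=> x [Dx _]; rewrite adjointD (st_adj st Dx) adjL.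
- by move=> x [Dx _]; rewrite mulmxDl (st_orth st Dx) LP // addr0.
- move=> x Ex; have [Dx _] := Ex; have [_ _ tL] := L1 x Ex.
  by rewrite mxtraceD (st_tr st Dx) tL -natr1.
- move=> x [Dx /= Tx] i; rewrite ltnS leq_eqVlt mulmxDl => /orP[/eqP ->|ij].
    have -> : a j x = T x + K x *m a j x by rewrite /T mulmxBl mul1mx subrK.
    rewrite !mulmxDr KT // mulmxA (st_idem st Dx) (mulmxA _ (K x)) LK // mul0mx addr0 add0r.
    by rewrite (line_projectorK (PP x) (aP x) (trP x) (TP x) Tx) addrC.
  rewrite (st_fix st Dx ij); have -> : line_projector (T x) *m a i x = 0.
    by rewrite -(st_fix st Dx ij) mulmxA LK // mul0mx.
  by rewrite addr0.
move=> x [Dx /= Tx] Z HZ; have ZK : Z *m K x = 0.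
  by apply: (st_span st Dx) => i ij; apply: HZ; exact: ltnW.
rewrite mulmxDr ZK add0r; apply: mulL.
by rewrite /T mulmxA mulmxBr mulmx1 ZK subr0 HZ.
Qed.

End Facts.

Lemma stage_nonempty j D K : stage j D K -> D !=set0.
Proof.
move=> st; have [|x [_ Dx]] := st_dense st openT; first by exists 0.
by exists x.
Qed.

(** K + P is a projector with trace j + 1. *)
Lemma stage_bound j D K : stage j D K -> (j < N)%N.
Proof.
move=> st; have [x Dx] := stage_nonempty st.
have i : (K x + P x) *m (K x + P x) = K x + P x.
  rewrite mulmxDl !mulmxDr (st_idem st Dx) (st_orth st Dx) PP addr0.
  have -> : P x *m K x = 0 by rewrite -aP -(st_adj st Dx) -adjointM (st_orth st Dx) adjoint0.
  by rewrite add0r.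
have /eqP := idempotent_rank i; rewrite mxtraceD (st_tr st Dx) trP natr1 eqr_nat => /eqP ->.
exact: rank_leq_row.
Qed.

(** Otherwise every stage could be continued, against the bound on traces. *)
Theorem osculating_projector : exists D K j, [/\ stage j D K, (j < N)%N & forall x, D x ->
  [/\ dd true K x = - (P x *m dd true P x), dd false K x = - (dd false P x *m P x),
      K x *m (dd false P x *m P x) = dd false P x *m P x & dd false P x *m K x = 0]].
Proof.
apply: contrapT => H.
suff H2 j : exists D K, stage j D K.
  by have [D [K /stage_bound]] := H2 N; rewrite ltnn.
elim: j => [|j [D [K st]]]; first by exists setT, (fun=> 0); exact: stage0.
have jN := stage_bound st.
have [T_neq0|T0] := pselect (nonvanishing D (fun y => (1%:M - K y) *m a j y) !=set0).
  by have st' := stage_step jN st T_neq0; do 2 eexists; exact: st'.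
exfalso; apply: H; exists D, K, j; split=> // x Dx.
apply: (stop_facts jN st) => // y Dy; apply: contrapT => /eqP Ty.
by apply: T0; exists y.
Qed.

End Stages.

(** * The associated surface and orthogonality of the sequence *)

Section Surface.
Context {R : realType} {N : nat}.
Local Notation C := R[i].
Local Notation M := 'M[C]_N.
Implicit Types (A B K X F : mxfun R N) (x y : R * R) (s t : bool) (D U : set (R * R)).

(** The partial derivatives are combinations of the two Wirtinger derivatives. *)
Lemma mndiff_by_dd n D A : open D -> (forall x, D x -> mdiff A x) ->
  mndiff n D (dd true A) -> mndiff n D (dd false A) -> mndiff n.+1 D A.
Proof.
move=> oD mA s1 s2 j k.
have cE h : cndiff n D (cderive h (fun y => A y j k)) ->
    ndiff n D (fun y => 'D_h (fun z => complex.Re (A z j k)) y) /\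
    ndiff n D (fun y => 'D_h (fun z => complex.Im (A z j k)) y).
  by move=> [a b]; split; [apply: ndiff_eq a|apply: ndiff_eq b] => // y _; rewrite cderiveE.
have w1 : cndiff n D (wirtinger true (fun y => A y j k)).
  by apply: cndiff_eq (s1 j k) => // y _; rewrite ddE.
have w2 : cndiff n D (wirtinger false (fun y => A y j k)).
  by apply: cndiff_eq (s2 j k) => // y _; rewrite ddE.
have [|a1 b1] := cE (1, 0).
  by apply: cndiff_eq (cndiffD oD w1 w2) => // y _; rewrite wirtinger_ex.
have [|a2 b2] := cE (0, 1).
  apply: cndiff_eq (cndiffM oD (cndiff_cst n 'i oD) (cndiffD oD w1 (cndiffN oD w2))) => // y _.
  by rewrite wirtinger_ey.
by split; split=> // x Dx; have [] := mA x Dx j k.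
Qed.

Lemma dense_eq0 D B : (forall U, open U -> U !=set0 -> (U `&` D) !=set0) ->
  (forall x, mdiff B x) -> (forall x, D x -> B x = 0) -> forall x, B x = 0.
Proof.
move=> dD mB B0 x; apply: contrapT => /eqP Bx.
have oU : open ([set y | B y != 0] : set (R * R)).
  by apply: open_by_near => y By; exact: near_mx_neq0.
have [|y [/= + Dy]] := dD _ oU; first by exists x.
by rewrite B0 // eqxx.
Qed.

Variables (P F : mxfun R N).
Hypothesis P_rank1 : forall x, rank1_projector (P x).
Hypothesis P_smooth : mndiff N.+2 setT P.
Hypothesis F_surface : associated_surface P F.

Let PP x : P x *m P x = P x. Proof. by case: (P_rank1 x). Qed.
Let aP x : adjoint (P x) = P x. Proof. by case: (P_rank1 x). Qed.
Let mP x : mdiff P x. Proof. exact: mndiff_mdiff P_smooth I. Qed.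

Lemma surface_mdiff x : mdiff F x.
Proof. by move=> j k; have [_ dF _] := F_surface; exact: dF. Qed.

Lemma surface_algebra (i o o' u u' a b : C) :
  i * i = -1 -> o = 1 -> o' = 1 -> u = i -> u' = - i ->
  2^-1 * (i * (- (o * a) + o' * b) - i * (i * (- (u * a) + u' * b))) = - i * a /\
  2^-1 * (i * (- (o * a) + o' * b) + i * (i * (- (u * a) + u' * b))) = i * b.
Proof.
move=> i2 -> -> -> ->; split.
  transitivity (2^-1 * (i * (b - a) + (i * i) * (i * a + i * b))); first by ring.
  by rewrite i2; field.
transitivity (2^-1 * (i * (b - a) - (i * i) * (i * a + i * b))); first by ring.
by rewrite i2; field.
Qed.

Lemma surface_dd t x : dd t F x = (if t then - 'i else 'i) *: commutator (dd t P x) (P x).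
Proof.
have [_ _ H] := F_surface; have i2 : 'i * 'i = -1 :> C by rewrite -expr2 sqr_i.
have o1 : 1 -i* 0 = 1 :> C by rewrite oppr0.
have o2 : 0 -i* 1 = - 'i :> C by apply: complexP; rewrite /= ?oppr0.
have key (a b : C) := @surface_algebra 'i (1 +i* 0) (1 -i* 0) (0 +i* 1) (0 -i* 1) a b i2 erefl o1 erefl o2.
have E10 := H x (1, 0); have E01 := H x (0, 1); move: E10 E01 => /=.
case: t; rewrite ?dd_true ?dd_false; move: (commutator _ _) (commutator _ _) => b a.
  rewrite /dplus => -> ->; apply/matrixP => j k; rewrite !mxE.
  by have [+ _] := key (a j k) (b j k).
rewrite /dminus => -> ->; apply/matrixP => j k; rewrite !mxE.
by have [_] := key (a j k) (b j k).
Qed.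

Lemma tr_commutator (X Q P0 : M) : P0 *m Q = Q *m P0 -> \tr (Q *m commutator X P0) = 0.
Proof.
move=> PQ; rewrite /commutator mulmxBr raddfB /= !mulmxA mxtrace_mulC mulmxA PQ.
by rewrite subrr.
Qed.

Lemma su_product_surface t (Q : M) x : P x *m Q = Q *m P x -> su_product Q (dd t F x) = 0.
Proof.
by move=> PQ; rewrite /su_product surface_dd -scalemxAr mxtraceZ tr_commutator // !mulr0.
Qed.

(** Its derivatives are those of the projector on the osculating space, where the
    latter is defined. *)
Definition surface_potential : mxfun R N := fun x => 2^-1 *: ('i *: F x - P x).

Lemma surface_potential_dd x : [/\ mdiff surface_potential x,
  dd true surface_potential x = - (P x *m dd true P x) &
  dd false surface_potential x = - (dd false P x *m P x)].
Proof.
have ci (c : C) : cdiff (fun=> c) x by exact: cdiff_cst.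
have mF := surface_mdiff x.
have m1 := mdiffZ (ci 'i) mF; have m2 := mdiffB m1 (mP x).
have E t : dd t surface_potential x = 2^-1 *: ('i *: dd t F x - dd t P x).
  rewrite (ddZ t (ci 2^-1) m2) wirtinger_cst scale0r add0r (ddB t m1 (mP x)).
  by rewrite (ddZ t (ci 'i) mF) wirtinger_cst scale0r add0r.
have i2 : 'i * 'i = -1 :> C by rewrite -expr2 sqr_i.
split; first exact: mdiffZ (ci 2^-1) m2.
  rewrite E surface_dd scalerA mulrN i2 opprK scale1r {2}(proj_dd P_rank1 P_smooth) /commutator.
  move: (_ *m _) (_ *m _) => a b; apply/matrixP => j k; rewrite !mxE.
  by move: (a j k) (b j k) => u v; field.
rewrite E surface_dd scalerA i2 scaleN1r {2}(proj_dd P_rank1 P_smooth) /commutator.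
move: (_ *m _) (_ *m _) => a b; apply/matrixP => j k; rewrite !mxE.
by move: (a j k) (b j k) => u v; field.
Qed.

Hypothesis P_harmonic : forall x, commutator (dd true (dd false P) x) (P x) = 0.
Hypothesis P_infinity : smooth_at_infinity N.+2 P.

Record osculating_extension K : Prop := OsculatingExtension {
  oe_mdiff : forall x, mdiff K x;
  oe_idem : forall x, K x *m K x = K x;
  oe_adj : forall x, adjoint (K x) = K x;
  oe_orth : forall x, K x *m P x = 0;
  oe_dd_true : forall x, dd true K x = - (P x *m dd true P x);
  oe_dd_false : forall x, dd false K x = - (dd false P x *m P x);
  oe_fix : forall x, K x *m (dd false P x *m P x) = dd false P x *m P x;
  oe_kill : forall x, dd false P x *m K x = 0 }.

(** On the connected set D the difference of K and the potential is constant; the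
    algebraic relations then extend from the dense set D by continuity. *)
Theorem osculating_extension_exists : exists K, osculating_extension K.
Proof.
have [D [K0 [j [st jN HK]]]] := osculating_projector P_rank1 P_smooth P_harmonic P_infinity.
have [p Dp] := stage_nonempty st.
pose G := surface_potential; pose K x := G x + (K0 p - G p).
have dG x := surface_potential_dd x.
have mK x : mdiff K x by have [mG _ _] := dG x; exact: mdiffD mG (mdiff_cst _ x).
have ddK t x : dd t K x = dd t G x.
  by have [mG _ _] := dG x; rewrite (ddD t mG (mdiff_cst _ x)) dd_cst addr0.
have KE x : D x -> K x = K0 x.
  move=> Dx; have : K0 x - G x = K0 p - G p; last by rewrite /K => <-; rewrite addrC subrK.
  apply: (sconnected_constant (A := fun y => K0 y - G y) (st_open st) (st_conn st) Dp _ Dx).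
  move=> y Dy; have [mG g1 g2] := dG y; have [k1 k2 _ _] := HK y Dy.
  have mK0 := st_mdiff jN st Dy.
  split; first exact: mdiffB.
    by rewrite (ddB true mK0 mG) g1 k1 subrr.
  by rewrite (ddB false mK0 mG) g2 k2 subrr.
have dens B : (forall x, mdiff B x) -> (forall x, D x -> B x = 0) -> forall x, B x = 0.
  exact: dense_eq0 (st_dense st).
have mA x : mdiff (fun y => dd false P y *m P y) x.
  exact: mdiffM (mdiff_ddP P_smooth false x) (mP x).
exists K; split=> //.
- move=> x; apply/eqP; rewrite -subr_eq0; apply/eqP; move: x; apply: dens => x.
    exact: mdiffB (mdiffM (mK x) (mK x)) (mK x).
  by move=> Dx; rewrite KE // (st_idem st Dx) subrr.
- move=> x; apply/eqP; rewrite -subr_eq0; apply/eqP; move: x; apply: dens => x.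
    exact: mdiffB (mdiff_adjoint (mK x)) (mK x).
  by move=> Dx; rewrite KE // (st_adj st Dx) subrr.
- apply: dens => x; first exact: mdiffM (mK x) (mP x).
  by move=> Dx; rewrite KE // (st_orth st Dx).
- by move=> x; rewrite ddK; have [_ -> _] := dG x.
- by move=> x; rewrite ddK; have [_ _ ->] := dG x.
- move=> x; apply/eqP; rewrite -subr_eq0; apply/eqP; move: x; apply: dens => x.
    exact: mdiffB (mdiffM (mK x) (mA x)) (mA x).
  by move=> Dx; rewrite KE //; have [_ _ -> _] := HK x Dx; rewrite subrr.
apply: dens => x; first exact: mdiffM (mdiff_ddP P_smooth false x) (mK x).
by move=> Dx; rewrite KE //; have [_ _ _ ->] := HK x Dx.
Qed.

Section Pairs.
Variable K : mxfun R N.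
Hypothesis oeK : osculating_extension K.

Let PK x : P x *m K x = 0.
Proof. by rewrite -aP -(oe_adj oeK) -adjointM (oe_orth oeK) adjoint0. Qed.

Let sP2 : mndiff 2 setT P. Proof. exact: mndiff_le P_smooth. Qed.

Let sK2 : mndiff 2 setT K.
Proof.
have sP1 : mndiff 1 setT P by exact: mndiff_le sP2.
have sd t : mndiff 1 setT (dd t P) by apply: mndiff_le (mndiff_ddP P_smooth t).
apply: mndiff_by_dd openT _ _ _; first by move=> x _; exact: oe_mdiff oeK x.
  have -> : dd true K = fun x => - (P x *m dd true P x) by apply/funext => x; exact: oe_dd_true.
  exact: mndiffN openT (mndiffM openT sP1 (sd true)).
have -> : dd false K = fun x => - (dd false P x *m P x) by apply/funext => x; exact: oe_dd_false.
exact: mndiffN openT (mndiffM openT (sd false) sP1).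
Qed.

Let PdPK x : P x *m dd true P x *m K x = P x *m dd true P x.
Proof.
have := congr1 (@adjoint R N) (oe_fix oeK x).
by rewrite !adjointM (oe_adj oeK) aP (adjoint_dd_proj P_rank1 P_smooth).
Qed.

(** Raising starts from the span of the sections obtained by d_-. *)
Lemma osculating_pair : holo_pair true K P.
Proof.
split=> //= x; rewrite ?(oe_idem oeK) ?(oe_adj oeK) ?(oe_orth oeK) //.
- rewrite (ddD false (oe_mdiff oeK x) (mP x)) (oe_dd_false oeK) mulmxDl !mulmxDr !mulNmx.
  by rewrite -!mulmxA PK PP mulmx0 oppr0 (oe_kill oeK) !add0r addNr.
- by rewrite (oe_dd_false oeK) mulNmx -mulmxA PK mulmx0 oppr0.
have QP : (1%:M - (K x + P x)) *m P x = 0.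
  by rewrite mulmxBl mul1mx mulmxDl (oe_orth oeK) PP add0r subrr.
by rewrite (oe_dd_true oeK) mulmxN mulNmx mulmxA QP !mul0mx oppr0.
Qed.

(** Lowering starts from the orthogonal complement of K + P, which plays the same role
    for the opposite orientation. *)
Lemma complementary_pair : holo_pair false (fun x => 1%:M - K x - P x) P.
Proof.
pose K' x : M := 1%:M - K x - P x.
have mK x : mdiff K x := oe_mdiff oeK x.
have PK' x : P x *m K' x = 0 by rewrite /K' !mulmxBr mulmx1 PK PP subr0 subrr.
have K'P x : K' x *m P x = 0 by rewrite /K' !mulmxBl mul1mx (oe_orth oeK) PP subr0 subrr.
have K'E x : K' x + P x = 1%:M - K x by rewrite /K' subrK.
have m1 x : mdiff (fun y => 1%:M - K y) x by exact: mdiffB (mdiff_cst _ x) (mK x).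
have d1 t x : dd t (fun y => 1%:M - K y) x = - dd t K x.
  by rewrite (ddB t (mdiff_cst _ x) (mK x)) dd_cst sub0r.
have dK' t x : dd t K' x = - dd t K x - dd t P x by rewrite (ddB t (m1 x) (mP x)) d1.
split=> //; rewrite -/K'.
- exact: mndiffB openT (mndiffB openT (mndiff_cst 2 1%:M openT) sK2) sP2.
- move=> x; rewrite -/(K' x) {1}/K' !mulmxBl mul1mx PK' subr0 {2}/K' !mulmxBr mulmx1.
  by rewrite (oe_idem oeK) (oe_orth oeK) subrr !subr0.
- by move=> x; rewrite !adjointB adjoint1 (oe_adj oeK) aP.
- move=> x; rewrite -/(K' x) K'E.
  have -> : (fun y => 1%:M - K y - P y + P y) = fun y => 1%:M - K y.
    by apply/funext => y; rewrite subrK.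
  by rewrite d1 (oe_dd_true oeK) opprK mulmxBr mulmx1 PdPK subrr.
- move=> x; rewrite -/(K' x) dK' (oe_dd_true oeK) opprK {2}(proj_dd P_rank1 P_smooth).
  by rewrite opprD addrCA subrr addr0 mulNmx -mulmxA PK' mulmx0 oppr0.
move=> x; rewrite -/(K' x) K'E dK' (oe_dd_false oeK) opprK {2}(proj_dd P_rank1 P_smooth).
have -> : 1%:M - (1%:M - K x) = K x by rewrite opprB addrC subrK.
by rewrite opprD addrA subrr add0r mulmxN mulNmx mulmxA (oe_orth oeK) !mul0mx oppr0.
Qed.

End Pairs.

Theorem sequence_commutes Q : in_projector_sequence P Q -> forall x, P x *m Q x = Q x *m P x.
Proof.
have [K oeK] := osculating_extension_exists.
have ladderE (d d' : mxfun R N -> mxfun R N) s : d = dd s -> d' = dd (~~ s) ->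
    forall K, holo_pair s K P -> forall k x, P x *m iter k (ladder d d') P x =
      iter k (ladder d d') P x *m P x.
  move=> -> -> K0 hp [|k] x //.
  by have [-> ->] := ladder_orthogonal hp (isT : k.+1 != 0)%N x.
have dT : @dplus R N = dd true by apply/funext => A; rewrite dd_true.
have dF : @dminus R N = dd false by apply/funext => A; rewrite dd_false.
move=> [k [->|->]]; first exact: ladderE dT dF K (osculating_pair oeK) k.
exact: ladderE dF dT _ (complementary_pair oeK) k.
Qed.

End Surface.

Theorem mainTheorem6 (R : realType) (N : nat)
    (P : sphere R -> 'M[R[i]%C]_N)
    (P_projector : forall z : sphere R, rank1_projector (P z))
    (P_differentiable : sphere_n_differentiable (N + 2)%N P)
    (P_EL : euler_lagrange (finite_chart P))
    (P_action : (action (finite_chart P) < +oo)%E)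
    (F : mxfun R N)
    (F_surface : associated_surface (finite_chart P) F)
    (Q : mxfun R N)
    (Q_sequence : in_projector_sequence (finite_chart P) Q) :
  forall x : R * R,
    su_product (Q x) (dplus F x) = 0%R /\ su_product (Q x) (dminus F x) = 0%R.
Proof.
have [smooth_fin smooth_inf] := P_differentiable; rewrite addn2 in smooth_fin smooth_inf.
have mxE A : mx_n_differentiable N.+2 A -> mndiff N.+2 setT (A : mxfun R N).
  move=> H j k; have [H1 H2] := H j k.
  by split; [exact: (proj1 (n_differentiableE _ _) H1)|exact: (proj1 (n_differentiableE _ _) H2)].
have rank1 x : rank1_projector (finite_chart P x) by exact: P_projector.
have harmonic x : commutator (dd true (dd false (finite_chart P)) x) (finite_chart P x) = 0.
  by rewrite dd_true dd_false; exact: P_EL.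
have infinity : smooth_at_infinity N.+2 (finite_chart P).
  exists (infinite_chart P); split=> [|x x0]; first exact: mxE.
  by rewrite /infinite_chart recip_eq0 (negbTE x0) recipK.
have comm := sequence_commutes rank1 (mxE _ smooth_fin) F_surface harmonic infinity Q_sequence.
move=> x; rewrite -dd_true -dd_false.
by split; apply: (su_product_surface F_surface).
Qed.
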